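(* Let $X$ be a Banach space and let $T\colon X\to X$ be an $R$-Ritt operator of $R$-type $\alpha\in\bigl(0,\frac{\pi}{2}\bigr)$. If $T$ and $T^*$ both satisfy uniform estimates, i.e. there is a constant $C>0$ such that $\|x\|_{T,1}\leq C\|x\|$ for all $x\in X$ and $\|y\|_{T^*,1}\leq C\|y\|$ for all $y\in X^*$, then $T$ admits a bounded $H^{\infty}(B_\gamma)$ functional calculus for any $\gamma\in\bigl(\alpha,\frac{\pi}{2}\bigr)$.
   Context: Let $X$ be a complex Banach space and $B(X)$ the algebra of bounded operators on $X$; write $R(\lambda,T)=(\lambda I-T)^{-1}$. An operator $T\in B(X)$ is a Ritt operator if the two sets $\{T^n : n\geq 0\}$ and $\{n(T^n-T^{n-1}) : n\geq 1\}$ are bounded. For $\gamma\in(0,\frac{\pi}{2})$, $B_\gamma$ (Stolz domain) is the interior of the convex hull of $1$ and the disc $D(0,\sin\gamma)=\{|z|<\sin\gamma\}$. A Ritt operator $T$ is of type $\alpha\in(0,\frac{\pi}{2})$ if $\sigma(T)\subset\overline{B_\alpha}$ and for every $\beta\in(\alpha,\frac{\pi}{2})$ the set $\{(\lambda-1)R(\lambda,T) : \lambda\in\mathbb{C}\setminus\overline{B_\beta}\}$ is bounded (every Ritt operator is of some type $\alpha$). $H^\infty_0(B_\gamma)$ is the space of bounded holomorphic $\varphi\colon B_\gamma\to\mathbb{C}$ for which there are $s,c>0$ with $|\varphi(\lambda)|\leq c|1-\lambda|^s$ on $B_\gamma$. If $T$ is a Ritt operator of type $\alpha<\gamma$ and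 $\varphi\in H^\infty_0(B_\gamma)$, set $\varphi(T)=\frac{1}{2\pi i}\int_{\partial B_\beta}\varphi(\lambda)R(\lambda,T)\,d\lambda$ with $\beta\in(\alpha,\gamma)$ and $\partial B_\beta$ oriented counterclockwise (independent of $\beta$). $T$ admits a bounded $H^\infty(B_\gamma)$ functional calculus if $T$ is of type $\alpha$ for some $\alpha<\gamma$ and there is $K>0$ with $\|\varphi(T)\|\leq K\sup_{\lambda\in B_\gamma}|\varphi(\lambda)|$ for all $\varphi\in H^\infty_0(B_\gamma)$. Let $(\varepsilon_k)_{k\geq 1}$ be independent Rademacher variables on a probability space $(\mathcal{M},d\mathbb{P})$. For a Banach space $Y$, $\mathrm{Rad}(Y)$ is the closed span of $\{\varepsilon_k\otimes x : k\geq 1,x\in Y\}$ in $L^2(\mathcal{M};Y)$, with the $L^2(\mathcal{M};Y)$-norm. For $S\in B(Y)$ and $x\in Y$, set $\|x\|_{S,1}=\bigl\|\sum_{k=1}^\infty k^{1/2}\,\varepsilon_k\otimes S^{k-1}(I-S)(x)\bigr\|_{\mathrm{Rad}(Y)}$ if the series converges in $L^2(\mathcal{M};Y)$, and $\|x\|_{S,1}=\infty$ otherwise. A set $E\subset B(X)$ is $R$-bounded if there is $C\geq 0$ such that $\|\sum_k\varepsilon_k\otimes T_k(x_k)\|_{\mathrm{Rad}(X)}\leq C\|\sum_k\varepsilon_k\otimes x_k\|_{\mathrm{Rad}(X)}$ for all finite families $(T_k)_k$ in $E$ and $(x_k)_k$ in $X$. $T\in B(X)$ is $R$-Ritt if $\{T^n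 : n\geq 0\}$ and $\{n(T^n-T^{n-1}) : n\geq 1\}$ are $R$-bounded. An $R$-Ritt operator $T$ is of $R$-type $\alpha\in(0,\frac\pi2)$ if $\sigma(T)\subset\overline{B_\alpha}$ and for every $\beta\in(\alpha,\frac{\pi}{2})$ the set $\{(\lambda-1)R(\lambda,T) : \lambda\in\mathbb{C}\setminus\overline{B_\beta}\}$ is $R$-bounded. *)

(* Defs.v *)
From HB Require Import structures.
From mathcomp Require Import all_boot all_order all_algebra.
From mathcomp Require Import finmap.
From mathcomp Require Import complex.
From mathcomp Require Import all_classical all_reals all_analysis.

Set Implicit Arguments.
Unset Strict Implicit.
Unset Printing Implicit Defensive.

Import Order.TTheory GRing.Theory Num.Theory.
Import numFieldNormedType.Exports.

Local Open Scope classical_set_scope.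
Local Open Scope ring_scope.
Local Open Scope complex_scope.

(* The norm of a normed module over R[i] takes its values in R[i]; [nrm] is the
   same norm seen as a real number. *)
Definition nrm {R : realType} {V : normedModType R[i]} (v : V) : R :=
  complex.Re `|v|.

Section Nrm.
Context {R : realType} {V : normedModType R[i]}.
Implicit Types v w : V.

Lemma nrmE v : (nrm v)%:C = `|v|.
Proof. by rewrite /nrm RRe_real // ger0_real. Qed.

Lemma nrm_ge0 v : 0 <= nrm v.
Proof. by rewrite -lecR nrmE; exact: normr_ge0. Qed.

Lemma nrm0 : nrm (0 : V) = 0.
Proof. by rewrite /nrm normr0. Qed.

Lemma nrm_eq0 v : nrm v = 0 -> v = 0.
Proof. by move=> v0; apply: normr0_eq0; rewrite -nrmE v0. Qed.

Lemma nrmD v w : nrm (v + w) <= nrm v + nrm w.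
Proof. by rewrite -lecR rmorphD /= !nrmE ler_normD. Qed.

Lemma nrmZ (a : R[i]) v : nrm (a *: v) = nrm (a : R[i]^o) * nrm v.
Proof.
suff: (nrm (a *: v))%:C = (nrm (a : R[i]^o) * nrm v)%:C.
  by move=> /(congr1 (@complex.Re R)).
by rewrite rmorphM /= !nrmE normrZ.
Qed.

Lemma nrm_real (r : R) : nrm (r%:C : R[i]^o) = `|r|.
Proof. by rewrite /nrm /= /Num.norm /= expr0n addr0 sqrtr_sqr. Qed.

End Nrm.

Section BoundedOperators.
Context {R : realType} (V W : normedModType R[i]).

Definition bounded_linear : {pred V -> W} := fun f =>
  `[< linear f /\ exists M : R, forall x, nrm (f x) <= M * nrm x >].

Record bop := Bop { bop_fun :> V -> W; bop_subproof : bop_fun \in bounded_linear }.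

HB.instance Definition _ := [isSub for bop_fun].
HB.instance Definition _ := [Choice of bop by <:].

Lemma bounded_linear_submod_closed : submod_closed bounded_linear.
Proof.
split.
  apply/asboolP; split; first by move=> a x y; rewrite scaler0 addr0.
  by exists 0 => x; rewrite mul0r nrm0.
move=> a f g /asboolP[lf [M fM]] /asboolP[lg [N gN]]; apply/asboolP; split.
  move=> b x y /=; rewrite [LHS](_ : _ = a *: f (b *: x + y) + g (b *: x + y))//.
  rewrite lf lg [in RHS](_ : (a *: f + g) x = a *: f x + g x)//.
  rewrite [in RHS](_ : (a *: f + g) y = a *: f y + g y)//.
  rewrite !scalerDr !scalerA [b * a]mulrC -!addrA; congr (_ + _).
  by rewrite addrCA.
exists (nrm (a : R[i]^o) * M + N) => x.
rewrite (_ : (a *: f + g) x = a *: f x + g x)//.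
rewrite (le_trans (nrmD _ _))// mulrDl lerD// nrmZ -mulrA.
by rewrite ler_wpM2l// nrm_ge0.
Qed.

HB.instance Definition _ :=
  GRing.isSubmodClosed.Build R[i] (V -> W) bounded_linear
    bounded_linear_submod_closed.
HB.instance Definition _ := [SubChoice_isSubLmodule of bop by <:].

Lemma bop_linear (f : bop) : linear f.
Proof. by case: f => f /= /asboolP[]. Qed.

HB.instance Definition _ (f : bop) :=
  GRing.isLinear.Build R[i] V W _ f (bop_linear f).

Lemma bop_bounded (f : bop) : exists M : R, forall x, nrm (f x) <= M * nrm x.
Proof. by case: f => f /= /asboolP[]. Qed.

Lemma bopP (f g : bop) : f =1 g -> f = g.
Proof. by move=> fg; apply/val_inj/funext. Qed.

Lemma bopDE (f g : bop) x : (f + g) x = f x + g x.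
Proof. by []. Qed.

Lemma bopZE a (f : bop) x : (a *: f) x = a *: f x.
Proof. by []. Qed.

Definition opnorm (f : bop) : R := sup [set nrm (f x) | x in [set x | nrm x <= 1]].

Lemma opnorm_has_sup (f : bop) :
  has_sup [set nrm (f x) | x in [set x | nrm x <= 1]].
Proof.
split; first by exists (nrm (f 0)), 0 => //=; rewrite nrm0.
have [M fM] := bop_bounded f; exists `|M| => _ [x /= x1 <-].
rewrite (le_trans (fM x))// (@le_trans _ _ (`|M| * nrm x))//.
  by rewrite ler_wpM2r ?nrm_ge0// ler_norm.
by rewrite ler_piMr.
Qed.

Lemma opnorm_ub (f : bop) x : nrm x <= 1 -> nrm (f x) <= opnorm f.
Proof.
move=> x1; apply: sup_upper_bound; first exact: opnorm_has_sup.
by exists x.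
Qed.

Lemma opnorm_lub (f : bop) (r : R) :
  (forall x, nrm x <= 1 -> nrm (f x) <= r) -> opnorm f <= r.
Proof.
move=> fr; apply: ge_sup; first by case: (opnorm_has_sup f).
by move=> _ [x /= x1 <-]; exact: fr.
Qed.

Lemma opnorm_ge0 (f : bop) : 0 <= opnorm f.
Proof. by rewrite (le_trans (nrm_ge0 (f 0)))// opnorm_ub// nrm0. Qed.

Lemma opnorm_le (f : bop) x : nrm (f x) <= opnorm f * nrm x.
Proof.
have [->|x0] := eqVneq x 0; first by rewrite linear0 !nrm0 mulr0.
have n0 : 0 < nrm x.
  rewrite lt_neqAle nrm_ge0 andbT eq_sym.
  by apply: contra_neq x0; exact: nrm_eq0.
rewrite -ler_pdivrMr//.
have -> : nrm (f x) / nrm x = nrm (f ((nrm x)^-1%:C *: x)).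
  by rewrite linearZ/= nrmZ nrm_real ger0_norm ?invr_ge0 ?nrm_ge0// mulrC.
rewrite opnorm_ub// nrmZ nrm_real ger0_norm ?invr_ge0 ?nrm_ge0//.
by rewrite mulVf// gt_eqF.
Qed.

Let bop_norm (f : bop) : R[i] := (opnorm f)%:C.

Let ler_bop_normD f g : bop_norm (f + g) <= bop_norm f + bop_norm g.
Proof.
rewrite /bop_norm -rmorphD /= lecR; apply: opnorm_lub => x x1.
by rewrite (le_trans (nrmD _ _))// lerD// opnorm_ub.
Qed.

Let bop_normZ (a : R[i]) f : bop_norm (a *: f) = `|a| * bop_norm f.
Proof.
have -> : `|a| = (nrm (a : R[i]^o))%:C by rewrite nrmE.
rewrite /bop_norm -rmorphM /=; congr (_%:C).
apply/eqP; rewrite eq_le; apply/andP; split.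
  apply: opnorm_lub => x x1.
  by rewrite nrmZ ler_wpM2l ?nrm_ge0// opnorm_ub.
have [->|a0] := eqVneq a 0; first by rewrite nrm0 mul0r opnorm_ge0.
have n0 : 0 < nrm (a : R[i]^o).
  rewrite lt_neqAle nrm_ge0 andbT eq_sym.
  by apply: contra_neq a0 => /nrm_eq0.
rewrite -ler_pdivlMl//; apply: opnorm_lub => x x1.
by rewrite ler_pdivlMl// -nrmZ (opnorm_ub (a *: f)).
Qed.

Let bop_norm_eq0 f : bop_norm f = 0 -> f = 0.
Proof.
case=> f0; apply: bopP => x; apply: nrm_eq0.
apply/eqP; rewrite eq_le nrm_ge0 andbT.
by rewrite (le_trans (opnorm_le f x))// f0 mul0r.
Qed.

HB.instance Definition _ :=
  Lmodule_isNormed.Build R[i] bop ler_bop_normD bop_normZ bop_norm_eq0.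

Lemma nrm_bop (f : bop) : nrm f = opnorm f.
Proof. by []. Qed.

End BoundedOperators.

Arguments bop {R} V W.
Arguments bounded_linear {R} V W _.

Section Composition.
Context {R : realType} {U V W : normedModType R[i]}.

Lemma bop_comp_subproof (g : bop V W) (f : bop U V) :
  (g \o f : U -> W) \in bounded_linear U W.
Proof.
apply/asboolP; split; first by move=> a x y; rewrite /= !linearP.
exists (opnorm g * opnorm f) => x /=.
rewrite (le_trans (opnorm_le _ _))// -mulrA ler_wpM2l ?opnorm_ge0//.
exact: opnorm_le.
Qed.

Definition bop_comp (g : bop V W) (f : bop U V) : bop U W :=
  Bop (bop_comp_subproof g f).

End Composition.

Section Algebra.
Context {R : realType} (X : normedModType R[i]).

Lemma bop_id_subproof : (id : X -> X) \in bounded_linear X X.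
Proof. by apply/asboolP; split => //; exists 1 => x; rewrite mul1r. Qed.

Definition bop_id : bop X X := Bop bop_id_subproof.

Let bop_mulA : associative (@bop_comp R X X X).
Proof. by move=> f g h; apply: bopP. Qed.
Let bop_mul1 : left_id bop_id (@bop_comp R X X X).
Proof. by move=> f; apply: bopP. Qed.
Let bop_mulr1 : right_id bop_id (@bop_comp R X X X).
Proof. by move=> f; apply: bopP. Qed.
Let bop_mulDl : left_distributive (@bop_comp R X X X) +%R.
Proof. by move=> f g h; apply: bopP. Qed.
Let bop_mulDr : right_distributive (@bop_comp R X X X) +%R.
Proof. by move=> f g h; apply: bopP => x /=; rewrite linearD. Qed.

(* B(X), with composition as product; only a [pzRingType] since X may be 0. *)
HB.instance Definition _ := GRing.Zmodule_isPzRing.Build (bop X X)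
  bop_mulA bop_mul1 bop_mulr1 bop_mulDl bop_mulDr.

End Algebra.

Section Precomposition.
Context {R : realType} {U V : normedModType R[i]} (W : normedModType R[i]).

Lemma bop_precomp_subproof (f : bop U V) :
  (fun g : bop V W => bop_comp g f) \in bounded_linear (bop V W) (bop U W).
Proof.
apply/asboolP; split; first by move=> a g h; apply: bopP.
exists (opnorm f) => g; rewrite !nrm_bop; apply: opnorm_lub => x x1 /=.
rewrite (le_trans (opnorm_le _ _))// mulrC ler_wpM2r ?opnorm_ge0//.
exact: opnorm_ub.
Qed.

Definition bop_precomp (f : bop U V) : bop (bop V W) (bop U W) :=
  Bop (bop_precomp_subproof f).

End Precomposition.

Definition dual {R : realType} (X : normedModType R[i]) : normedModType R[i] :=
  bop X R[i]^o.

(* T^*, mapping the functional y to y \o T. *)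
Definition adjoint {R : realType} {X : normedModType R[i]} (T : bop X X) :
  bop (dual X) (dual X) := bop_precomp R[i]^o T.

Section Spectrum.
Context {R : realType} {X : normedModType R[i]}.
Implicit Types (T : bop X X) (z : R[i]^o).

Definition inverses (A : bop X X) : set (bop X X) :=
  [set S | S * A = 1 /\ A * S = 1].

Definition spectrum T : set R[i]^o := [set z | inverses (z *: (1 : bop X X) - T) = set0].

(* R(z, T); equal to 0 by convention when z is in the spectrum of T. *)
Definition resolvent z T : bop X X := xget 0 (inverses (z *: (1 : bop X X) - T)).

End Spectrum.

Section Stolz.
Context {R : realType}.

Definition stolz (gamma : R) : set R[i]^o :=
  interior (smallest (@convex_set R[i] R[i]^o)
    ([set 1] `|` [set z : R[i]^o | nrm z < sin gamma])).

Definition cis (theta : R) : R[i] := cos theta +i* sin theta.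

End Stolz.

Section Bochner.
Context {R : realType} d (M : measurableType d) (mu : {measure set M -> \bar R}).
Context {Y : normedModType R[i]}.
Implicit Types (D : set M) (f s : M -> Y).

Definition simple_function s : Prop :=
  finite_set (range s) /\ forall y, measurable (s @^-1` [set y]).

Definition strongly_measurable D f : Prop :=
  exists2 s : nat -> M -> Y, (forall n, simple_function (s n)) &
    {ae mu, forall w, D w -> s n w @[n --> \oo] --> f w}.

(* For a simple function s and a set D of finite measure. *)
Definition simple_integral D s : Y :=
  \sum_(y \in range s) (fine (mu (D `&` s @^-1` [set y])))%:C *: y.

Definition is_bochner D f (z : Y) : Prop :=
  strongly_measurable D f /\
  exists s : nat -> M -> Y,
    [/\ forall n, simple_function (s n),
        (\int[mu]_(w in D) (nrm (f w - s n w))%:E)%E @[n --> \oo] --> 0%E &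
        simple_integral D (s n) @[n --> \oo] --> z].

(* The Bochner integral of f over a set D of finite measure; equal to 0 by
   convention when f is not Bochner integrable on D. *)
Definition bochner D f : Y := xget 0 (is_bochner D f).

Definition L2norm f : \bar R := 'N[mu]_2%:E[(fun w => (nrm (f w))%:E)]%E.

Definition L2 f : Prop := strongly_measurable setT f /\ (L2norm f < +oo)%E.

Definition L2_limit (u : nat -> M -> Y) f : Prop :=
  L2 f /\ L2norm (fun w => u n w - f w) @[n --> \oo] --> 0%E.

End Bochner.

Section ContourIntegral.
Context {R : realType} {Y : normedModType R[i]}.
Implicit Types F : R[i]^o -> Y.

Definition segment_integral (a b : R[i]) F : Y :=
  bochner lebesgue_measure `[0, 1]%classic
    (fun t : R => (b - a) *: F (a + t%:C * (b - a))).

Definition arc_integral (r theta0 theta1 : R) F : Y :=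
  bochner lebesgue_measure `[theta0, theta1]%classic
    (fun theta : R => ('i * r%:C * cis theta) *: F (r%:C * cis theta)).

(* The two tangents from 1 to the circle of radius sin beta touch it at the
   points of argument -+ (pi/2 - beta), so that, counterclockwise, the boundary
   of the Stolz domain is a segment, an arc and a segment. *)
Definition stolz_boundary_integral (beta : R) F : Y :=
  let theta := pi / 2 - beta in
  let r := sin beta in
  segment_integral 1 (r%:C * cis theta) F
  + arc_integral r theta (2 * pi - theta) F
  + segment_integral (r%:C * cis (- theta)) 1 F.

End ContourIntegral.

Section Ritt.
Context {R : realType} {X : normedModType R[i]}.
Implicit Types (T : bop X X) (alpha beta gamma : R).

Definition powers T : set (bop X X) := [set T ^+ n | n in setT].

Definition differences T : set (bop X X) :=
  [set (T ^+ n - T ^+ n.-1) *+ n | n in [set n | (0 < n)%N]].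

Definition resolvents T beta : set (bop X X) :=
  [set (z - 1) *: resolvent z T | z in ~` closure (stolz beta)].

Definition ritt T : Prop := bounded_set (powers T) /\ bounded_set (differences T).

Definition ritt_of_type T alpha : Prop :=
  [/\ ritt T, 0 < alpha < pi / 2, spectrum T `<=` closure (stolz alpha) &
      forall beta, alpha < beta < pi / 2 -> bounded_set (resolvents T beta)].

Definition Hinfty0 gamma (phi : R[i]^o -> R[i]^o) : Prop :=
  [/\ forall z, stolz gamma z -> derivable phi z 1,
      exists M : R, forall z, stolz gamma z -> nrm (phi z) <= M &
      exists s c : R, [/\ 0 < s, 0 < c &
        forall z, stolz gamma z -> nrm (phi z) <= c * nrm (1 - z) `^ s]].

(* phi(T), computed on the boundary of the Stolz domain of angle beta. *)
Definition fcalc T beta (phi : R[i]^o -> R[i]^o) : bop X X :=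
  (2 * pi%:C * 'i)^-1 *:
    stolz_boundary_integral beta (fun z => phi z *: resolvent z T).

Definition sup_stolz gamma (phi : R[i]^o -> R[i]^o) : R :=
  sup [set nrm (phi z) | z in stolz gamma].

(* phi(T) does not depend on beta in ]alpha, gamma[. *)
Definition bounded_Hinfty_calculus T gamma : Prop :=
  exists alpha, [/\ ritt_of_type T alpha, alpha < gamma &
    exists2 K : R, 0 < K & forall phi, Hinfty0 gamma phi ->
      forall beta, alpha < beta < gamma ->
      nrm (fcalc T beta phi) <= K * sup_stolz gamma phi].

End Ritt.

Section Rademacher.
Context {R : realType} d (M : measurableType d) (P : probability M R).
Variable eps : nat -> {RV P >-> R}.

Definition mutually_independent : Prop :=
  forall (J : {fset nat}) (A : nat -> set R), (forall k, measurable (A k)) ->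
    P (\bigcap_(k in [set` J]) (eps k @^-1` A k)) =
    (\prod_(k <- J) P (eps k @^-1` A k))%E.

(* Indexed from 0 instead of 1. *)
Definition rademacher_sequence : Prop :=
  (forall k, P (eps k @^-1` [set 1]) = (2^-1)%:E /\
             P (eps k @^-1` [set -1]) = (2^-1)%:E) /\
  mutually_independent.

(* sum_(k < n) eps_k (x) x_k. Its norm in Rad(Y), a closed subspace of
   L2(M; Y), is its L2 norm. *)
Definition rad_sum {Y : normedModType R[i]} n (x : nat -> Y) : M -> Y :=
  fun w => \sum_(k < n) (eps k w)%:C *: x k.

Definition Rbounded {X : normedModType R[i]} (E : set (bop X X)) : Prop :=
  exists2 C : R, 0 <= C &
    forall n (T : nat -> bop X X) (x : nat -> X),
      (forall k, (k < n)%N -> E (T k)) ->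
      (L2norm P (rad_sum n (fun k => T k (x k))) <=
       C%:E * L2norm P (rad_sum n x))%E.

Definition Rritt {X : normedModType R[i]} (T : bop X X) : Prop :=
  Rbounded (powers T) /\ Rbounded (differences T).

Definition Rritt_of_Rtype {X : normedModType R[i]} (T : bop X X) (alpha : R) :
    Prop :=
  [/\ Rritt T, 0 < alpha < pi / 2, spectrum T `<=` closure (stolz alpha) &
      forall beta, alpha < beta < pi / 2 -> Rbounded (resolvents T beta)].

(* The square function norm |x|_{S,1}; with the index shifted, its k-th term is
   (k + 1)^(1/2) eps_k (x) S^k (I - S) x. *)
Definition square_norm {Y : normedModType R[i]} (S : bop Y Y) (x : Y) : \bar R :=
  let u n := rad_sum n (fun k => (Num.sqrt k.+1%:R)%:C *: (S ^+ k * (1 - S)) x) in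
  if `[< exists f, L2_limit P u f >] then L2norm P (xget (cst 0) (L2_limit P u))
  else +oo%E.

End Rademacher.

(* Main.v *)
(* On the boundary of a Stolz domain B_b the identity
     2 = sum_(k < N) (k+1)(k+2) S^k (1-S)^3 + r_N(S),   S = z^3,
   with (1-S)^3 = (1-z)^3 Q, Q = (1+z+z^2)^3, gives in the limit
     2 phi(T) = sum_k (k+1) (1-T)T^k V_k T^k(1-T),
     V_k = (k+2) int phi(z) z^k (1-z) Q(z) R(z, T) dz.
   Since (k+1) int |z|^k |dz| is bounded in k, V_k belongs to a multiple,
   proportional to sup |phi|, of the absolutely convex hull of the R-bounded set
   {(z-1) R(z, T)}. Splitting k+1 evenly between the two sides, pairing with a
   functional and averaging over signs, the sum is controlled by the square
   functions of T and T^*.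
   Contour integrals are limits of Riemann sums. Replacing z by T under the
   integral costs moments int phi(z) z^k dz, which vanish by Goursat's lemma; here
   this is a statement on midpoint sums over triangles. T being also of any type
   in ]alpha, gamma[, only contours with b bounded away from alpha matter, and the
   R-bound of (z-1) R(z, T) outside a fixed B_b0 serves all of them at once. *)

Require Import Defs.
From HB Require Import structures.
From mathcomp Require Import all_boot all_order all_algebra.
From mathcomp Require Import finmap.
From mathcomp Require Import complex.
From mathcomp Require Import all_classical all_reals all_analysis.
From mathcomp Require Import measurable_realfun.
From mathcomp Require Import ring lra.

Set Implicit Arguments.
Unset Strict Implicit.
Unset Printing Implicit Defensive.

Import Order.TTheory GRing.Theory Num.Theory.
Import numFieldNormedType.Exports.

Local Open Scope classical_set_scope.
Local Open Scope ring_scope.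
Local Open Scope complex_scope.

(** Why S = z^3: of the three factors 1 - z, two become the 1 - T of the two square functions and
    the third offsets the growth of R(z, T) at 1, leaving the R-bounded (z - 1) R(z, T). Likewise
    z^(3k) is shared out as T^k, z^k, T^k, and the z^k kept under the integral supplies a decay 1 /
    (k + 1). The weights come from sum_k (k + 1)(k + 2) S^k = 2 / (1 - S)^3: the factor k + 1 feeds
    the square functions, k + 2 is absorbed by the integral. No operator series is summed. N stays
    finite, and the remainder r_N is an explicit polynomial whose contour sums are small because phi
    decays at 1. The final constant may depend on [b0] and gamma but not on the angle b of the
    contour, so every estimate uses the gap 1 - sin gamma instead of 1 - sin b. It must also be
    linear in sup |phi|; this is arranged by taking sup |phi| as the weight in the AM-GM inequality.
    Expectations over signs are encoded as the finite recursion [radE]. Once the hypotheses are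
    translated into it, the operator part involves no probability. *)

Section NrmBasics.
Context {R : realType} {V : normedModType R[i]}.
Implicit Types v w : V.

Lemma nrmN v : nrm (- v) = nrm v.
Proof. by rewrite /nrm normrN. Qed.

Lemma nrmBC v w : nrm (v - w) = nrm (w - v).
Proof. by rewrite /nrm distrC. Qed.

Lemma nrmB v w : nrm (v - w) <= nrm v + nrm w.
Proof. by rewrite -(nrmN w) nrmD. Qed.

Lemma nrmB_gt0 v w : v != w -> 0 < nrm (v - w).
Proof.
move=> vw; rewrite lt_neqAle nrm_ge0 andbT eq_sym.
by apply: contra_neq vw => /nrm_eq0/eqP; rewrite subr_eq0 => /eqP.
Qed.

Lemma nrm_sum (I : Type) (r : seq I) (P : pred I) (F : I -> V) :
  nrm (\sum_(i <- r | P i) F i) <= \sum_(i <- r | P i) nrm (F i).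
Proof.
elim/big_rec2 : _ => [|i y x _ le_xy]; first by rewrite nrm0.
by rewrite (le_trans (nrmD _ _))// lerD2l.
Qed.

Lemma nrmZr (r : R) v : nrm (r%:C *: v) = `|r| * nrm v.
Proof. by rewrite nrmZ nrm_real. Qed.

Lemma nrm_triangle v w z : nrm (v - z) <= nrm (v - w) + nrm (w - z).
Proof. by rewrite (le_trans _ (nrmD _ _))// subrKA. Qed.

Lemma ler_dist_nrm v w : `|nrm v - nrm w| <= nrm (v - w).
Proof.
rewrite ler_norml lerBrDl lerBlDr; apply/andP; split.
  by rewrite nrmBC addrC -{1}(subrK v w) nrmD.
by rewrite lerBlDr -{1}(subrK w v) nrmD.
Qed.

End NrmBasics.

Section ComplexNrm.
Context {R : realType}.
Implicit Types z w : R[i]^o.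

Lemma nrmM z w : nrm (z * w : R[i]^o) = nrm z * nrm w.
Proof. exact: nrmZ. Qed.

Lemma nrm1 : nrm (1 : R[i]^o) = 1.
Proof. by rewrite /nrm normr1. Qed.

Lemma nrmX z n : nrm (z ^+ n : R[i]^o) = nrm z ^+ n.
Proof. by elim: n => [|n IH]; rewrite ?expr0 ?nrm1// !exprS nrmM IH. Qed.

Lemma nrmi : nrm ('i : R[i]^o) = 1.
Proof. by rewrite /nrm /= /Num.norm /= expr0n/= expr1n add0r sqrtr1. Qed.

Lemma nrm_sqr z : nrm z ^+ 2 = (complex.Re z) ^+ 2 + (complex.Im z) ^+ 2.
Proof.
by case: z => a b; rewrite /nrm /= /Num.norm /= sqr_sqrtr// addr_ge0// sqr_ge0.
Qed.

Lemma Re_nrm z : `|complex.Re z| <= nrm z.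
Proof.
rewrite -(@ler_pXn2r _ 2) ?nnegrE ?nrm_ge0// nrm_sqr real_normK ?num_real//.
by rewrite lerDl sqr_ge0.
Qed.

Lemma Im_nrm z : `|complex.Im z| <= nrm z.
Proof.
rewrite -(@ler_pXn2r _ 2) ?nnegrE ?nrm_ge0// nrm_sqr real_normK ?num_real//.
by rewrite lerDr sqr_ge0.
Qed.

Lemma nrm_ReIm z : nrm z <= `|complex.Re z| + `|complex.Im z|.
Proof.
have {1}-> : z = (complex.Re z)%:C *: (1 : R[i]^o) + (complex.Im z)%:C *: ('i : R[i]^o).
  by case: z => a b; apply/eqP; rewrite eq_complex /=; apply/andP; split; apply/eqP; ring.
by rewrite (le_trans (nrmD _ _))// !nrmZr nrm1 nrmi !mulr1.
Qed.

End ComplexNrm.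

(** * Norming functionals *)

Section Sublinear.
Context {R : realType} {X : normedModType R[i]}.
Implicit Types (p q : X -> R) (x y v : X).

Definition sublinear q :=
  (forall x y, q (x + y) <= q x + q y) /\
  (forall (r : R) x, 0 < r -> q (r%:C *: x) <= r * q x).

Lemma sublinearZ q : sublinear q ->
  forall (r : R) x, 0 < r -> q (r%:C *: x) = r * q x.
Proof.
move=> [_ qZ] r x r0; apply/eqP; rewrite eq_le qZ//=.
have := qZ r^-1 (r%:C *: x); rewrite invr_gt0 scalerA -rmorphM mulVf ?gt_eqF//.
by rewrite scale1r => /(_ r0); rewrite ler_pdivlMl.
Qed.

Lemma sublinear0 q : sublinear q -> q 0 = 0.
Proof.
move=> sq; have := sublinearZ sq 0 (ltr0Sn _ 1).
by rewrite scaler0 => ?; lra.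
Qed.

Lemma sublinearN q x : sublinear q -> - q (- x) <= q x.
Proof.
by move=> sq; rewrite lerNl -subr_ge0 opprK addrC -(sublinear0 sq) -(subrr x) sq.1.
Qed.

Lemma sublinear_nrm : sublinear (@nrm R X).
Proof.
by split=> [x y|r x r0]; [exact: nrmD | rewrite nrmZr gtr0_norm].
Qed.

(* The largest sublinear minorant of q that is additive in the direction v. *)
Definition descent q v x : R := inf [set q (x + t%:C *: v) - t * q v | t in [set t | 0 <= t]].

Lemma descent_lb q v x : sublinear q ->
  lbound [set q (x + t%:C *: v) - t * q v | t in [set t | 0 <= t]] (- q (- x)).
Proof.
move=> sq _ [t /= t0 <-]; rewrite lerBrDr addrC lerBlDr.
have [->|tn0] := eqVneq t 0.
  by rewrite scale0r addr0 mul0r -lerBlDr sub0r sublinearN.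
rewrite -(sublinearZ sq); last by rewrite lt_neqAle eq_sym tn0.
by rewrite (le_trans _ (sq.1 _ _))// addrAC subrr add0r.
Qed.

Lemma descent_le q v x t : sublinear q -> 0 <= t ->
  descent q v x <= q (x + t%:C *: v) - t * q v.
Proof.
move=> sq t0; apply: ge_inf; last by exists t.
by exists (- q (- x)); exact: descent_lb.
Qed.

Lemma le_descent q v x r : sublinear q ->
  (forall t, 0 <= t -> r <= q (x + t%:C *: v) - t * q v) -> r <= descent q v x.
Proof.
move=> sq H; apply: lb_le_inf; first by exists (q (x + 0%:C *: v) - 0 * q v), 0 => /=.
by move=> _ [t t0 <-]; exact: H.
Qed.

Lemma descent_sublinear q v : sublinear q -> sublinear (descent q v).
Proof.
move=> sq; split => [x y|r x r0].
  rewrite -lerBlDr; apply: le_descent => // t t0.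
  rewrite lerBlDr -lerBlDl; apply: le_descent => // s s0; rewrite lerBlDr.
  have st0 : 0 <= s + t by rewrite addr_ge0.
  rewrite (le_trans (descent_le v (x + y) sq st0))// rmorphD/= scalerDl.
  have := sq.1 (y + s%:C *: v) (x + t%:C *: v).
  rewrite addrACA (addrC y x) => /le_trans; rewrite mulrDl => H.
  have {}H := H _ (lexx _); lra.
rewrite mulrC -ler_pdivrMr//; apply: le_descent => // t t0; rewrite ler_pdivrMr//.
have rt0 : 0 <= r * t by rewrite mulr_ge0// ltW.
rewrite (le_trans (descent_le v _ sq rt0))//.
by rewrite rmorphM/= -scalerA -scalerDr (sublinearZ sq)// mulrBl mulrC (mulrC r t) -!mulrA (mulrC r).
Qed.

Lemma descent_le_self q v x : sublinear q -> descent q v x <= q x.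
Proof.
move=> sq; have := descent_le v x sq (lexx 0).
by rewrite scale0r addr0 mul0r subr0.
Qed.

Lemma minimal_sublinear p : sublinear p -> exists q,
  [/\ sublinear q, forall x, q x <= p x &
  forall r, sublinear r -> (forall x, r x <= q x) -> forall x, r x = q x].
Proof.
move=> sp; pose T := {q | sublinear q /\ forall x, q x <= p x}.
pose ge (f g : T) := `[< forall x, sval g x <= sval f x >].
have p0 : T by exists p.
have [||A totA|[q [sq qp]] qmin] := @ZL_preorder T p0 ge.
- by move=> t; apply/asboolP.
- by move=> r s t /asboolP H1 /asboolP H2; apply/asboolP => x; exact: le_trans (H1 x).
- have [A0|/set0P[a Aa]] := eqVneq A set0.
    by exists p0 => s; rewrite A0.
  pose h x := inf [set sval f x | f in A].
  have lb x : has_lbound [set sval f x | f in A].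
    exists (- p (- x)) => _ [f Af <-]; case: f Af => f /= [sf fp] _.
    by rewrite (le_trans _ (sublinearN x sf))// lerN2.
  have hle x f : A f -> h x <= sval f x by move=> Af; apply: ge_inf => //; exists f.
  have leh x r : (forall f, A f -> r <= sval f x) -> r <= h x.
    by move=> H; apply: lb_le_inf; [exists (sval a x), a|move=> _ [f Af <-]; exact: H].
  have sh : sublinear h.
    split => [x y|r x r0].
      rewrite -lerBlDr; apply: (leh _ _) => f Af; rewrite lerBlDr -lerBlDl.
      apply: (leh _ _) => g Ag; rewrite lerBlDr.
      have [/asboolP fg|/asboolP gf] := totA _ _ Af Ag.
        rewrite (le_trans (hle _ _ Ag))// (le_trans ((svalP g).1.1 _ _))// addrC.
        by rewrite lerD2l.
      rewrite (le_trans (hle _ _ Af))// (le_trans ((svalP f).1.1 _ _))// addrC.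
      by rewrite lerD2r.
    rewrite mulrC -ler_pdivrMr//; apply: (leh _ _) => f Af; rewrite ler_pdivrMr//.
    by rewrite (le_trans (hle _ _ Af))// mulrC (svalP f).1.2.
  have hp x : h x <= p x by rewrite (le_trans (hle _ _ Aa))// (svalP a).2.
  by exists (exist _ h (conj sh hp)) => s As; apply/asboolP => x /=; exact: hle.
exists q; split => // r sr rq x.
have rp y : r y <= p y by rewrite (le_trans (rq _)).
have := qmin (exist _ r (conj sr rp)).
move=> /(_ (asboolT rq)) /asboolP /= qr.
by apply/eqP; rewrite eq_le rq qr.
Qed.

(** A minimal sublinear function equals its own [descent] in every direction, which makes it
    additive. Minimizing below the descent of the norm along [v], rather than below the norm, forces
    the value at - v to be at most - nrm v. *)
Lemma real_hahn_banach v : exists u : X -> R,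
  [/\ forall x y, u (x + y) = u x + u y, forall (r : R) x, u (r%:C *: x) = r * u x,
   forall x, u x <= nrm x & nrm v <= u v].
Proof.
have sn := sublinear_nrm.
have [q [sq qd qmin]] := minimal_sublinear (descent_sublinear v sn).
have qn x : q x <= nrm x by rewrite (le_trans (qd x))// descent_le_self.
have qdE w x : descent q w x = q x.
  by apply: (qmin _) => [|y]; [exact: descent_sublinear|exact: descent_le_self].
have qD x y : q (x + y) = q x + q y.
  apply/eqP; rewrite eq_le sq.1/= -lerBrDr.
  by have := descent_le y x sq ler01; rewrite qdE scale1r mul1r.
have qN x : q (- x) = - q x.
  by apply/eqP; rewrite -addr_eq0 -qD addNr (sublinear0 sq).
exists q; split => // [r x|].
  have [r0|r0|->] := ltrgtP r 0.
  - by rewrite -{1}[r]opprK rmorphN scaleNr qN (sublinearZ sq) ?oppr_gt0// mulNr opprK.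
  - exact: sublinearZ.
  - by rewrite scale0r (sublinear0 sq) mul0r.
rewrite -lerN2 -qN (le_trans (qd _))//.
by have := descent_le v (- v) sn ler01; rewrite scale1r addNr nrm0 mul1r sub0r.
Qed.

(* The constant 2 instead of 1 spares the rotation of the complexified
   functional. *)
Lemma hahn_banach v : exists2 y : dual X, nrm y <= 2 & nrm v <= nrm (y v).
Proof.
have [u [uD uZ un uv]] := real_hahn_banach v.
have uN x : u (- x) = - u x.
  by rewrite -scaleN1r -(rmorphN1 (real_complex R)) uZ mulN1r.
have uabs x : `|u x| <= nrm x.
  by rewrite ler_norml un andbT lerNl -uN -[nrm x]nrmN.
pose f x : R[i]^o := (u x) -i* (u ('i *: x)).
have ReIm z x : (z : R[i]) *: x = (complex.Re z)%:C *: x + (complex.Im z)%:C *: ('i *: x).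
  by rewrite scalerA -scalerDl; congr (_ *: _); case: z => a b; apply/eqP; rewrite eq_complex /=; apply/andP; split; apply/eqP; ring.
have lf : linear f.
  move=> a x y; rewrite /f scalerDr !uD.
  have -> : 'i *: (a *: x) = a *: ('i *: x) by rewrite !scalerA mulrC.
  rewrite (ReIm a x) (ReIm a ('i *: x)) !uD !uZ.
  have -> : 'i *: ('i *: x) = - x by rewrite scalerA -expr2 sqr_i scaleN1r.
  rewrite uN; case: a => a b /=.
  apply/eqP; rewrite eq_complex /=.
  by apply/andP; split; apply/eqP; ring.
have nf x : nrm (f x) <= 2 * nrm x.
  rewrite (le_trans (nrm_ReIm _))//= mulr_natl mulr2n lerD// normrN.
  by rewrite (le_trans (uabs _))// nrmZ nrmi mul1r.
have bf : f \in bounded_linear X R[i]^o.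
  by apply/asboolP; split => //; exists 2.
exists (Bop bf).
  rewrite nrm_bop; apply: opnorm_lub => x x1.
  by rewrite (le_trans (nf x))// ler_piMr.
by rewrite (le_trans uv)//= (le_trans _ (Re_nrm _))//= ler_norm.
Qed.

End Sublinear.

(** * Averages over signs *)

(* The expectation of g (sum_(k < n) eps_k x_k) for independent signs. *)
Fixpoint radE {R : realType} {Y : zmodType} n (x : nat -> Y) (g : Y -> R) : R :=
  if n is n'.+1 then
    (radE n' x (fun v => g (v + x n')) + radE n' x (fun v => g (v - x n'))) / 2
  else g 0.

Definition sqn {R : realType} {Y : normedModType R[i]} (v : Y) : R := nrm v ^+ 2.

Section RadE.
Context {R : realType}.

Lemma eq_radE (Y : zmodType) n (x y : nat -> Y) (g h : Y -> R) :
  (forall k, (k < n)%N -> x k = y k) -> g =1 h -> radE n x g = radE n y h.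
Proof.
elim: n g h => [|n IH] g h xy gh //=.
have xy' k : (k < n)%N -> x k = y k by move=> kn; rewrite xy// ltnW.
by congr ((_ + _) / _); apply: IH => // v; rewrite gh xy.
Qed.

Lemma radE_le (Y : zmodType) n (x : nat -> Y) (g h : Y -> R) :
  (forall v, g v <= h v) -> radE n x g <= radE n x h.
Proof.
elim: n g h => [|n IH] g h gh //=.
by rewrite ler_pM2r ?invr_gt0// lerD// IH.
Qed.

Lemma radE_linear (Y : zmodType) n (x : nat -> Y) (a b : R) (g h : Y -> R) :
  radE n x (fun v => a * g v + b * h v) = a * radE n x g + b * radE n x h.
Proof.
elim: n g h => [|n IH] g h //=.
rewrite (IH (fun v => g (v + x n)) (fun v => h (v + x n))).
by rewrite (IH (fun v => g (v - x n)) (fun v => h (v - x n))); field.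
Qed.

Lemma radEZ (Y : zmodType) n (x : nat -> Y) (a : R) (g : Y -> R) :
  radE n x (fun v => a * g v) = a * radE n x g.
Proof.
rewrite -[RHS]addr0 -[in RHS](mul0r (radE n x g)) -radE_linear.
by apply: eq_radE => // v; rewrite mul0r addr0.
Qed.

Lemma radE_ge0 (Y : zmodType) n (x : nat -> Y) (g : Y -> R) :
  (forall v, 0 <= g v) -> 0 <= radE n x g.
Proof.
elim: n g => [|n IH] g g0 //=.
by rewrite divr_ge0// addr_ge0// IH.
Qed.

Lemma radE_raddf (Y Z : zmodType) (f : {additive Y -> Z}) n (x : nat -> Y) (g : Z -> R) :
  radE n (fun k => f (x k)) g = radE n x (g \o f).
Proof.
elim: n g => [|n IH] g /=; first by rewrite raddf0.
rewrite !IH; congr ((_ + _) / _); apply: eq_radE => // v /=.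
  by rewrite raddfD.
by rewrite raddfB.
Qed.

Lemma radE_sign (Y : zmodType) n (x : nat -> Y) (s : nat -> bool) (g : Y -> R) :
  radE n (fun k => if s k then - x k else x k) g = radE n x g.
Proof.
elim: n g => [|n IH] g //=; rewrite !IH.
case: (s n) => //; rewrite addrC; congr ((_ + _) / _).
by apply: eq_radE => // v; rewrite opprK.
Qed.

(** Both components carry the same sign, so the cross terms cancel and only the diagonal
    survives. *)
Lemma radE_biadditive (Y Z : zmodType) (phi : Y -> Z -> R) n (y : nat -> Y) (z : nat -> Z) :
  (forall a b c, phi (a + b) c = phi a c + phi b c) ->
  (forall a b c, phi a (b + c) = phi a b + phi a c) ->
  radE n (fun k => (y k, z k)) (fun p => phi p.1 p.2) = \sum_(k < n) phi (y k) (z k).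
Proof.
move=> phiDl phiDr.
have phi0l b : phi 0 b = 0.
  by apply: (addrI (phi 0 b)); rewrite -phiDl !addr0.
have phi0r b : phi b 0 = 0.
  by apply: (addrI (phi b 0)); rewrite -phiDr !addr0.
have phiNl a b : phi (- a) b = - phi a b.
  by apply: (addrI (phi a b)); rewrite -phiDl !subrr.
have phiNr a b : phi a (- b) = - phi a b.
  by apply: (addrI (phi a b)); rewrite -phiDr !subrr.
(* The recursion of [radE] translates its argument, so the induction needs an arbitrary base point;
   the same device recurs in the lemmas below. *)
have H a b : radE n (fun k => (y k, z k)) (fun p => phi (p.1 + a) (p.2 + b)) =
    phi a b + \sum_(k < n) phi (y k) (z k).
  elim: n a b => [|n IH] a b /=; first by rewrite big_ord0 !add0r addr0.
  rewrite (@eq_radE _ n _ (fun k => (y k, z k)) _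
    (fun p => phi (p.1 + (y n + a)) (p.2 + (z n + b))))//; last by move=> p; rewrite !addrA.
  rewrite (@eq_radE _ n (fun k => (y k, z k)) (fun k => (y k, z k))
    (fun v => phi (v.1 - y n + a) (v.2 - z n + b))
    (fun p => phi (p.1 + (- y n + a)) (p.2 + (- z n + b))))//; last first.
    by move=> p; rewrite !addrA.
  rewrite !IH big_ord_recr/= !phiDl !phiDr !phiNl !phiNr.
  by field.
have := H 0 0; rewrite phi0l add0r => <-.
by apply: eq_radE => // p; rewrite !addr0.
Qed.

Definition convex_fun (Y : lmodType R[i]) (g : Y -> R) :=
  forall m (p : 'I_m -> R) (v : 'I_m -> Y), (forall j, 0 <= p j) -> \sum_j p j = 1 ->
  g (\sum_j (p j)%:C *: v j) <= \sum_j p j * g (v j).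

Lemma radE_convex (Y : lmodType R[i]) (g : Y -> R) n m (p : 'I_m -> R) (x : 'I_m -> nat -> Y) :
  convex_fun g -> (forall j, 0 <= p j) -> \sum_j p j = 1 ->
  radE n (fun k => \sum_j (p j)%:C *: x j k) g <= \sum_j p j * radE n (x j) g.
Proof.
move=> gconv p0 p1.
have H (y : 'I_m -> Y) :
    radE n (fun k => \sum_j (p j)%:C *: x j k) (fun v => g (v + \sum_j (p j)%:C *: y j)) <=
    \sum_j p j * radE n (x j) (fun v => g (v + y j)).
  elim: n y => [|n IH] y /=.
    by rewrite add0r (le_trans (gconv _ _ _ _ _))//; apply: ler_sum => j _; rewrite add0r.
  have E : \sum_j p j * ((radE n (x j) (fun v => g (v + x j n + y j)) +
      radE n (x j) (fun v => g (v - x j n + y j))) / 2) =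
      (\sum_j p j * radE n (x j) (fun v => g (v + (x j n + y j))) +
       \sum_j p j * radE n (x j) (fun v => g (v + (- x j n + y j)))) / 2.
    rewrite -big_split /= mulr_suml; apply: eq_bigr => j _; rewrite mulrA mulrDr.
    by congr ((_ * _ + _ * _) / _); apply: eq_radE => // v; rewrite addrA.
  rewrite E ler_pM2r ?invr_gt0//; apply: lerD.
    apply: le_trans (IH _); rewrite le_eqVlt; apply/orP; left; apply/eqP.
    apply: eq_radE => // v; rewrite -addrA -big_split/=; congr (g (_ + _)).
    by apply: eq_bigr => j _; rewrite scalerDr.
  apply: le_trans (IH _); rewrite le_eqVlt; apply/orP; left; apply/eqP.
  apply: eq_radE => // v; rewrite -addrA -sumrN -big_split/=; congr (g (_ + _)).
  by apply: eq_bigr => j _; rewrite scalerDr scalerN.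
have := H (fun=> 0).
rewrite (_ : \sum_j _ = 0); last by apply: big1 => j _; rewrite scaler0.
move=> H'; apply: le_trans (le_trans H' _).
  by rewrite le_eqVlt; apply/orP; left; apply/eqP/eq_radE => // v; rewrite addr0.
apply: ler_sum => j _; rewrite le_eqVlt; apply/orP; left; apply/eqP.
by congr (_ * _); apply: eq_radE => // v; rewrite addr0.
Qed.

Definition hull (Y : lmodType R[i]) (E : set Y) : set Y :=
  [set v | exists m (p : 'I_m -> R) (e : 'I_m -> Y),
    [/\ forall j, 0 <= p j, \sum_j p j = 1, forall j, E (e j) & v = \sum_j (p j)%:C *: e j]].

(** The average is convex in each coordinate separately, so a bound over all choices of generators
    extends to the hulls by treating one coordinate after the other. *)
Lemma radE_hull (Y : lmodType R[i]) (g : Y -> R) n (E : nat -> set Y) (B : R) :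
  convex_fun g ->
  (forall v, (forall k, (k < n)%N -> E k (v k)) -> radE n v g <= B) ->
  forall v, (forall k, (k < n)%N -> hull (E k) (v k)) -> radE n v g <= B.
Proof.
move=> gconv EB.
(* Only the coordinates below [m] are still in a hull; those from [m] on are generators. *)
suff H m : forall v, (forall k, (k < n)%N -> (k < m)%N -> hull (E k) (v k)) ->
    (forall k, (k < n)%N -> (m <= k)%N -> E k (v k)) -> radE n v g <= B.
  move=> v hv; apply: (H n) => [k kn _|k kn]; first exact: hv.
  by rewrite leqNgt kn.
elim: m => [|m IH] v hv Ev; first by apply: EB => k kn; exact: Ev.
have [nm|mn] := leqP n m.
  apply: IH => k kn km; first by apply: hv => //; rewrite ltnW.
  by move: (leq_trans kn nm); rewrite ltnNge km.
have [l [p [e [p0 p1 Ee vm]]]] := hv m mn (ltnSn m).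
pose x j k := if k == m then e j else v k.
rewrite (_ : radE n v g = radE n (fun k => \sum_j (p j)%:C *: x j k) g); last first.
  apply: eq_radE => // k kn; rewrite /x; have [->|km] := eqVneq k m; first by rewrite vm.
  by rewrite -scaler_suml -rmorph_sum/= p1 scale1r.
apply: le_trans (radE_convex n x gconv p0 p1) _.
rewrite -[leRHS]mul1r -p1 mulr_suml; apply: ler_sum => j _.
apply: ler_wpM2l => //; apply: IH => k kn km; rewrite /x.
  by rewrite ltn_eqF//; apply: hv => //; rewrite ltnW.
have [->|nkm] := eqVneq k m; first exact: Ee.
by apply: Ev => //; rewrite ltn_neqAle eq_sym nkm.
Qed.

End RadE.

Section RadSquare.
Context {R : realType}.

Lemma sqn_ge0 (Y : normedModType R[i]) (v : Y) : 0 <= sqn v.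
Proof. exact: sqr_ge0. Qed.

Lemma sqnD (Y : normedModType R[i]) (v w : Y) : sqn (v + w) <= 2 * sqn v + 2 * sqn w.
Proof.
apply: (@le_trans _ _ ((nrm v + nrm w) ^+ 2)).
  by rewrite ler_sqr ?nnegrE ?addr_ge0 ?nrm_ge0// nrmD.
by rewrite /sqn; have := sqr_ge0 (nrm v - nrm w); nra.
Qed.

Lemma sqnZ (Y : normedModType R[i]) (a : R[i]) (v : Y) :
  sqn (a *: v) = sqn (a : R[i]^o) * sqn v.
Proof. by rewrite /sqn nrmZ exprMn. Qed.

Lemma sqn_convex (Y : normedModType R[i]) : convex_fun (@sqn R Y).
Proof.
move=> m p v p0 p1; pose s := \sum_j p j * nrm (v j).
have s0 : 0 <= s by apply: sumr_ge0 => j _; rewrite mulr_ge0 ?nrm_ge0.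
apply: (@le_trans _ _ (s ^+ 2)).
  rewrite /sqn ler_sqr ?nnegrE ?nrm_ge0// (le_trans (nrm_sum _ _ _))//.
  by apply: ler_sum => j _; rewrite nrmZr ger0_norm.
rewrite -subr_ge0 (_ : _ - _ = \sum_j p j * (nrm (v j) - s) ^+ 2).
  by apply: sumr_ge0 => j _; rewrite mulr_ge0// sqr_ge0.
transitivity (\sum_j p j * nrm (v j) ^+ 2 - 2 * s * \sum_j p j * nrm (v j) + s ^+ 2 * \sum_j p j).
  by rewrite p1 -/s /sqn; ring.
clearbody s; rewrite !mulr_sumr -sumrB -big_split/=; apply: eq_bigr => j _.
ring.
Qed.

(** Each [v] is the mean of v + x n and v - x n, and the squared norm is convex. *)
Lemma radE_sqn_mono (Y : normedModType R[i]) m n (x : nat -> Y) : (m <= n)%N ->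
  radE m x sqn <= radE n x sqn.
Proof.
elim: n => [|n IH]; first by rewrite leqn0 => /eqP ->.
rewrite leq_eqVlt => /orP[/eqP -> //|]; rewrite ltnS => /IH /le_trans; apply => /=.
have -> : (radE n x (fun v => sqn (v + x n)) + radE n x (fun v => sqn (v - x n))) / 2 =
   radE n x (fun v => 2^-1 * sqn (v + x n) + 2^-1 * sqn (v - x n)).
  by rewrite radE_linear mulrDl !(mulrC _ 2^-1).
apply: radE_le => v.
have {1}-> : v = 2^-1%:C *: ((v + x n) + (v - x n)).
  rewrite addrACA subrr addr0 scalerDr -scalerDl -rmorphD/=.
  by rewrite (_ : _ + _ = 1) ?scale1r//; field.
rewrite sqnZ [sqn (_ : R[i]^o)]/sqn nrm_real ger0_norm ?invr_ge0//.
by have := sqnD (v + x n) (v - x n); lra.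
Qed.

Lemma radE_sqnZ (Y : normedModType R[i]) n (x : nat -> Y) (a : R[i]) :
  radE n (fun k => a *: x k) sqn = sqn (a : R[i]^o) * radE n x sqn.
Proof.
rewrite (radE_raddf ( *:%R a : {additive Y -> Y})) -radEZ.
by apply: eq_radE => // v /=; rewrite sqnZ.
Qed.

Lemma radE_sqnD (Y : normedModType R[i]) n (x y : nat -> Y) :
  radE n (fun k => x k + y k) sqn <= 2 * radE n x sqn + 2 * radE n y sqn.
Proof.
have H (a b : Y) : radE n (fun k => x k + y k) (fun v => sqn (v + (a + b))) <=
    2 * radE n x (fun v => sqn (v + a)) + 2 * radE n y (fun v => sqn (v + b)).
  elim: n a b => [|n IH] a b /=; first by rewrite !add0r sqnD.
  have := lerD (IH (x n + a) (y n + b)) (IH (- x n + a) (- y n + b)).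
  rewrite (@eq_radE _ _ _ _ (fun k => x k + y k) _ (fun v => sqn (v + (x n + y n) + (a + b))))//; last first.
    by move=> v /=; rewrite (addrACA (x n)) (addrA v).
  rewrite (@eq_radE _ _ _ (fun k => x k + y k) (fun k => x k + y k)
    (fun v => sqn (v + _)) (fun v => sqn (v - (x n + y n) + (a + b))))//; last first.
    by move=> v /=; rewrite opprD (addrACA (- x n)) (addrA v).
  rewrite (@eq_radE _ _ _ x x (fun v => sqn (v + (x n + a))) (fun v => sqn (v + x n + a)))//; last first.
    by move=> v; rewrite addrA.
  rewrite (@eq_radE _ _ _ x x (fun v => sqn (v + (- x n + a))) (fun v => sqn (v - x n + a)))//; last first.
    by move=> v; rewrite addrA.
  rewrite (@eq_radE _ _ _ y y (fun v => sqn (v + (y n + b))) (fun v => sqn (v + y n + b)))//; last first.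
    by move=> v; rewrite addrA.
  rewrite (@eq_radE _ _ _ y y (fun v => sqn (v + (- y n + b))) (fun v => sqn (v - y n + b)))//; last first.
    by move=> v; rewrite addrA.
  lra.
have := H 0 0; rewrite addr0 (_ : (fun v : Y => sqn (v + 0)) = sqn)//.
by apply/funext => v; rewrite addr0.
Qed.

(** Kahane's contraction principle. A real coefficient in [-1, 1] is a convex combination of 1 and
    -1, and changing signs does not alter the average; treating real and imaginary parts separately
    costs the factor 4. *)
Lemma radE_contraction (Y : normedModType R[i]) n (x : nat -> Y) (c : nat -> R[i]^o) :
  (forall k, (k < n)%N -> nrm (c k) <= 1) ->
  radE n (fun k => c k *: x k) sqn <= 4 * radE n x sqn.
Proof.
move=> c1.
have rcontr (r : nat -> R) (z : nat -> Y) : (forall k, (k < n)%N -> `|r k| <= 1) ->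
    radE n (fun k => (r k)%:C *: z k) sqn <= radE n z sqn.
  move=> r1; pose E k : set Y := [set v | v = z k \/ v = - z k].
  apply: (@radE_hull _ _ _ _ E); first exact: sqn_convex.
    move=> v Ev; rewrite -(radE_sign n z (fun k => v k != z k)).
    rewrite le_eqVlt; apply/orP; left; apply/eqP; apply: eq_radE => // k kn.
    by have [->//|vz /=] := eqVneq (v k) (z k); case: (Ev k kn) => // /eqP; rewrite (negbTE vz).
  move=> k kn; have := r1 k kn; rewrite ler_norml => /andP[rl rr].
  exists 2, (fun j => if j == 0 then (1 + r k) / 2 else (1 - r k) / 2),
    (fun j => if j == 0 then z k else - z k); split.
  - by move=> j; case: ifP => _; rewrite divr_ge0//; lra.
  - by rewrite big_ord_recl big_ord1 /=; field.
  - by move=> j; case: ifP => _; [left|right].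
  - rewrite big_ord_recl big_ord1 /= scalerN -scalerBl -rmorphB/=; congr (_%:C *: _).
    by field.
rewrite (@eq_radE _ _ _ _ (fun k => (complex.Re (c k))%:C *: x k +
    (complex.Im (c k))%:C *: ('i *: x k)) _ sqn)//; last first.
  move=> k _; rewrite scalerA -scalerDl; congr (_ *: _); case: (c k) => a b.
  by apply/eqP; rewrite eq_complex /=; apply/andP; split; apply/eqP; ring.
have H1 := rcontr (fun k => complex.Re (c k)) x (fun k kn => le_trans (Re_nrm _) (c1 k kn)).
have H2 := rcontr (fun k => complex.Im (c k)) (fun k => 'i *: x k)
  (fun k kn => le_trans (Im_nrm _) (c1 k kn)).
rewrite radE_sqnZ [sqn ('i : R[i]^o)]/sqn nrmi expr1n mul1r in H2.
apply: le_trans (radE_sqnD _ _ _) _; lra.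
Qed.

(* The absolutely convex hull of an R-bounded set is R-bounded. *)
Lemma radE_acvx (Y : normedModType R[i]) n (x : nat -> Y) m (W : 'I_m -> Y -> Y)
    (c : nat -> 'I_m -> R[i]^o) (B : R) :
  0 <= B ->
  (forall J : nat -> 'I_m, radE n (fun k => W (J k) (x k)) sqn <= B) ->
  (forall k, (k < n)%N -> \sum_j nrm (c k j) <= 1) ->
  radE n (fun k => \sum_j c k j *: W j (x k)) sqn <= 4 * B.
Proof.
move=> B0 WB c1.
have [m0|m0] := posnP m.
  rewrite (@eq_radE _ _ _ _ (fun k => (0 : R[i]) *: x k) _ sqn)//; last first.
    by move=> k _; rewrite scale0r big1// => j _; have := ltn_ord j; rewrite [X in (_ < X)%N]m0.
  by rewrite radE_sqnZ [sqn _]/sqn nrm0 expr0n mul0r mulr_ge0.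
(* Generators are allowed a scalar of modulus at most 1, so that the phases of the coefficients go
   into the generators and are removed by [radE_contraction]. *)
pose E k : set Y := [set v | exists j (t : R[i]^o), nrm t <= 1 /\ v = t *: W j (x k)].
apply: (@radE_hull _ _ _ _ E); first exact: sqn_convex.
  move=> v Ev.
  pose j0 := Ordinal m0.
  have /choice[Jt HJt] : forall k, exists Jt : 'I_m * R[i]^o, (k < n)%N ->
      nrm Jt.2 <= 1 /\ v k = Jt.2 *: W Jt.1 (x k).
    move=> k; have [kn|_] := boolP (k < n)%N; last by exists (j0, 0).
    by have [j [t Ht]] := Ev k kn; exists (j, t).
  rewrite (@eq_radE _ _ _ _ (fun k => (Jt k).2 *: W (Jt k).1 (x k)) _ sqn)//; last first.
    by move=> k kn; have [_ ->] := HJt k kn.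
  apply: le_trans (radE_contraction _ _) _; first by move=> k kn; have [] := HJt k kn.
  by rewrite ler_pM2l// (WB (fun k => (Jt k).1)).
move=> k kn.
(* The moduli serve as convex weights; the missing mass [q] is placed on the generator 0. *)
pose q := 1 - \sum_j nrm (c k j).
have q0 : 0 <= q by rewrite subr_ge0 c1.
exists m.+1, (fun j => if unlift ord0 j is Some i then nrm (c k i) else q),
  (fun j => if unlift ord0 j is Some i then ((nrm (c k i))^-1%:C * c k i) *: W i (x k) else 0).
split.
- by move=> j; case: unliftP => [i _|_] //; exact: nrm_ge0.
- rewrite big_ord_recl unlift_none; under eq_bigr do rewrite liftK.
  by rewrite /q subrK.
- move=> j; case: unliftP => [i _|_]; last first.
    by exists (Ordinal m0), 0; rewrite nrm0 scale0r.
  exists i, ((nrm (c k i))^-1%:C * c k i); split => //.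
  rewrite (nrmM _ (c k i)) nrm_real ger0_norm ?invr_ge0 ?nrm_ge0//.
  by have [->|c0] := eqVneq (nrm (c k i)) 0; [rewrite mulr0|rewrite mulVf].
- rewrite big_ord_recl unlift_none scaler0 add0r; apply: eq_bigr => i _.
  rewrite liftK scalerA mulrA -rmorphM/=.
  have [c0|c0] := eqVneq (nrm (c k i)) 0; last by rewrite divff// mul1r.
  by rewrite c0 mul0r mul0r (nrm_eq0 c0).
Qed.

End RadSquare.

(** * Rademacher sums *)

Section LowerIntegral.
Import HBNNSimple.
Context {d} {T : measurableType d} {R : realType} (mu : {measure set T -> \bar R}).
Local Open Scope ereal_scope.

(** Here [f] and [h] are arbitrary nonnegative functions: the integral is a supremum over simple
    functions below, and such a function below [f], set to 0 on [N], lies below [h] with unchanged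
    integral. *)
Lemma le_integral_off_null (N : set T) (f h : T -> \bar R) :
  measurable N -> mu N = 0 -> (forall x, 0 <= f x) -> (forall x, 0 <= h x) ->
  (forall x, ~ N x -> f x <= h x) -> \int[mu]_x f x <= \int[mu]_x h x.
Proof.
move=> mN N0 f0 h0 fh; rewrite [leLHS]ge0_integralTE//.
apply: ge_ereal_sup => _ [/= phi phif <-].
rewrite -integralT_nnsfun (ge0_negligible_integral mN)//; last 2 first.
- by apply/measurable_EFinP; exact: measurable_funPT.
- by move=> x _; rewrite lee_fin.
rewrite setTD [leRHS]ge0_integralTE//; apply: ereal_sup_ubound.
exists (proj_nnsfun phi (measurableC mN)) => [x|] /=.
  rewrite mindicE; have [xN|xN] := boolP (x \in ~` N).
    by rewrite mulr1 (le_trans (phif x))// fh//; move: xN; rewrite inE.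
  by rewrite mulr0.
rewrite -(integralT_nnsfun mu (proj_nnsfun phi (measurableC mN))) [RHS]integral_mkcond; apply: eq_integral => x _ /=.
rewrite patchE mindicE; case: ifPn => _; by rewrite ?mulr1 ?mulr0.
Qed.

Lemma le_integral_T (D : set T) (f h : T -> \bar R) :
  (forall x, 0 <= f x) -> (forall x, 0 <= h x) ->
  (forall x, D x -> f x <= h x) -> \int[mu]_(x in D) f x <= \int[mu]_x h x.
Proof.
move=> f0 h0 fh; rewrite integral_mkcond.
apply: (@le_integral_off_null set0) => // [x|x _].
  by rewrite patchE; case: ifP.
by rewrite patchE; case: ifPn => // /set_mem; exact: fh.
Qed.

End LowerIntegral.

Section SimpleFunctions.
Context {R : realType} {d} {M : measurableType d}.

Let measurable_map2 (T1 T2 U : Type) (s1 : M -> T1) (s2 : M -> T2) (phi : T1 -> T2 -> U) (B : set U) :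
  finite_set (range s1) -> (forall y, measurable (s1 @^-1` [set y])) ->
  finite_set (range s2) -> (forall y, measurable (s2 @^-1` [set y])) ->
  measurable ((fun w => phi (s1 w) (s2 w)) @^-1` B).
Proof.
move=> f1 m1 f2 m2.
rewrite (_ : _ @^-1` _ = \bigcup_(p in (range s1 `*` range s2) `&` [set p | B (phi p.1 p.2)])
  (s1 @^-1` [set p.1] `&` s2 @^-1` [set p.2])).
  apply: fin_bigcup_measurable; last by move=> p _; exact: measurableI.
  by apply: finite_setI; left; exact: finite_setX.
apply/seteqP; split => [w /= Bw|w [[y1 y2] [/= _ B12] [/= -> ->]]//].
by exists (s1 w, s2 w) => //=; split => //; split => /=; [exists w|exists w].
Qed.

Lemma simple_measurable2 (Y1 Y2 : normedModType R[i]) (s1 : M -> Y1) (s2 : M -> Y2) (phi : Y1 -> Y2 -> R) :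
  simple_function s1 -> simple_function s2 ->
  measurable_fun setT (fun w => phi (s1 w) (s2 w)).
Proof. by move=> [f1 m1] [f2 m2] _ B mB; rewrite setTI; exact: measurable_map2. Qed.

Lemma simple_map2 (Y1 Y2 Y : normedModType R[i]) (s1 : M -> Y1) (s2 : M -> Y2) (phi : Y1 -> Y2 -> Y) :
  simple_function s1 -> simple_function s2 ->
  simple_function (fun w => phi (s1 w) (s2 w)).
Proof.
move=> [f1 m1] [f2 m2]; split; last by move=> y; exact: measurable_map2.
apply: (@sub_finite_set _ _ ((fun p => phi p.1 p.2) @` (range s1 `*` range s2))).
  by move=> _ [w _ <-]; exists (s1 w, s2 w) => //; split; exists w.
by apply: finite_image; exact: finite_setX.
Qed.

Lemma simple_cst (Y : normedModType R[i]) (y : Y) : simple_function (fun _ : M => y).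
Proof.
split; first by apply: (@sub_finite_set _ _ [set y]) => // _ [w _ <-].
move=> z; have [->|yz] := pselect (y = z).
  by rewrite (_ : _ @^-1` _ = setT)//; apply/seteqP; split.
by rewrite (_ : _ @^-1` _ = set0)//; apply/seteqP; split.
Qed.

Lemma simple_if (Y : normedModType R[i]) (A : set M) (b : M -> bool) (y z : Y) :
  measurable A -> (forall w, reflect (A w) (b w)) ->
  simple_function (fun w => if b w then y else z).
Proof.
move=> mA Ab; split.
  apply: (@sub_finite_set _ _ [set y; z]) => [_ [w _ <-]|]; first by case: ifP => _; [left|right].
  exact: finite_set2.
move=> t; rewrite (_ : _ @^-1` _ =
  (A `&` [set _ | y = t]) `|` (~` A `&` [set _ | z = t])).
  have mc (Q : Prop) : measurable [set _ : M | Q].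
    have [q|q] := pselect Q.
      by rewrite (_ : [set _ | _] = setT)//; apply/seteqP; split.
    by rewrite (_ : [set _ | _] = set0)//; apply/seteqP; split.
  by apply: measurableU; apply: measurableI => //; exact: measurableC.
apply/seteqP; split => w /=; case: Ab => Aw; by [left|right|case=> -[]].
Qed.

End SimpleFunctions.

Section NormCvg.
Context {R : realType} {V : normedModType R[i]}.

Lemma cvg_nrmP {T : Type} {F : set_system T} {FF : Filter F} (f : T -> V) (l : V) :
  f @ F --> l <-> forall e : R, 0 < e -> \forall t \near F, nrm (l - f t) < e.
Proof.
split=> [/cvgrPdist_lt H e e0|H].
  have := H e%:C; rewrite ltcR => /(_ e0); apply: filterS => t.
  by rewrite -nrmE ltcR.
apply/cvgrPdist_lt => -[e e'] /=; rewrite ltcE /= => /andP[/eqP -> e0].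
by apply: filterS (H _ e0) => t; rewrite -nrmE ltcE /= eqxx.
Qed.

Lemma cvg_nrm {T : Type} {F : set_system T} {FF : Filter F} (f : T -> V) (l : V) :
  f @ F --> l -> nrm (f t) @[t --> F] --> nrm l.
Proof.
move=> /cvg_nrmP H; apply/cvgrPdist_lt => e e0; apply: filterS (H _ e0) => t.
by apply: le_lt_trans; exact: ler_dist_nrm.
Qed.

Lemma cvg_sqn {T : Type} {F : set_system T} {FF : Filter F} (f : T -> V) (l : V) :
  f @ F --> l -> sqn (f t) @[t --> F] --> sqn l.
Proof. by move=> /cvg_nrm H; rewrite /sqn; under eq_fun do rewrite expr2; rewrite expr2; exact: cvgM. Qed.

End NormCvg.

Section L2norm.
Context {R : realType} {d} {M : measurableType d} (mu : {measure set M -> \bar R}).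
Context {Y : normedModType R[i]}.
Local Open Scope ereal_scope.

Lemma L2normE (f : M -> Y) : L2norm mu f = (\int[mu]_w (sqn (f w))%:E) `^ 2^-1.
Proof.
rewrite /L2norm unlock; congr (_ `^ _); apply: eq_integral => w _ /=.
by rewrite ger0_norm ?nrm_ge0// powR_mulrn// nrm_ge0.
Qed.

Lemma L2norm_sqr (f : M -> Y) : (L2norm mu f) `^ 2 = \int[mu]_w (sqn (f w))%:E.
Proof.
rewrite L2normE -poweRrM mulVf ?pnatr_eq0// poweRe1//.
by apply: integral_ge0 => w _; rewrite lee_fin sqn_ge0.
Qed.

Lemma L2norm_le (f : M -> Y) (C : R) : (0 <= C)%R -> L2norm mu f <= C%:E ->
  \int[mu]_w (sqn (f w))%:E <= (C ^+ 2)%:E.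
Proof.
move=> C0 fC; rewrite -L2norm_sqr -powR_mulrn// -poweR_EFin.
by apply: gt0_ler_poweR => //; rewrite in_itv/= leey ?andbT ?lee_fin// Lnorm_ge0.
Qed.

End L2norm.

Section Rademacher.
Context {R : realType} {d} {M : measurableType d} (P : probability M R).
Variable eps : nat -> {RV P >-> R}.
Hypothesis eps_rad : rademacher_sequence eps.

(** The negative sign is the complement of 1 rather than -1, so that the two events partition the
    space everywhere and not only almost everywhere; both still have probability 1/2. *)
Let sgnset (b : bool) : set R := if b then [set 1] else ~` [set 1].

Let msgnset b : measurable (sgnset b).
Proof. by case: b => //=; exact: measurableC. Qed.

Let eps1 k (w : M) : bool := eps k w == 1.

Let meps k (A : set R) : measurable A -> measurable (eps k @^-1` A).
Proof. by move=> mA; rewrite -[_ @^-1` _]setTI; exact: measurable_funPT. Qed.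

Let eps1P k b w : (sgnset b (eps k w)) <-> (eps1 k w = b).
Proof.
rewrite /eps1 /sgnset; case: b.
  by split => [->|/eqP //]; rewrite eqxx.
by split => [/eqP/negbTE//|H /= /eqP]; rewrite H.
Qed.

Let cyl n N (s : nat -> bool) : set M :=
  [set w | forall k, (n <= k < N)%N -> eps1 k w = s k].

Let cylE n N s : cyl n N s = \bigcap_(k in [set k | (n <= k < N)%N]) (eps k @^-1` sgnset (s k)).
Proof.
by apply/seteqP; split => w H k kN; [apply/eps1P; exact: H|apply/eps1P; exact: (H k)].
Qed.

Let mcyl n N s : measurable (cyl n N s).
Proof.
rewrite cylE; apply: bigcap_measurableType => k _; exact: meps.
Qed.

Let P_sgnset k b : P (eps k @^-1` sgnset b) = (2^-1)%:E.
Proof.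
have [H1 _] := eps_rad.1 k; case: b => //=.
rewrite -preimage_setC probability_setC; last exact: meps.
by rewrite H1 -EFinB; congr EFin; lra.
Qed.

Let P_cyl N s : P (cyl 0 N s) = (2 ^- N)%:E.
Proof.
have [J [memJ sizeJ]] : exists J : {fset nat}, (forall k, (k \in J) = (k < N)%N) /\ size J = N.
  exists (seq_fset tt (iota 0 N)); split => [k|]; first by rewrite seq_fsetE mem_iota.
  by rewrite size_seq_fset undup_id ?iota_uniq// size_iota.
have := eps_rad.2 J (fun k => sgnset (s k)) (fun k => msgnset (s k)).
rewrite [X in P X = _](_ : _ = cyl 0 N s); last first.
  by rewrite cylE; apply: eq_bigcapl; split => k /=; rewrite memJ.
move=> ->; under eq_bigr do rewrite P_sgnset.
rewrite prodEFin; congr EFin.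
rewrite big_const_seq count_predT sizeJ.
by rewrite -exprVn; elim: (N) => //= m ->; rewrite exprS.
Qed.

Let rad_sum' {Y : normedModType R[i]} n (x : nat -> Y) : M -> Y :=
  fun w => \sum_(k < n) (if eps1 k w then x k else - x k).

Let rad_sum'_simple {Y : normedModType R[i]} n (x : nat -> Y) :
  simple_function (rad_sum' n x).
Proof.
rewrite /rad_sum'; elim: n => [|n IH].
  by under [X in simple_function X]funext do rewrite big_ord0; exact: simple_cst.
under [X in simple_function X]funext do rewrite big_ord_recr.
apply: (simple_map2 +%R) IH _.
apply: (@simple_if _ _ _ _ (eps n @^-1` [set 1])); first exact: meps.
by move=> w; apply: (iffP eqP).
Qed.

(** Induction on the number of free signs: fixing one more sign splits the cylinder in two and
    reproduces the recursion of [radE]. Independence enters only at the end, where all signs are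
    fixed; m = 0 is the integral over the whole space. *)
Let integral_cyl (Y : normedModType R[i]) n m s (x : nat -> Y) (g : Y -> R) :
  (forall v, 0 <= g v) ->
  (\int[P]_(w in cyl n (n + m) s) (g (rad_sum' n x w))%:E = (radE n x g * 2 ^- m)%:E)%E.
Proof.
elim: n m s g => [|n IH] m s g g0.
  under eq_integral do rewrite /rad_sum' big_ord0.
  rewrite add0n integral_cst; last exact: mcyl.
  transitivity ((g 0)%:E * (2 ^- m)%:E)%E; last by rewrite -EFinM.
  by congr (_ * _)%E; exact: P_cyl.
pose sb b k := if k == n then b else s k.
have cylb b w : cyl n (n + m.+1) (sb b) w <-> cyl n.+1 (n.+1 + m) s w /\ eps1 n w = b.
  rewrite addnS -addSn; split=> [H|[H1 H2] k /andP[nk kN]]; last first.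
    rewrite /sb; have [->//|kn] := eqVneq k n.
    by apply: H1; rewrite kN ltn_neqAle eq_sym kn nk.
  split; last by rewrite H ?leqnn ?ltn_addr ?leq_addr//= /sb eqxx.
  move=> k /andP[nk kN]; rewrite H ?kN ?(ltnW nk)// /sb.
  by rewrite gtn_eqF.
rewrite (_ : cyl n.+1 (n.+1 + m) s = cyl n (n + m.+1) (sb true) `|` cyl n (n + m.+1) (sb false)); last first.
  apply/seteqP; split => w.
    by move=> Hw; case En: (eps1 n w); [left|right]; apply/cylb.
  by case=> /cylb[].
have mg : measurable_fun setT (fun w => (g (rad_sum' n.+1 x w))%:E).
  apply/measurable_EFinP.
  exact: (simple_measurable2 (fun v _ => g v) (rad_sum'_simple _ _) (rad_sum'_simple 0 x)).
rewrite ge0_integral_setU//=; last 3 first.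
- exact: measurable_funTS.
- by move=> w _; rewrite lee_fin.
- by apply/disj_setPS => w [/cylb[_ wT] /cylb[_]]; rewrite wT.
have E b : (\int[P]_(w in cyl n (n + m.+1) (sb b)) (g (rad_sum' n.+1 x w))%:E =
    \int[P]_(w in cyl n (n + m.+1) (sb b)) (g (rad_sum' n x w + if b then x n else - x n))%:E)%E.
  by apply: eq_integral => w /set_mem /cylb[_ wb]; rewrite /rad_sum' big_ord_recr/= wb.
rewrite !E (IH _ _ (fun v => g (v + x n)))// (IH _ _ (fun v => g (v - x n)))// -EFinD.
by congr EFin; rewrite -mulrDl exprS invfM mulrA.
Qed.

Let eps_exceptional : exists N : set M, [/\ measurable N, P N = 0%E &
  forall w, ~ N w -> forall n (Y : normedModType R[i]) (x : nat -> Y), rad_sum eps n x w = rad_sum' n x w].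
Proof.
have : P.-negligible (\bigcup_k (eps k @^-1` (~` [set 1; -1]))).
  have n1 : ((1 : R) == -1) = false by apply/negbTE/eqP; lra.
  have mk k : measurable (eps k @^-1` [set 1; -1]) by apply: meps; exact: measurableU.
  have Pk k : P (~` (eps k @^-1` [set 1; -1])) = 0%E.
    rewrite probability_setC// preimage_setU measureU; [|exact: meps|exact: meps|]; last first.
      by apply/seteqP; split => // w /= [-> /eqP]; rewrite n1.
    have [e1 e2] := eps_rad.1 k.
    transitivity (1 - ((2^-1)%:E + (2^-1)%:E) : \bar R)%E.
      by congr (_ - (_ + _))%E.
    rewrite -EFinD (_ : 2^-1 + 2^-1 = 1); last by lra.
    by rewrite subrr.
  apply: negligible_bigcup => k; rewrite -preimage_setC.
  by exists (~` (eps k @^-1` [set 1; -1])); split => //; [exact: measurableC|exact: Pk].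
move=> [N [mN N0 subN]]; exists N; split => // w Nw n Y x.
rewrite /rad_sum /rad_sum'; apply: eq_bigr => k _.
have [e|e] : eps k w = 1 \/ eps k w = -1.
- by apply: contrapT => H; apply/Nw/subN; exists k.
- by rewrite /eps1 e eqxx scale1r.
- rewrite /eps1 e (_ : (-1 == 1 :> R) = false); last by apply/negbTE/eqP; lra.
  by rewrite rmorphN1 scaleN1r.
Qed.

(** The bridge from probability to finite averages: both the R-bounds and the square function
    estimates are translated through it. *)
Lemma integral_rad_sum (Y : normedModType R[i]) n (x : nat -> Y) (g : Y -> R) :
  (forall v, 0 <= g v) ->
  (\int[P]_w (g (rad_sum eps n x w))%:E = (radE n x g)%:E)%E.
Proof.
move=> g0; have [N [mN N0 NE]] := eps_exceptional.
have <- : (\int[P]_w (g (rad_sum' n x w))%:E = (radE n x g)%:E)%E.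
  rewrite -(mulr1 (radE n x g)) -[1 in RHS]invr1 -[1 in RHS](expr0 2).
  rewrite -(@integral_cyl Y n 0 (fun=> true))//; congr (integral _ _ _).
  apply/esym/seteqP; split => // w _ k; rewrite addn0 => /andP[nk].
  by rewrite ltnNge nk.
have g0E v : (0 <= (g v)%:E)%E by rewrite lee_fin.
by apply/eqP; rewrite eq_le; apply/andP; split;
  apply: (le_integral_off_null mN N0) => // w Nw; rewrite NE.
Qed.

Lemma Rbounded_radE (X : normedModType R[i]) (E : set (bop X X)) : Rbounded eps E ->
  exists2 C : R, 0 <= C & forall n (T : nat -> bop X X) (x : nat -> X),
    (forall k, (k < n)%N -> E (T k)) ->
    radE n (fun k => T k (x k)) sqn <= C * radE n x sqn.
Proof.
move=> [C C0 HC]; exists (C ^+ 2) => [|n T x ET]; first exact: sqr_ge0.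
have rad0 (z : nat -> X) : 0 <= radE n z sqn by apply: radE_ge0; exact: sqn_ge0.
have := HC n T x ET; rewrite [X in (_ <= _ * X)%E]L2normE integral_rad_sum ?poweR_EFin -?EFinM; last first.
  exact: sqn_ge0.
move=> /L2norm_le; rewrite mulr_ge0 ?powR_ge0// => /(_ isT).
rewrite integral_rad_sum; last exact: sqn_ge0.
by rewrite lee_fin exprMn -[(_ `^ _) ^+ 2]powR_mulrn ?powR_ge0// -powRrM mulVf ?pnatr_eq0// powRr1.
Qed.

(** Partial averages increase with n, so it suffices to bound a late one. Writing u m = (u m - f) +
    f, with [f] the sum of the series in L2, [sqnD] gives the factor 2 while the first part tends to
    0. *)
Lemma square_norm_radE (Y : normedModType R[i]) (S : bop Y Y) (x : Y) (C : R) :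
  0 <= C -> (square_norm eps S x <= C%:E)%E -> forall n,
  radE n (fun k => (Num.sqrt k.+1%:R)%:C *: (S ^+ k * (1 - S)) x) sqn <= 2 * C ^+ 2.
Proof.
move=> C0; pose a k := (Num.sqrt k.+1%:R)%:C *: (S ^+ k * (1 - S)) x.
pose u n := rad_sum eps n a; rewrite /square_norm -[fun n => rad_sum eps n _]/u.
case: asboolP => [[f0 lf0]|_]; last by rewrite leye_eq.
case: xgetP => [f _ [[[s ss [N [mN N0 sN]]] fL2] uf]|/(_ f0)//].
move=> fC n.
rewrite -[fun k => _ *: _]/a.
have {}fC := L2norm_le C0 fC.
have [N' [mN' N'0 NE]] := eps_exceptional.
(* Off this null set [f] is a pointwise limit of simple functions and [rad_sum] has exact signs,
   which gives the measurability needed to add integrals. *)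
pose A := ~` (N `|` N').
have mA : measurable A by apply: measurableC; exact: measurableU.
have muA : P (N `|` N') = 0%E.
  by apply: null_set_setU.
have sf w : A w -> s m w @[m --> \oo] --> f w.
  by move=> Aw; apply: contrapT => H; apply: Aw; left; apply: sN => /(_ I).
have mf : measurable_fun A (fun w => sqn (f w)).
  apply: (@measurable_fun_cvg _ _ _ _ (fun m w => sqn (s m w))) => [m|w Aw].
    apply: measurable_funTS.
    exact: (simple_measurable2 (fun v _ => sqn v) (ss m) (ss m)).
  by apply: cvg_sqn; exact: sf.
have muf m : measurable_fun A (fun w => sqn (u m w - f w)).
  apply: (@measurable_fun_cvg _ _ _ _ (fun k w => sqn (rad_sum' m a w - s k w))) => [k|w Aw].
    apply: measurable_funTS.
    exact: (simple_measurable2 (fun v v' => sqn (v - v')) (rad_sum'_simple _ _) (ss k)).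
  rewrite /u NE; last by move=> ?; apply: Aw; right.
  by apply: cvg_sqn; apply: cvgB; [exact: cvg_cst|exact: sf].
have key m : ((radE m a sqn)%:E <= 2%:E * \int[P]_w (sqn (u m w - f w))%:E + (2 * C ^+ 2)%:E)%E.
  rewrite -integral_rad_sum; last exact: sqn_ge0.
  have e0 (Z : normedModType R[i]) (v : Z) : (0 <= (sqn v)%:E)%E by rewrite lee_fin sqn_ge0.
  have h0 w : (0 <= 2%:E * (sqn (u m w - f w))%:E + 2%:E * (sqn (f w))%:E)%E.
    by rewrite adde_ge0// mule_ge0.
  apply: (@le_trans _ _ (\int[P]_(w in A) (2%:E * (sqn (u m w - f w))%:E + 2%:E * (sqn (f w))%:E))%E).
    rewrite [leRHS]integral_mkcond; apply: (le_integral_off_null _ muA) => //.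
    - exact: measurableU.
    - by move=> w; rewrite patchE; case: ifP.
    - move=> w Aw; rewrite patchE mem_set// -!EFinM -EFinD lee_fin.
      by have := sqnD (u m w - f w) (f w); rewrite subrK.
  rewrite ge0_integralD//; last 4 first.
  - by move=> w _; rewrite mule_ge0.
  - by apply: measurable_funeM; exact/measurable_EFinP.
  - by move=> w _; rewrite mule_ge0.
  - by apply: measurable_funeM; exact/measurable_EFinP.
  rewrite !ge0_integralZl_EFin//; last 2 first.
  - exact/measurable_EFinP.
  - exact/measurable_EFinP.
  apply: leeD.
    by rewrite lee_pmul2l//; apply: le_integral_T.
  by rewrite EFinM lee_pmul2l//; apply: le_trans fC; apply: le_integral_T.
apply/ler_addgt0Pr => e e0.
(* Chosen so that 2 * e' ^+ 2 <= e. *)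
pose e' := Num.min 1 (e / 2); have e'0 : 0 < e' by rewrite lt_min ltr01 divr_gt0.
have /fine_cvgP[fin0 /cvgrPdist_lt /(_ e' e'0) small] := uf.
near \oo => m.
have nm : (n <= m)%N by near: m; exists n.
have finm : L2norm P (fun w => u m w - f w) \is a fin_num by near: m.
have : `|0 - fine (L2norm P (fun w => u m w - f w))| < e' by near: m.
rewrite sub0r normrN => /ltW; rewrite ger0_norm ?fine_ge0 ?Lnorm_ge0//.
rewrite -lee_fin fineK// => /(L2norm_le (ltW e'0)) ue'.
rewrite -lee_fin (le_trans _ (_ : (2%:E * (e' ^+ 2)%:E + (2 * C ^+ 2)%:E <= _)%E))//.
  apply: (@le_trans _ _ (radE m a sqn)%:E); first by rewrite lee_fin radE_sqn_mono.
  by rewrite (le_trans (key m))// leeD2r// lee_pmul2l.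
rewrite -EFinM -EFinD lee_fin addrC lerD2l.
have e'1 : e' <= 1 by rewrite ge_min lexx.
have e'e : e' <= e / 2 by rewrite ge_min lexx orbT.
by rewrite expr2; nra.
Unshelve. all: by end_near. Qed.

End Rademacher.

(** * Goursat's lemma for midpoint sums *)

Section DyadicMidpoint.
Context {R : realType}.
Local Notation C := R[i]^o.
Implicit Types (a b c z w : C) (f g : C -> C) (K : C -> Prop).

Definition mid a b : C := (a + b) / 2.

Lemma midC a b : mid a b = mid b a.
Proof. by rewrite /mid addrC. Qed.

(** The midpoint rule with 2^m equal pieces. It is exact on affine functions for every m
    ([midI_affine]), so the affine part of f can be subtracted without passing to a limit. *)
Fixpoint midI m f a b : C :=
  if m is m'.+1 then midI m' f a (mid a b) + midI m' f (mid a b) b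
  else (b - a) * f (mid a b).

Definition midT m f a b c : C := midI m f a b + midI m f b c + midI m f c a.

Lemma nrm_2V : nrm (2^-1 : C) = 2^-1.
Proof.
rewrite (_ : 2^-1 = (2^-1)%:C :> C); last by rewrite fmorphV rmorph_nat.
by rewrite nrm_real ger0_norm// invr_ge0.
Qed.

Lemma mid_subl a b : nrm (mid a b - a) = nrm (b - a) / 2.
Proof.
by rewrite (_ : mid a b - a = (b - a) * 2^-1) ?nrmM ?nrm_2V//; rewrite /mid; field.
Qed.

Lemma mid_subr a b : nrm (b - mid a b) = nrm (b - a) / 2.
Proof.
by rewrite (_ : b - mid a b = (b - a) * 2^-1) ?nrmM ?nrm_2V//; rewrite /mid; field.
Qed.

Lemma midI_rev m f a b : midI m f b a = - midI m f a b.
Proof.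
elim: m a b => [|m IH] a b /=; first by rewrite midC -mulNr opprB.
by rewrite midC (IH a) (IH (mid a b)) addrC opprD.
Qed.

Lemma midI_affine m (p q : C) a b :
  midI m (fun w => p + q * w) a b = p * (b - a) + q * (b ^+ 2 - a ^+ 2) / 2.
Proof.
by elim: m a b => [|m IH] a b /=; rewrite ?IH /mid; field.
Qed.

Lemma midI_sub m f g a b :
  midI m (fun w => f w - g w) a b = midI m f a b - midI m g a b.
Proof.
elim: m a b => [|m IH] a b /=; first by rewrite mulrBr.
by rewrite !IH opprD addrACA.
Qed.

(** A substitute for convexity: the nodes of [midI] are iterated midpoints of the end points. *)
Definition mid_closed K := forall a b, K a -> K b -> K (mid a b).

Lemma midI_bound m f K (B : R) a b : mid_closed K ->
  (forall w, K w -> nrm (f w) <= B) -> K a -> K b ->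
  nrm (midI m f a b) <= B * nrm (b - a).
Proof.
move=> Km fB; elim: m a b => [|m IH] a b Ka Kb /=.
  by rewrite nrmM mulrC ler_wpM2r ?nrm_ge0// fB//; exact: Km.
rewrite (le_trans (nrmD _ _))// (le_trans (lerD (IH _ _ _ _) (IH _ _ _ _)))//; try exact: Km.
by rewrite mid_subl mid_subr -mulrDr -splitr.
Qed.

Lemma midT_rot m f a b c : midT m f b c a = midT m f a b c.
Proof. by rewrite /midT [LHS]addrC [LHS]addrA. Qed.

Lemma midT_affine m (p q : C) a b c : midT m (fun w => p + q * w) a b c = 0.
Proof. by rewrite /midT !midI_affine; field. Qed.

Lemma midT_split m f a b c :
  midT m.+1 f a b c = midT m f a (mid a b) (mid c a) + midT m f (mid a b) b (mid b c)
    + midT m f (mid c a) (mid b c) c + midT m f (mid a b) (mid b c) (mid c a).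
Proof.
rewrite /midT /= (midI_rev m f (mid a b) (mid c a)) (midI_rev m f (mid a b) (mid b c)).
by rewrite (midI_rev m f (mid b c) (mid c a)); ring.
Qed.

Lemma midT_bound m f K (B : R) a b c : mid_closed K ->
  (forall w, K w -> nrm (f w) <= B) -> K a -> K b -> K c ->
  nrm (midT m f a b c) <= B * (nrm (b - a) + nrm (c - b) + nrm (a - c)).
Proof.
move=> Km fB Ka Kb Kc; rewrite /midT !mulrDr.
rewrite (le_trans (nrmD _ _))// lerD//; last exact: (midI_bound _ Km).
by rewrite (le_trans (nrmD _ _))// lerD//; exact: (midI_bound _ Km).
Qed.

Definition cdiff f z := exists p : C, forall e : R, 0 < e -> exists2 d : R, 0 < d &
  forall w, nrm (w - z) < d -> nrm (f w - f z - p * (w - z)) <= e * nrm (w - z).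

Lemma ball_mid_closed z (r : R) : mid_closed (fun w => nrm (w - z) <= r).
Proof.
move=> a b az bz.
rewrite (_ : mid a b - z = (a - z) * 2^-1 + (b - z) * 2^-1); last by rewrite /mid; field.
by rewrite (le_trans (nrmD _ _))// !nrmM nrm_2V; lra.
Qed.

Lemma half_cauchy (x : nat -> R) :
  (forall n, `|x n.+1 - x n| <= 2 ^- n) -> exists l, forall n, `|x n - l| <= 2 * 2 ^- n.
Proof.
move=> xn; have pos k : 0 < 2 ^- k :> R by rewrite invr_gt0 exprn_gt0.
have H n k : `|x (n + k)%N - x n| <= 2 * 2 ^- n - 2 * 2 ^- (n + k).
  elim: k => [|k IH]; first by rewrite addn0 !subrr normr0.
  rewrite -(subrK (x (n + k)%N) (x (n + k.+1)%N)) -addrA (le_trans (ler_normD _ _))//.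
  rewrite addnS (le_trans (lerD (xn _) IH))// exprS invfM.
  by have := pos (n + k)%N; lra.
have K n m : x m - 2 * 2 ^- m <= x n + 2 * 2 ^- n.
  have pn := pos n; have pm := pos m.
  have [nm|/ltnW mn] := leqP n m.
    have := H n (m - n)%N; rewrite subnKC// ler_norml => /andP[_]; lra.
  have := H m (n - m)%N; rewrite subnKC// ler_norml => /andP[]; lra.
exists (sup [set x m - 2 * 2 ^- m | m in setT]) => n.
have hub : has_ubound [set x m - 2 * 2 ^- m | m in setT].
  by exists (x 0%N + 2 * 2 ^- 0) => _ [m _ <-].
rewrite distrC ler_norml; apply/andP; split.
  rewrite lerBrDl; apply: ub_le_sup => //; exists n => //.
rewrite lerBlDl; apply: ge_sup; first by exists (x 0%N - 2 * 2 ^- 0), 0%N.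
by move=> _ [m _ <-].
Qed.

(** Goursat's bisection argument with sums in place of integrals. If the claim fails, it fails for
    one of the four quarters at a quarter of the tolerance; the nested triangles obtained in this
    way shrink to a point, where f is affine up to a small error and affine functions have sum
    exactly 0. *)
Lemma goursat f a b c :
  (forall x y : R, 0 <= x -> 0 <= y -> x + y <= 1 ->
    cdiff f (a + x%:C * (b - a) + y%:C * (c - a))) ->
  forall e : R, 0 < e -> exists M, forall m, (M <= m)%N -> nrm (midT m f a b c) <= e.
Proof.
move=> fd e e0.
pose T x y : C := a + x%:C * (b - a) + y%:C * (c - a).
have Tmid x y x' y' : mid (T x y) (T x' y') = T ((x + x') / 2) ((y + y') / 2).
  rewrite /T /mid !rmorphM !rmorphD !fmorphV !rmorph_nat.
  by field.
(* All the subtriangles are homothetic to the given one: the triple (x, y, h)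
   stands for the image under T of the triangle (x, y), (x + h, y), (x, y + h). *)
pose tri := (R * R * R)%type.
pose TT m (t : tri) := let: (x, y, h) := t in midT m f (T x y) (T (x + h) y) (T x (y + h)).
pose bad n t := ~ exists M, forall m, (M <= m)%N -> nrm (TT m t) <= e * 4 ^- n.
(* The central triangle is upside down, whence the negative size of the last child. *)
pose child (t : tri) (j : 'I_4) : tri := let: (x, y, h) := t in
  match val j with
  | 0%N => (x, y, h / 2) | 1%N => (x + h / 2, y, h / 2)
  | 2%N => (x, y + h / 2, h / 2) | _ => (x + h / 2, y + h / 2, - (h / 2)) end.
have badS n t : bad n t -> exists j, bad n.+1 (child t j).
  move=> bt; apply: contrapT => /forallNP nb; apply: bt.
  have /choice[M HM] : forall j, exists M, forall m, (M <= m)%N ->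
      nrm (TT m (child t j)) <= e * 4 ^- n.+1.
    by move=> j; have := nb j => /contrapT.
  exists (\max_j M j).+1 => -[//|m] Mm.
  have Mj j : nrm (TT m (child t j)) <= e * 4 ^- n.+1.
    by apply: HM; rewrite -ltnS (leq_trans _ Mm)// ltnS leq_bigmax.
  have := Mj (@Ordinal 4 0 isT); have := Mj (@Ordinal 4 1 isT).
  have := Mj (@Ordinal 4 2 isT); have := Mj (@Ordinal 4 3 isT).
  move: t {nb HM Mj} => [[x y] h]; rewrite /TT /child /=.
  have e1 (u : R) : u + h / 2 + h / 2 = u + h by field.
  have e2 (u : R) : u + h / 2 - h / 2 = u by field.
  have e3 (u : R) : (u + (u + h)) / 2 = u + h / 2 by field.
  have e4 (u : R) : (u + u) / 2 = u by field.
  have e5 (u : R) : (u + h + u) / 2 = u + h / 2 by field.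
  rewrite !e1 !e2 => H3 H2 H1 H0.
  rewrite midT_split !Tmid !e3 !e4 !e5.
  rewrite (le_trans (nrmD _ _))// (le_trans (lerD (nrmD _ _) (lexx _)))//.
  rewrite (le_trans (lerD (lerD (nrmD _ _) (lexx _)) (lexx _)))//.
  rewrite -(midT_rot m f (T (x + h / 2) y) (T (x + h / 2) (y + h / 2))).
  rewrite (le_trans (lerD (lerD (lerD H0 H1) H2) H3))//.
  by rewrite exprS invfM; lra.
apply: contrapT => bad0.
pose t0 : tri := (0, 0, 1).
have b0 : bad 0%N t0.
  move=> [M HM]; apply: bad0; exists M => m /HM; rewrite /TT /T /=.
  rewrite !add0r !mul0r !mul1r !addr0 expr0 invr1 mulr1.
  by rewrite !(addrC a) !subrK.
have /choice[nx nxP] : forall nt : nat * tri, exists j, bad nt.1 nt.2 -> bad nt.1.+1 (child nt.2 j).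
  move=> [n t]; have [bt|nbt] := pselect (bad n t); last by exists ord0.
  by have [j Hj] := badS n t bt; exists j.
pose t_ := fix t_ n := if n is n'.+1 then child (t_ n') (nx (n', t_ n')) else t0.
have bt n : bad n (t_ n) by elim: n => [|n IH] //=; exact: (nxP (n, t_ n)).
pose X n := (t_ n).1.1; pose Y n := (t_ n).1.2; pose h n := (t_ n).2.
have tE n : t_ n = (X n, Y n, h n) by rewrite /X /Y /h; case: (t_ n) => [[]].
have tS n : exists j, (X n.+1, Y n.+1, h n.+1) = child (X n, Y n, h n) j.
  by exists (nx (n, t_ n)); rewrite -!tE.
have okt n : [/\ 0 <= X n, 0 <= Y n, X n + Y n <= 1, 0 <= X n + h n &
    0 <= Y n + h n /\ X n + Y n + h n <= 1].
  elim: n => [|n]; first by rewrite /X /Y /h /=; split => //; lra.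
  have [j] := tS n; move: (X n) (Y n) (h n) => x y k.
  by case: j => -[|[|[|[|//]]]] ? /= [-> -> ->] [? ? ? ? [? ?]]; split; lra.
have hn n : `|h n| = 2 ^- n.
  elim: n => [|n]; first by rewrite /h /= normr1 expr0 invr1.
  rewrite exprS invfM; have [j] := tS n; move: (X n) (Y n) (h n) => x y k.
  by case: j => -[|[|[|[|//]]]] ? /= [_ _ ->] <-;
    rewrite ?normrN normrM mulrC [ `|2^-1| ]ger0_norm ?invr_ge0.
have step n : `|X n.+1 - X n| <= 2 ^- n /\ `|Y n.+1 - Y n| <= 2 ^- n.
  rewrite -hn; have [j] := tS n; move: (X n) (Y n) (h n) => x y k.
  have k0 := normr_ge0 k.
  by case: j => -[|[|[|[|//]]]] ? /= [-> -> _];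
    rewrite ?subrr ?(addrC x) ?(addrC y) ?addrK ?normr0 ?normrM ?[ `|2^-1| ]ger0_norm ?invr_ge0//;
    split => //; lra.
have [x xl] := half_cauchy (fun n => (step n).1).
have [y yl] := half_cauchy (fun n => (step n).2).
have small (u v : R) : (forall n, u <= v + 2 * 2 ^- n) -> u <= v.
  move=> H; apply/ler_addgt0Pr => d d0.
  have /cvgrPdist_lt /(_ (d / 2)) : (fun n => 2^-1 ^+ n : R) @ \oo --> (0 : R).
    by apply: cvg_expr; rewrite ger0_norm ?invr_ge0// invf_lt1 ?ltr1n.
  rewrite divr_gt0// => /(_ isT) [n _ /(_ n (leqnn n))].
  rewrite sub0r normrN ger0_norm ?exprn_ge0 ?invr_ge0// exprVn => Hn.
  by have := H n; lra.
have x0 : 0 <= x.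
  apply: small => n; have [H _ _ _ _] := okt n.
  by have := xl n; rewrite ler_norml => /andP[]; lra.
have y0 : 0 <= y.
  apply: small => n; have [_ H _ _ _] := okt n.
  by have := yl n; rewrite ler_norml => /andP[]; lra.
have xy1 : x + y <= 1.
  suff : 2^-1 * (x + y) <= 2^-1 * 1 by rewrite ler_pM2l ?invr_gt0.
  apply: small => n; have [_ _ H _ _] := okt n.
  have := yl n; rewrite ler_norml => /andP[].
  by have := xl n; rewrite ler_norml => /andP[]; lra.
pose z : C := T x y.
have [p Hp] := fd x y x0 y0 xy1; rewrite -/(T x y) -/z in Hp.
(* The coordinates of a vertex are within 2 * 2 ^- n of the limit, plus a side |h n| = 2 ^- n: this
   is the 3. *)
pose D : R := 3 * (nrm (b - a) + nrm (c - a)).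
have D0 : 0 <= D by rewrite mulr_ge0// addr_ge0 ?nrm_ge0.
have Tdist (d x1 y1 x2 y2 : R) : `|x1 - x2| <= d -> `|y1 - y2| <= d ->
    nrm (T x1 y1 - T x2 y2) <= d * (nrm (b - a) + nrm (c - a)).
  move=> c1 c2.
  rewrite (_ : _ - _ = (x1 - x2)%:C *: (b - a) + (y1 - y2)%:C *: (c - a)); last first.
    by rewrite /T !rmorphB /= /GRing.scale /=; ring.
  by rewrite (le_trans (nrmD _ _))// !nrmZr mulrDr lerD// ler_wpM2r// nrm_ge0.
have near n : [/\ nrm (T (X n) (Y n) - z) <= D * 2 ^- n,
    nrm (T (X n + h n) (Y n) - z) <= D * 2 ^- n & nrm (T (X n) (Y n + h n) - z) <= D * 2 ^- n].
  have E : D * 2 ^- n = 3 * 2 ^- n * (nrm (b - a) + nrm (c - a)) by rewrite /D; ring.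
  have p0 : 0 <= 2 ^- n :> R by rewrite invr_ge0 exprn_ge0.
  have B (u l : R) : `|u - l| <= 2 * 2 ^- n -> `|u - l| <= 3 * 2 ^- n by lra.
  have B' (u l : R) : `|u - l| <= 2 * 2 ^- n -> `|u + h n - l| <= 3 * 2 ^- n.
    by move=> H; rewrite addrAC (le_trans (ler_normD _ _))// hn; lra.
  by rewrite E; split; apply: Tdist; (exact: B || exact: B').
(* With r = D * 2 ^- n, the perimeter is at most 6 r and the error of the affine approximation at
   most this constant times r; the product stays below e * 4 ^- n. The 1 avoids a zero
   denominator. *)
have e'0 : 0 < e / (6 * D ^+ 2 + 1).
  by rewrite divr_gt0// ltr_wpDl// mulr_ge0// sqr_ge0.
have [d d0 Hd] := Hp _ e'0.
have [n nd] : exists n, D * 2 ^- n < d.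
  have /cvgrPdist_lt /(_ (d / (D + 1))) : (fun n => 2^-1 ^+ n : R) @ \oo --> (0 : R).
    by apply: cvg_expr; rewrite ger0_norm ?invr_ge0// invf_lt1 ?ltr1n.
  rewrite divr_gt0 ?ltr_wpDl// => /(_ isT) [n _ /(_ n (leqnn n))].
  rewrite sub0r normrN ger0_norm ?exprn_ge0 ?invr_ge0// exprVn ltr_pdivlMr ?ltr_wpDl// => Hn.
  exists n; apply: le_lt_trans Hn; rewrite mulrC ler_wpM2l ?invr_ge0 ?exprn_ge0//.
  by rewrite lerDl.
apply: (bt n); exists 0%N => m _; rewrite tE /TT.
have [v1 v2 v3] := near n.
move: (T (X n) (Y n)) (T (X n + h n) (Y n)) (T (X n) (Y n + h n)) v1 v2 v3 => A B E v1 v2 v3.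
set r := D * 2 ^- n in nd v1 v2 v3.
have r0 : 0 <= r by rewrite mulr_ge0// invr_ge0 exprn_ge0.
(* The error of the affine approximation of f at the limit point [z]. *)
pose k w := f w - (f z - p * z + p * w).
have -> : midT m f A B E =
    midT m k A B E.
  rewrite -[LHS]subr0 -(midT_affine m (f z - p * z) p A B E).
  by rewrite /midT !midI_sub; ring.
have hB w : nrm (w - z) <= r -> nrm (k w) <= e / (6 * D ^+ 2 + 1) * r.
  move=> wz; have := Hd w (le_lt_trans wz nd).
  rewrite (_ : k w = f w - f z - p * (w - z)); last by rewrite /k; ring.
  by move=> /le_trans; apply; rewrite ler_wpM2l// ltW.
rewrite (le_trans (midT_bound m (@ball_mid_closed z r) hB v1 v2 v3))//.
apply: (@le_trans _ _ (e / (6 * D ^+ 2 + 1) * r * (6 * r))).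
  have K0 : 0 <= e / (6 * D ^+ 2 + 1) * r by rewrite mulr_ge0// ltW.
  rewrite ler_wpM2l//.
  have t1 := nrm_triangle B z A.
  have t2 := nrm_triangle E z B.
  have t3 := nrm_triangle A z E.
  by move: t1 t2 t3; rewrite !(nrmBC z); lra.
have -> : 4 ^- n = 2 ^- n * 2 ^- n :> R.
  by rewrite -invfM -exprMn; congr (_ ^- _); lra.
rewrite /r (_ : e / (6 * D ^+ 2 + 1) * (D / 2 ^+ n) * (6 * (D / 2 ^+ n)) =
  e * (2 ^- n * 2 ^- n) * ((6 * D ^+ 2) / (6 * D ^+ 2 + 1))); last by ring.
rewrite ler_piMr//; first by rewrite !mulr_ge0 ?(ltW e0)// invr_ge0 exprn_ge0.
rewrite ler_pdivrMr ?mul1r ?lerDl//.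
by rewrite ltr_wpDl// mulr_ge0// sqr_ge0.
Qed.

End DyadicMidpoint.

(** * Goursat's lemma on a drop, including its corner 1 *)

Section Drop.
Context {R : realType}.
Local Notation C := R[i]^o.
Implicit Types (a b c z w : C) (f g : C -> C) (r : R).

(* The convex hull of 1 and of the closed disc of radius r, without the point 1. *)
Definition drop_set r : set C :=
  [set z : C | exists2 t : R, 0 < t <= 1 & nrm (z - (1 - t)%:C : C) <= r * t].

Definition full_drop r : set C := [set z | drop_set r z \/ z = 1].

Lemma drop_conv r s a b : 0 <= s <= 1 -> drop_set r a -> drop_set r b ->
  drop_set r ((1 - s)%:C * a + s%:C * b).
Proof.
move=> /andP[s0 s1] [t /andP[t0 t1] at_] [u /andP[u0 u1] bu].
exists ((1 - s) * t + s * u).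
  apply/andP; split; last by nra.
  have [->|sn0] := eqVneq s 0; first by rewrite subr0 mul1r mul0r addr0.
  have sp : 0 < s by rewrite lt_neqAle eq_sym sn0.
  by rewrite ltr_wpDl ?mulr_gt0// mulr_ge0 ?subr_ge0// ltW.
rewrite (_ : _ - _ = (1 - s)%:C *: (a - (1 - t)%:C) + s%:C *: (b - (1 - u)%:C)); last first.
  by rewrite /GRing.scale /= !rmorphB !rmorphD !rmorphM !rmorphB /= rmorph1; ring.
rewrite (le_trans (nrmD _ _))// !nrmZr !ger0_norm ?subr_ge0//.
have : (1 - s) * nrm (a - (1 - t)%:C) <= (1 - s) * (r * t) by rewrite ler_wpM2l ?subr_ge0.
have : s * nrm (b - (1 - u)%:C) <= s * (r * u) by rewrite ler_wpM2l.
by lra.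
Qed.

Lemma drop_conv1 r s a : 0 <= s < 1 -> drop_set r a ->
  drop_set r ((1 - s)%:C * a + s%:C).
Proof.
move=> /andP[s0 s1] [t /andP[t0 t1] at_].
exists ((1 - s) * t).
  by rewrite mulr_gt0 ?subr_gt0//=; nra.
rewrite (_ : _ - _ = (1 - s)%:C *: (a - (1 - t)%:C)); last first.
  by rewrite /GRing.scale /= !rmorphB !rmorphM !rmorphB /= rmorph1; ring.
rewrite nrmZr ger0_norm ?subr_ge0 ?(ltW s1)// mulrCA ler_wpM2l ?subr_ge0 ?(ltW s1)//.
Qed.

Lemma midE a b : mid a b = (1 - 2^-1)%:C * a + 2^-1%:C * b.
Proof. by rewrite rmorphB /= fmorphV rmorph_nat rmorph1 /mid; field. Qed.

Lemma drop_mid r : mid_closed (drop_set r).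
Proof. by move=> a b ra rb; rewrite midE; apply: drop_conv => //; lra. Qed.

Lemma drop_mid1 r a : drop_set r a -> drop_set r (mid a 1).
Proof. by move=> ra; rewrite midE mulr1; apply: drop_conv1 => //; lra. Qed.

Lemma full_drop_mid r : mid_closed (full_drop r).
Proof.
move=> a b [ra|->] [rb|->].
- by left; exact: drop_mid.
- by left; exact: drop_mid1.
- by left; rewrite midC; exact: drop_mid1.
- by right; rewrite /mid; field.
Qed.

Lemma drop_ne1 r z : r < 1 -> drop_set r z -> z != 1.
Proof.
move=> r1 [t /andP[t0 _] zt]; apply/eqP => z1; move: zt.
rewrite z1 (_ : _ - _ = t%:C); last by rewrite rmorphB rmorph1 /=; ring.
by rewrite nrm_real gtr0_norm// leNgt -subr_gt0; nra.
Qed.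

Lemma drop_disc r z : nrm z <= r -> drop_set r z.
Proof. by move=> zr; exists 1; rewrite ?ltr01 ?lexx// subrr subr0 mulr1. Qed.

Lemma drop_tri r a b c (x y : R) : drop_set r a -> drop_set r b -> drop_set r c ->
  0 <= x -> 0 <= y -> x + y <= 1 -> drop_set r (a + x%:C * (b - a) + y%:C * (c - a)).
Proof.
move=> ra rb rc x0 y0 xy1.
have [xy0|xyn0] := eqVneq (x + y) 0.
  have -> : x = 0 by lra.
  have -> : y = 0 by lra.
  by rewrite !mul0r !addr0.
have xyp : 0 < x + y by rewrite lt_neqAle eq_sym xyn0/=; lra.
have xy0C : x%:C + y%:C != 0 :> C by rewrite -rmorphD /= fmorph_eq0.
rewrite (_ : _ + _ = (1 - (x + y))%:C * a +
  (x + y)%:C * ((1 - y / (x + y))%:C * b + (y / (x + y))%:C * c)); last first.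
  rewrite !rmorphB !rmorphM !rmorphD /= rmorph1 fmorphV rmorphD /=.
  by field.
apply: drop_conv => //; first lra.
apply: drop_conv => //; rewrite divr_ge0 ?(ltW xyp)//= ler_pdivrMr// mul1r; lra.
Qed.

Lemma goursat_drop r f a b c : (forall z, drop_set r z -> cdiff f z) ->
  drop_set r a -> drop_set r b -> drop_set r c ->
  forall e : R, 0 < e -> exists M, forall m, (M <= m)%N -> nrm (midT m f a b c) <= e.
Proof.
move=> fd ra rb rc; apply: goursat => x y x0 y0 xy1.
by apply: fd; exact: drop_tri.
Qed.

(** At the vertex 1 only boundedness of f is known. Three of the four quarters avoid 1 and are
    negligible; the fourth again has a vertex at 1 and half the perimeter, so after n cuts
    boundedness leaves an error of order 2 ^- n. *)
Lemma goursat_corner r f (B : R) a b : (forall z, drop_set r z -> cdiff f z) ->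
  (forall z, full_drop r z -> nrm (f z) <= B) -> drop_set r a -> drop_set r b ->
  forall e : R, 0 < e -> exists M, forall m, (M <= m)%N -> nrm (midT m f a b 1) <= e.
Proof.
move=> fd fB ra0 rb0.
pose per a b : R := nrm (b - a) + nrm (1 - b) + nrm (a - 1).
have B0 : 0 <= B by rewrite (le_trans (nrm_ge0 (f 1)))// fB//; right.
have H n : forall a b, drop_set r a -> drop_set r b -> forall e : R, 0 < e ->
    exists M, forall m, (M <= m)%N -> nrm (midT m f a b 1) <= e + B * per a b * 2 ^- n.
  elim: n => [|n IH] u v ru rv e e0.
    exists 0%N => m _; rewrite expr0 invr1 mulr1 (le_trans (midT_bound m (@full_drop_mid r) fB _ _ _))//.
    - by left.
    - by left.
    - by right.
    - by rewrite lerDr ltW.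
  have e40 : 0 < e / 4 by rewrite divr_gt0.
  have ruv := drop_mid ru rv; have rv1 := drop_mid1 rv; have ru1 := drop_mid1 ru.
  have r1u : drop_set r (mid 1 u) by rewrite midC.
  have [M1 H1] := goursat_drop fd ru ruv r1u e40.
  have [M2 H2] := goursat_drop fd ruv rv rv1 e40.
  have [M3 H3] := goursat_drop fd ruv rv1 r1u e40.
  have [M4 H4] := IH _ _ r1u rv1 _ e40.
  exists (maxn (maxn M1 M2) (maxn M3 M4)).+1 => -[//|m].
  rewrite ltnS !geq_max => /andP[/andP[m1 m2] /andP[m3 m4]].
  rewrite midT_split.
  rewrite (le_trans (nrmD _ _))// (le_trans (lerD (nrmD _ _) (lexx _)))//.
  rewrite (le_trans (lerD (lerD (nrmD _ _) (lexx _)) (lexx _)))//.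
  have E : per (mid 1 u) (mid v 1) = per u v / 2.
    rewrite /per mid_subr mid_subl.
    rewrite (_ : mid v 1 - mid 1 u = (v - u) * 2^-1); last by rewrite /mid; field.
    by rewrite nrmM nrm_2V; field.
  have := H4 m m4; rewrite E.
  have := H1 m m1; have := H2 m m2; have := H3 m m3.
  by rewrite exprS invfM; lra.
move=> e e0.
have [n Hn] : exists n, B * per a b * 2 ^- n <= e / 2.
  have p0 : 0 <= B * per a b by rewrite mulr_ge0// !addr_ge0 ?nrm_ge0.
  have /cvgrPdist_lt /(_ (e / 2 / (B * per a b + 1))) : (fun n => 2^-1 ^+ n : R) @ \oo --> (0 : R).
    by apply: cvg_expr; rewrite ger0_norm ?invr_ge0// invf_lt1 ?ltr1n.
  rewrite !divr_gt0 ?ltr_wpDl// => /(_ isT) [n _ /(_ n (leqnn n))].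
  rewrite sub0r normrN ger0_norm ?exprn_ge0 ?invr_ge0// exprVn ltr_pdivlMr ?ltr_wpDl// => Hn.
  exists n; apply: ltW; apply: le_lt_trans Hn; rewrite mulrC ler_wpM2l ?invr_ge0 ?exprn_ge0//.
  by rewrite lerDl.
have [M HM] := H n a b ra0 rb0 (e / 2) (divr_gt0 e0 (ltr0Sn _ 1)).
by exists M => m /HM /le_trans; apply; lra.
Qed.

Lemma goursat_full_drop r f (B : R) a b : 0 <= r -> (forall z, drop_set r z -> cdiff f z) ->
  (forall z, full_drop r z -> nrm (f z) <= B) -> full_drop r a -> full_drop r b ->
  drop_set r a \/ drop_set r b ->
  forall e : R, 0 < e -> exists M, forall m, (M <= m)%N -> nrm (midT m f 0 a b) <= e.
Proof.
move=> r0 fd fB; have d0 : drop_set r 0 by apply: drop_disc; rewrite nrm0.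
move=> [ra|->] [rb|->] => [_|_|_|[]].
- exact: (goursat_drop fd d0 ra rb).
- exact: (goursat_corner fd fB d0 ra).
- move=> e e0; have [M HM] := goursat_corner fd fB rb d0 e0.
  by exists M => m /HM; rewrite (midT_rot m f 1 b 0) (midT_rot m f 0 1 b).
- by move=> /[dup] r1 _; move=> e e0; apply: (goursat_drop fd d0 r1 r1).
- by move=> /[dup] r1 _; move=> e e0; apply: (goursat_drop fd d0 r1 r1).
Qed.

(** The edges through 0 telescope; for a closed polygon their contributions cancel altogether. *)
Lemma midT_fan m f (p : nat -> C) n :
  \sum_(j < n) midT m f 0 (p j) (p j.+1) =
  \sum_(j < n) midI m f (p j) (p j.+1) + midI m f 0 (p 0%N) - midI m f 0 (p n).
Proof.
elim: n => [|n IH]; first by rewrite !big_ord0 add0r subrr.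
rewrite !big_ord_recr/= IH /midT (midI_rev m f 0 (p n.+1)); ring.
Qed.

Lemma midI_tag r m f a b tag (e d : R) : full_drop r a -> full_drop r b ->
  nrm (a - tag) <= d -> nrm (b - tag) <= d ->
  (forall w, full_drop r w -> nrm (w - tag) <= d -> nrm (f w - f tag) <= e) ->
  nrm (midI m f a b - (b - a) * f tag) <= e * nrm (b - a).
Proof.
move=> ra rb ad bd fe.
have -> : midI m f a b - (b - a) * f tag = midI m (fun w => f w - f tag) a b.
  rewrite midI_sub; congr (_ - _).
  have := midI_affine m (f tag) 0 a b; rewrite mul0r mul0r addr0 mulrC => <-.
  by congr midI; apply/funext => w; rewrite mul0r addr0.
apply: (midI_bound m (K := fun w => full_drop r w /\ nrm (w - tag) <= d)) => //.
- move=> u v [ru ud] [rv vd]; split; first exact: full_drop_mid.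
  exact: ball_mid_closed.
- by move=> w [rw wd]; exact: fe.
Qed.

End Drop.

(** * Riemann sums along the boundary of a Stolz domain *)

Section Cis.
Context {R : realType}.
Local Notation C := R[i]^o.

Lemma nrm_cis (t : R) : nrm (cis t : C) = 1.
Proof. by rewrite /nrm /= /Num.norm /= cos2Dsin2 sqrtr1. Qed.

Lemma cisD (s t : R) : cis (s + t) = cis s * cis t.
Proof.
rewrite /cis cosD sinD; apply/eqP; rewrite eq_complex /=.
by rewrite eqxx /= addrC (mulrC (cos s)) (mulrC (sin s)) addrC !(mulrC (cos t)) !(mulrC (sin t)) eqxx.
Qed.

Lemma cis_2piB (t : R) : cis (2 * pi - t) = cis (- t).
Proof.
rewrite cisD -[RHS]mul1r; congr (_ * _).
by rewrite /cis mulr_natl cos2pi sin2pi.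
Qed.

Lemma derive_approx (f : R -> R) (x l : R) : is_derive x 1 f l ->
  forall e : R, 0 < e -> exists2 d : R, 0 < d & forall h, `|h| < d ->
    `|f (x + h) - f x - l * h| <= e * `|h|.
Proof.
move=> [fd fl] e e0; move: fd => /cvg_ex [l' Hl'].
have ll' : l' = l by rewrite -fl; apply/esym/cvg_lim.
move: Hl' => /cvgrPdist_le /(_ e e0) [d /= d0 Hd]; exists d => // h hd.
have [->|h0] := eqVneq h 0.
  by rewrite addr0 mulr0 subrr subr0 normr0 mulr0.
have := Hd h; rewrite /= sub0r normrN => /(_ hd h0).
rewrite ll' /= /GRing.scale /= mulr1 (addrC h).
rewrite -(ler_pM2r (_ : 0 < `|h|)) ?normr_gt0// -normrM => H.
apply: le_trans H; rewrite le_eqVlt; apply/orP; left; apply/eqP.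
rewrite -[RHS]normrN; congr `|_|; field.
exact: h0.
Qed.

Lemma cis_approx (e : R) : 0 < e -> exists2 d : R, 0 < d & forall h : R, `|h| < d ->
  nrm (cis h - 1 - 'i * h%:C : C) <= e * `|h|.
Proof.
move=> e0; have e20 : 0 < e / 2 by rewrite divr_gt0.
have [d1 d10 H1] := derive_approx (is_derive_cos (0 : R)) e20.
have [d2 d20 H2] := derive_approx (is_derive_sin (0 : R)) e20.
exists (Num.min d1 d2) => [|h]; first by rewrite lt_min d10.
rewrite lt_min => /andP[/H1 + /H2].
rewrite sin0 cos0 add0r subr0 oppr0 mul0r subr0 mul1r => A B.
rewrite (le_trans (nrm_ReIm _))//.
rewrite (_ : complex.Re _ = cos h - 1); last by rewrite /=; ring.
rewrite (_ : complex.Im _ = sin h - h); last by rewrite /=; ring.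
lra.
Qed.

End Cis.

Section Contour.
Context {R : realType}.
Local Notation C := R[i]^o.
Implicit Types (r th : R) (n j : nat).

Definition psum {Y : lmodType R[i]} n (w z : nat -> C) (F : C -> Y) : Y :=
  \sum_(j < n) w j *: F (z j).

Definition om r th : C := r%:C * cis th.

Definition line (a b : C) (t : R) : C := a + t%:C * (b - a).

Definition p1 r th n j : C := line 1 (om r th) (j%:R / n%:R).
Definition p2 r th n j : C := om r (th + (2 * pi - th - th) * (j%:R / n%:R)).
Definition p3 r th n j : C := line (om r (- th)) 1 (j%:R / n%:R).
Definition w1 r th n (j : nat) : C := (n%:R^-1)%:C * (om r th - 1).
(** The derivative of the parametrization times the step. Unlike [w1] and [w3] it is not the chord
    between consecutive nodes, hence the comparison through [cis_approx] in [Lsum_cdiff]. *)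
Definition w2 r th n j : C := ((2 * pi - th - th) / n%:R)%:C * ('i * p2 r th n j.+1).
Definition w3 r th n (j : nat) : C := (n%:R^-1)%:C * (1 - om r (- th)).

(* Riemann sums for the counterclockwise integral along the boundary of the
   Stolz domain with r = sin beta and th = pi / 2 - beta; the nodes avoid 1. *)
Definition Lsum {Y : lmodType R[i]} r th n (F : C -> Y) : Y :=
  psum n (w1 r th n) (fun j => p1 r th n j.+1) F +
  psum n (w2 r th n) (fun j => p2 r th n j.+1) F +
  psum n (w3 r th n) (p3 r th n) F.

Lemma nrm_om r th : 0 <= r -> nrm (om r th) = r.
Proof. by move=> r0; rewrite /om nrmM nrm_real nrm_cis ger0_norm// mulr1. Qed.

Lemma om_drop r th : 0 <= r -> drop_set r (om r th).
Proof. by move=> r0; apply: drop_disc; rewrite nrm_om. Qed.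

Lemma p1_drop r th n j : 0 <= r -> (j < n)%N -> drop_set r (p1 r th n j.+1).
Proof.
move=> r0 jn; have n0 : 0 < n%:R :> R by rewrite ltr0n (leq_ltn_trans _ jn).
rewrite /p1 /line.
rewrite (_ : _ + _ = (1 - (1 - j.+1%:R / n%:R))%:C * om r th + (1 - j.+1%:R / n%:R)%:C).
  apply: drop_conv1; last exact: om_drop.
  rewrite subr_ge0 ler_pdivrMr// mul1r ler_nat jn/= ltrBlDl ltrDr divr_gt0// ltr0Sn.
by rewrite !rmorphB /= rmorph1; ring.
Qed.

Lemma p3_drop r th n j : 0 <= r -> (j < n)%N -> drop_set r (p3 r th n j).
Proof.
move=> r0 jn; have n0 : 0 < n%:R :> R by rewrite ltr0n (leq_ltn_trans _ jn).
rewrite /p3 /line.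
rewrite (_ : _ + _ = (1 - (j%:R / n%:R))%:C * om r (- th) + (j%:R / n%:R)%:C).
  apply: drop_conv1; last exact: om_drop.
  by rewrite divr_ge0//= ltr_pdivrMr// mul1r ltr_nat.
by rewrite !rmorphB /= rmorph1; ring.
Qed.

Lemma p2_drop r th n j : 0 <= r -> drop_set r (p2 r th n j).
Proof. exact: om_drop. Qed.

Lemma p1_0 r th n : p1 r th n 0 = 1.
Proof. by rewrite /p1 /line mul0r mul0r addr0. Qed.

Lemma p1_n r th n : (0 < n)%N -> p1 r th n n = om r th.
Proof. by move=> n0; rewrite /p1 /line divff ?pnatr_eq0 -?lt0n// mul1r addrC subrK. Qed.

Lemma p2_0 r th n : p2 r th n 0 = om r th.
Proof. by rewrite /p2 mul0r mulr0 addr0. Qed.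

Lemma p2_n r th n : (0 < n)%N -> p2 r th n n = om r (- th).
Proof.
move=> n0; rewrite /p2 divff ?pnatr_eq0 -?lt0n// mulr1 (addrC th) subrK.
by rewrite /om cis_2piB.
Qed.

Lemma p3_0 r th n : p3 r th n 0 = om r (- th).
Proof. by rewrite /p3 /line mul0r mul0r addr0. Qed.

Lemma p3_n r th n : (0 < n)%N -> p3 r th n n = 1.
Proof. by move=> n0; rewrite /p3 /line divff ?pnatr_eq0 -?lt0n// mul1r addrC subrK. Qed.

Lemma w1E r th n j : w1 r th n j = p1 r th n j.+1 - p1 r th n j.
Proof. by rewrite /p1 /line /w1 -[j.+1]addn1 natrD mulrDl rmorphD /= mul1r; ring. Qed.

Lemma w3E r th n j : w3 r th n j = p3 r th n j.+1 - p3 r th n j.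
Proof. by rewrite /p3 /line /w3 -[j.+1]addn1 natrD mulrDl rmorphD /= mul1r; ring. Qed.

Lemma eq_Lsum {Y : lmodType R[i]} r th n (F G : C -> Y) : 0 <= r ->
  (forall z, drop_set r z -> F z = G z) -> Lsum r th n F = Lsum r th n G.
Proof.
move=> r0 FG; rewrite /Lsum /psum; congr (_ + _ + _); apply: eq_bigr => j _; rewrite FG//.
- exact: p1_drop.
- exact: p2_drop.
- exact: p3_drop.
Qed.

Lemma line_continuous (a b : C) : continuous (line a b).
Proof.
move=> t; apply/cvg_nrmP => e e0.
have d0 : 0 < e / (nrm (b - a) + 1) by rewrite divr_gt0// ltr_wpDl ?nrm_ge0.
exists (e / (nrm (b - a) + 1)) => //= t' tt'.
rewrite (_ : line a b t - line a b t' = (t - t')%:C *: (b - a)); last first.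
  by rewrite /line /GRing.scale /= rmorphB /=; ring.
have {tt'} : `|t - t'| < e / (nrm (b - a) + 1) by [].
rewrite nrmZr ltr_pdivlMr ?ltr_wpDl ?nrm_ge0//.
by apply: le_lt_trans; rewrite ler_wpM2l// lerDl.
Qed.

Lemma om_continuous r : 0 <= r -> continuous (om r).
Proof.
move=> r0 t; apply/cvg_nrmP => e e0.
have [d d0 Hd] := cis_approx (ltr01 : 0 < 1 :> R).
have e'0 : 0 < Num.min d (e / (2 * r + 1)).
  by rewrite lt_min d0 divr_gt0// ltr_wpDl// mulr_ge0.
exists (Num.min d (e / (2 * r + 1))) => //= t' tt'.
have {tt'} : `|t - t'| < Num.min d (e / (2 * r + 1)) by [].
rewrite distrC lt_min => /andP[/Hd H1].
rewrite ltr_pdivlMr ?ltr_wpDl ?mulr_ge0// => H2.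
rewrite nrmBC (_ : om r t' - om r t = om r t * (cis (t' - t) - 1)); last first.
  by rewrite mulrBr mulr1 /om -mulrA -cisD addrCA subrr addr0.
rewrite nrmM nrm_om//.
have := nrmD (cis (t' - t) - 1 - 'i * (t' - t)%:C : C) ('i * (t' - t)%:C : C).
rewrite subrK nrmM nrmi nrm_real mul1r => H3.
have : r * nrm (cis (t' - t) - 1 : C) <= r * (`|t' - t| + `|t' - t|).
  by rewrite ler_wpM2l//; lra.
move=> /le_lt_trans; apply; have := normr_ge0 (t' - t); nra.
Qed.

Definition cont_in (K : set C) (g : C -> C) := forall z, K z -> forall e : R, 0 < e ->
  exists2 d : R, 0 < d & forall w, K w -> nrm (w - z) < d -> nrm (g w - g z) <= e.

(** Compactness of the parameter interval. The point [w] ranges over K near the curve and not only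
    over the curve, because the midpoints of chords of the arc lie off it. *)
Lemma unif_cont_curve (K : set C) (g : C -> C) (lam : R -> C) (a b : R) :
  cont_in K g -> (forall t, a <= t <= b -> K (lam t)) -> continuous lam ->
  forall e : R, 0 < e -> exists2 d : R, 0 < d & forall t, a <= t <= b ->
    forall w, K w -> nrm (w - lam t) <= d -> nrm (g w - g (lam t)) <= e.
Proof.
move=> gc lamK lamc e e0.
pose Q (d t : R) := a <= t <= b -> forall w, K w -> nrm (w - lam t) <= d -> nrm (g w - g (lam t)) <= e.
have /compact_near_coveringP cpt := @segment_compact R a b.
have : \forall d \near (0 : R)^'+, `[a, b] `<=` Q d.
  apply: cpt => t; rewrite /= in_itv /= => tab.
  have [d d0 Hd] := gc _ (lamK _ tab) (e / 2) (divr_gt0 e0 (ltr0Sn _ 1)).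
  have d20 : 0 < d / 2 by rewrite divr_gt0.
  have /cvg_nrmP /(_ _ d20) lt := lamc t.
  exists ([set t' | nrm (lam t - lam t') < d / 2], [set d' | d' < d / 2]); first split => //=.
    exact: nbhs_right_lt.
  move=> [t' d'] /= [tt' dd'] tab' w Kw wt'.
  have A : nrm (w - lam t) < d.
    by have := nrm_triangle w (lam t') (lam t); rewrite (nrmBC (lam t')); lra.
  have B : nrm (lam t' - lam t) < d by rewrite nrmBC; lra.
  have := nrm_triangle (g w) (g (lam t)) (g (lam t')); rewrite (nrmBC (g (lam t))).
  by have := Hd _ Kw A; have := Hd _ (lamK _ tab') B; lra.
move=> H; have : exists d : R, 0 < d /\ (`[a, b] `<=` Q d).
  near (0 : R)^'+ => d; exists d; split; last by near: d.
  by near: d; exact: nbhs_right_gt.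
move=> [d [d0 Hd]]; exists d => // t tab; exact: Hd.
Unshelve. all: by end_near. Qed.

(** A discrete Cauchy theorem. For a fixed mesh the polygon through the nodes is filled by triangles
    with apex 0, whose midpoint sums are negligible for m large depending on n; uniform continuity
    then replaces each edge by its term in the Riemann sum. *)
Lemma Lsum_cdiff r th (g : C -> C) (B : R) : 0 <= r -> 0 <= th <= pi ->
  (forall z, drop_set r z -> cdiff g z) ->
  (forall z, full_drop r z -> nrm (g z) <= B) -> cont_in (full_drop r) g ->
  forall e : R, 0 < e -> exists N, forall n, (N <= n)%N -> nrm (Lsum r th n g) <= e.
Proof.
move=> r0 /andP[th0 thpi] gd gB gc e e0.
have [L LE] : exists L : R, 2 * pi - th - th = L by exists (2 * pi - th - th).
have L0 : 0 <= L by rewrite -LE; lra.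
have B0 : 0 <= B by rewrite (le_trans (nrm_ge0 (g 1)))// gB//; right.
(* One summand per source of error: the two segments, the total length of the chords of the arc (at
   most 2 r L), the chords against the weights [w2] (r L B), and the triangles. *)
pose D : R := nrm (om r th - 1) + nrm (1 - om r (- th)) + r * L * 2 + r * L * B + 1.
have D0 : 0 < D by rewrite /D ltr_wpDl// !addr_ge0 ?nrm_ge0// !mulr_ge0.
pose e' := Num.min 1 (e / D).
have e'0 : 0 < e' by rewrite lt_min ltr01 divr_gt0.
have e'1 : e' <= 1 by rewrite ge_min lexx.
have e'D : e' * D <= e by rewrite -ler_pdivlMr// ge_min lexx orbT.
have lineK1 t : 0 <= t <= 1 -> full_drop r (line 1 (om r th) t).
  move=> /andP[t0 t1]; have [->|tn0] := eqVneq t 0.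
    by right; rewrite /line mul0r addr0.
  left; rewrite /line (_ : _ + _ = (1 - (1 - t))%:C * om r th + (1 - t)%:C).
    apply: drop_conv1; last exact: om_drop.
    by rewrite subr_ge0 t1/= ltrBlDl ltrDr lt_neqAle eq_sym tn0.
  by rewrite !rmorphB /= rmorph1; ring.
have lineK3 t : 0 <= t <= 1 -> full_drop r (line (om r (- th)) 1 t).
  move=> /andP[t0 t1]; have [->|tn1] := eqVneq t 1.
    by right; rewrite /line mul1r addrC subrK.
  left; rewrite /line (_ : _ + _ = (1 - t)%:C * om r (- th) + t%:C).
    by apply: drop_conv1; [rewrite t0 lt_neqAle tn1|exact: om_drop].
  by rewrite !rmorphB /= rmorph1; ring.
have [d1 d10 U1] := unif_cont_curve gc lineK1 (@line_continuous _ _) e'0.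
have [d3 d30 U3] := unif_cont_curve gc lineK3 (@line_continuous _ _) e'0.
have omK t : th <= t <= th + L -> full_drop r (om r t) by move=> _; left; exact: om_drop.
have [d2 d20 U2] := unif_cont_curve gc omK (om_continuous r0) e'0.
have [dc dc0 Uc] := cis_approx e'0.
pose dd := Num.min (Num.min d1 d3) (Num.min d2 dc).
have dd0 : 0 < dd by rewrite !lt_min d10 d30 d20 dc0.
(* Every edge of the polygon, and also the angular step, is at most S / n. *)
pose S : R := nrm (om r th - 1) + nrm (1 - om r (- th)) + 2 * r * L + L.
have S0 : 0 <= S by rewrite /S !addr_ge0 ?nrm_ge0// !mulr_ge0.
exists (Num.truncn (S / dd)).+1 => n Nn.
have n0 : (0 < n)%N by rewrite (leq_trans _ Nn).
have n0R : 0 < n%:R :> R by rewrite ltr0n.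
have Sn : S / n%:R < dd.
  rewrite ltr_pdivrMr// mulrC -ltr_pdivrMr// (lt_le_trans (truncnS_gt _))//.
  by rewrite ler_nat.
have Sle (x : R) : 0 <= x -> x <= S -> x / n%:R < dd.
  by move=> x0 xS; apply: le_lt_trans Sn; rewrite ler_wpM2r// invr_ge0 ltW.
pose h := L / n%:R.
have h0 : 0 <= h by rewrite divr_ge0.
pose q1 := p1 r th n; pose q2 := p2 r th n; pose q3 := p3 r th n.
have jn01 j : (j <= n)%N -> 0 <= (j%:R / n%:R : R) <= 1.
  by move=> jn; rewrite divr_ge0//= ler_pdivrMr// mul1r ler_nat.
have q1K j : (j <= n)%N -> full_drop r (q1 j) by move=> jn; apply: lineK1; exact: jn01.
have q3K j : (j <= n)%N -> full_drop r (q3 j) by move=> jn; apply: lineK3; exact: jn01.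
have q2K j : full_drop r (q2 j) by left; exact: p2_drop.
have q2n j : nrm (q2 j) = r by rewrite /q2 /p2 nrm_om.
have q2E j : q2 j = q2 j.+1 * cis (- h).
  rewrite /q2 /p2 /om -mulrA -cisD; congr (_ * cis _); rewrite LE /h -addn1 natrD; ring.
have q2d j : nrm (q2 j.+1 - q2 j - h%:C * ('i * q2 j.+1)) <= r * (e' * h).
  rewrite (_ : _ - _ = - (q2 j.+1 * (cis (- h) - 1 - 'i * (- h)%:C))); last first.
    by rewrite (q2E j) rmorphN /=; ring.
  rewrite nrmN nrmM q2n ler_wpM2l//.
  have := Uc (- h); rewrite normrN ger0_norm//; apply.
  apply: (lt_le_trans (Sle L _ _)) => //.
    by rewrite /S lerDr !addr_ge0 ?nrm_ge0// !mulr_ge0.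
  by rewrite !ge_min lexx !orbT.
have q2l j : nrm (q2 j.+1 - q2 j) <= 2 * r * h.
  have := nrmD (q2 j.+1 - q2 j - h%:C * ('i * q2 j.+1)) (h%:C * ('i * q2 j.+1)).
  rewrite subrK (nrmM h%:C) (nrmM 'i) nrmi nrm_real q2n ger0_norm// mul1r.
  have : r * (e' * h) <= r * (1 * h) by rewrite ler_wpM2l// ler_wpM2r.
  by have := q2d j; lra.
(* the triangles with vertex 0 over the edges of the polygon *)
have tri : exists m, [/\ forall j : 'I_n, nrm (midT m g 0 (q1 j) (q1 j.+1)) <= e' / (3 * n%:R),
    forall j : 'I_n, nrm (midT m g 0 (q2 j) (q2 j.+1)) <= e' / (3 * n%:R) &
    forall j : 'I_n, nrm (midT m g 0 (q3 j) (q3 j.+1)) <= e' / (3 * n%:R)].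
  have en0 : 0 < e' / (3 * n%:R) by rewrite divr_gt0// mulr_gt0.
  have K1 (j : 'I_n) : exists M, forall m, (M <= m)%N ->
      nrm (midT m g 0 (q1 j) (q1 j.+1)) <= e' / (3 * n%:R).
    apply: (goursat_full_drop r0 gd gB (q1K _ _) (q1K _ _)) => //; first exact: ltnW.
    by right; exact: p1_drop.
  have K2 (j : 'I_n) : exists M, forall m, (M <= m)%N ->
      nrm (midT m g 0 (q2 j) (q2 j.+1)) <= e' / (3 * n%:R).
    apply: (goursat_full_drop r0 gd gB (q2K _) (q2K _)) => //.
    by right; exact: p2_drop.
  have K3 (j : 'I_n) : exists M, forall m, (M <= m)%N ->
      nrm (midT m g 0 (q3 j) (q3 j.+1)) <= e' / (3 * n%:R).
    apply: (goursat_full_drop r0 gd gB (q3K _ _) (q3K _ _)) => //; first exact: ltnW.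
    by left; exact: p3_drop.
  have [M1 HM1] := choice K1; have [M2 HM2] := choice K2; have [M3 HM3] := choice K3.
  exists (maxn (\max_j M1 j) (maxn (\max_j M2 j) (\max_j M3 j))); split => j.
  - by apply: HM1; rewrite (leq_trans (leq_bigmax j))// leq_maxl.
  - by apply: HM2; rewrite (leq_trans (leq_bigmax j))// leq_max leq_maxl orbT.
  - by apply: HM3; rewrite (leq_trans (leq_bigmax j))// !leq_max leqnn !orbT.
have [m [T1 T2 T3]] := tri.
pose J (q : nat -> C) := \sum_(j < n) midI m g (q j) (q j.+1).
have closed : nrm (J q1 + J q2 + J q3) <= e'.
  have -> : J q1 + J q2 + J q3 = \sum_(j < n) midT m g 0 (q1 j) (q1 j.+1) +
      \sum_(j < n) midT m g 0 (q2 j) (q2 j.+1) + \sum_(j < n) midT m g 0 (q3 j) (q3 j.+1).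
    rewrite !midT_fan -/(J q1) -/(J q2) -/(J q3) /q1 /q2 /q3.
    by rewrite p1_0 p1_n// p2_0 p2_n// p3_0 p3_n//; ring.
  have sumT (q : nat -> C) : (forall j : 'I_n, nrm (midT m g 0 (q j) (q j.+1)) <= e' / (3 * n%:R)) ->
      nrm (\sum_(j < n) midT m g 0 (q j) (q j.+1)) <= e' / 3.
    move=> H; rewrite (le_trans (nrm_sum _ _ _))//.
    apply: (@le_trans _ _ (\sum_(j < n) e' / (3 * n%:R))); first exact: ler_sum.
    rewrite sumr_const card_ord -mulr_natr le_eqVlt; apply/orP; left; apply/eqP.
    by field; rewrite gt_eqF.
  rewrite (le_trans (nrmD _ _))// (le_trans (lerD (nrmD _ _) (lexx _)))//.
  by have := sumT _ T1; have := sumT _ T2; have := sumT _ T3; lra.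
have dd1 : dd <= d1 by rewrite !ge_min lexx.
have dd3 : dd <= d3 by rewrite !ge_min lexx !orbT.
have dd2 : dd <= d2 by rewrite !ge_min lexx !orbT.
have n1nrm (x : C) : nrm ((n%:R^-1)%:C * x : C) = nrm x / n%:R.
  by rewrite nrmM nrm_real ger0_norm ?invr_ge0 ?(ltW n0R)// mulrC.
have sumc (x y : R) : \sum_(j < n) x * (y / n%:R) = x * y.
  by rewrite sumr_const card_ord -[LHS]mulr_natr -mulrA divfK// gt_eqF.
have A1 : nrm (psum n (w1 r th n) (fun j => q1 j.+1) g - J q1) <= e' * nrm (om r th - 1).
  rewrite /psum /J -sumrB (le_trans (nrm_sum _ _ _))//.
  apply: (@le_trans _ _ (\sum_(j < n) e' * (nrm (om r th - 1) / n%:R))).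
    apply: ler_sum => j _; rewrite nrmBC w1E -n1nrm -/(w1 r th n j) w1E.
    have wd : nrm (q1 j.+1 - q1 j) <= d1.
      rewrite /q1 -w1E n1nrm (le_trans _ dd1)// ltW// Sle ?nrm_ge0//.
      by rewrite /S -!addrA lerDl !addr_ge0 ?nrm_ge0// !mulr_ge0.
    apply: (@midI_tag _ r m g _ _ (q1 j.+1) e' d1).
    - by apply: q1K; exact: ltnW.
    - exact: q1K.
    - by rewrite nrmBC.
    - by rewrite subrr nrm0 ltW.
    - by apply: U1; exact: jn01.
  by rewrite sumc.
have A3 : nrm (psum n (w3 r th n) q3 g - J q3) <= e' * nrm (1 - om r (- th)).
  rewrite /psum /J -sumrB (le_trans (nrm_sum _ _ _))//.
  apply: (@le_trans _ _ (\sum_(j < n) e' * (nrm (1 - om r (- th)) / n%:R))).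
    apply: ler_sum => j _; rewrite nrmBC w3E -n1nrm -/(w3 r th n j) w3E.
    have wd : nrm (q3 j.+1 - q3 j) <= d3.
      rewrite /q3 -w3E n1nrm (le_trans _ dd3)// ltW// Sle ?nrm_ge0//.
      have := nrm_ge0 (om r th - 1); have : 0 <= r * L by rewrite mulr_ge0.
      by rewrite /S; lra.
    apply: (@midI_tag _ r m g _ _ (q3 j) e' d3).
    - by apply: q3K; exact: ltnW.
    - exact: q3K.
    - by rewrite subrr nrm0 ltW.
    - exact: wd.
    - by apply: U3; apply: jn01; exact: ltnW.
  by rewrite sumc.
have A2 : nrm (psum n (w2 r th n) (fun j => q2 j.+1) g - J q2) <= e' * (r * L * 2 + r * L * B).
  rewrite /psum /J -sumrB (le_trans (nrm_sum _ _ _))//.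
  apply: (@le_trans _ _ (\sum_(j < n) (e' * ((r * L * 2 + r * L * B) / n%:R)))).
    apply: ler_sum => j _; rewrite nrmBC.
    have wd : nrm (q2 j.+1 - q2 j) <= d2.
      rewrite (le_trans (q2l j))// (le_trans _ dd2)// ltW// /h mulrA Sle ?mulr_ge0//.
      have := nrm_ge0 (om r th - 1); have := nrm_ge0 (1 - om r (- th)).
      by rewrite /S; lra.
    have := nrmD (midI m g (q2 j) (q2 j.+1) - (q2 j.+1 - q2 j) * g (q2 j.+1))
      ((q2 j.+1 - q2 j - w2 r th n j) * g (q2 j.+1)).
    rewrite [X in nrm X <= _](_ : _ = midI m g (q2 j) (q2 j.+1) - w2 r th n j *: g (q2 j.+1)); last first.
      by rewrite /GRing.scale /=; ring.
    move=> /le_trans; apply.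
    rewrite (_ : e' * (_ / n%:R) = e' * (2 * r * h) + r * (e' * h) * B); last by rewrite /h; ring.
    apply: lerD.
      apply: (@le_trans _ _ (e' * nrm (q2 j.+1 - q2 j))); last by rewrite ler_wpM2l// ltW.
      apply: (@midI_tag _ r m g _ _ (q2 j.+1) e' d2) => //.
      - by rewrite nrmBC.
      - by rewrite subrr nrm0 ltW.
      - apply: U2; rewrite LE lerDl mulr_ge0 ?(andP (jn01 _ _)).1//= lerD2l.
        by rewrite ler_piMr//; have /andP[] := jn01 j.+1 (ltn_ord j).
    rewrite nrmM ler_pM ?nrm_ge0//; first by rewrite /w2 LE; exact: q2d.
    exact: gB.
  by rewrite sumc.
have := nrmD (psum n (w1 r th n) (fun j => q1 j.+1) g - J q1) (J q1 + J q2 + J q3).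
have := nrmD (psum n (w2 r th n) (fun j => q2 j.+1) g - J q2)
  (psum n (w1 r th n) (fun j => q1 j.+1) g - J q1 + (J q1 + J q2 + J q3)).
have := nrmD (psum n (w3 r th n) q3 g - J q3)
  ((psum n (w2 r th n) (fun j => q2 j.+1) g - J q2) +
   (psum n (w1 r th n) (fun j => q1 j.+1) g - J q1 + (J q1 + J q2 + J q3))).
rewrite [X in nrm X <= _](_ : _ = Lsum r th n g); last by rewrite /Lsum -/q1 -/q2 -/q3; ring.
by move: e'D; rewrite /D; lra.
Qed.

End Contour.

(** * Bochner integrals as limits of Riemann sums *)

Section SimpleIntegral.
Context {R : realType} {d} {M : measurableType d} (mu : {measure set M -> \bar R}).
Variable D : set M.
Hypotheses (mD : measurable D) (finD : (mu D < +oo)%E).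

Section fibres.
Variables (T : choiceType) (p : M -> T) (S : {fset T}).
Hypotheses (pS : forall w, p w \in S) (mp : forall x, measurable (p @^-1` [set x])).

Let m x : R := fine (mu (D `&` p @^-1` [set x])).

Let mDp x : measurable (D `&` p @^-1` [set x]).
Proof. exact: measurableI. Qed.

Let mE x : mu (D `&` p @^-1` [set x]) = (m x)%:E.
Proof.
rewrite /m fineK// ge0_fin_numE//; apply: le_lt_trans finD.
by apply: le_measure; rewrite ?inE//; exact: subIsetl.
Qed.

Let fibre_triv (A : set T) : trivIset A (fun x => D `&` p @^-1` [set x]).
Proof. by move=> x y _ _ [w [[_ /= <-] [_ /= <-]]]. Qed.

(** The integral of a simple function may be computed on any finite partition finer than its level
    sets. Two simple functions are compared on the common partition given by their pair. *)
Lemma simple_integral_fset (Y : normedModType R[i]) (phi : T -> Y) :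
  simple_integral mu D (phi \o p) =
  \sum_(x <- S) (fine (mu (D `&` p @^-1` [set x])))%:C *: phi x.
Proof.
have finr : finite_set (range (phi \o p)).
  apply: (@sub_finite_set _ _ (phi @` [set` S])); last by apply: finite_image; exact: finite_fset.
  by move=> _ [w _ <-]; exists (p w) => //=.
rewrite /simple_integral fsbig_finite//=.
have muE y : fine (mu (D `&` (phi \o p) @^-1` [set y])) = \sum_(x <- S | phi x == y) m x.
  rewrite (_ : _ `&` _ = \big[setU/set0]_(x <- [fset x in S | phi x == y]%fset) (D `&` p @^-1` [set x])).
    rewrite measure_fbigsetU; [|by move=> x _; exact: mDp|by apply: fibre_triv].
    transitivity (fine (\sum_(i <- [fset x | x in S & phi x == y]%fset) (m i)%:E)%E).
      by congr fine; apply: eq_bigr => i _; exact: mE.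
    by rewrite sumEFin /= [RHS]big_fset_condE.
  rewrite -bigcup_fset; apply/seteqP; split => [w [Dw /= wy]|w [x /=]].
    by exists (p w) => //=; rewrite !inE pS; apply/eqP.
  by rewrite !inE => /andP[_ /eqP xy] [Dw /= wx]; split => //=; rewrite wx.
under eq_bigr do rewrite muE rmorph_sum /= scaler_suml.
rewrite (exchange_big_dep xpredT)//=; apply: eq_bigr => x _.
have [xr|xr] := pselect (range (phi \o p) (phi x)).
  have xin : phi x \in fset_set (range (phi \o p)) by rewrite in_fset_set// inE.
  rewrite (big_rem (phi x))//= eqxx big1_seq ?addr0// => y /andP[/eqP yx].
  by rewrite -yx mem_rem_uniq ?fset_uniq// !inE eqxx.
have m0 : m x = 0.
  rewrite /m (_ : _ `&` _ = set0) ?measure0//; apply/seteqP; split => // w [_ /= wx].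
  by apply: xr; exists w => //=; rewrite wx.
rewrite -/(m x) m0 scale0r big1// => y _; by rewrite scale0r.
Qed.

Lemma integral_fset (psi : T -> R) : (forall x, 0 <= psi x) ->
  (\int[mu]_(w in D) (psi (p w))%:E = (\sum_(x <- S) fine (mu (D `&` p @^-1` [set x])) * psi x)%:E)%E.
Proof.
move=> psi0.
have DE : D = \big[setU/set0]_(x <- S) (D `&` p @^-1` [set x]).
  rewrite -bigcup_fset; apply/seteqP; split => [w Dw|w [x _ []]//].
  by exists (p w) => //=.
rewrite {1}DE (@ge0_integral_bigsetU _ _ _ _ _ (fun x => D `&` p @^-1` [set x])) ?fset_uniq//=.
- rewrite -sumEFin; apply: eq_bigr => x _.
  rewrite (eq_integral (cst (psi x)%:E)).
    by rewrite integral_cst// mE EFinM muleC.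
  by move=> w; rewrite inE => -[_ /= ->].
- rewrite -DE; apply/measurable_EFinP; apply: measurable_funTS => _ B mB; rewrite setTI.
  rewrite (_ : _ @^-1` _ = \bigcup_(x in [set` S] `&` psi @^-1` B) p @^-1` [set x]).
    by apply: fin_bigcup_measurable => // ; apply: finite_setI; left; exact: finite_fset.
  apply/seteqP; split => [w /= Bw|w [x [_ /= Bx] /= wx]]; last by rewrite /= wx.
  by exists (p w) => //=; split => //=.
- by move=> w _; rewrite lee_fin.
Qed.

End fibres.

Lemma nrm_simple_integralB (Y : normedModType R[i]) (s s' : M -> Y) :
  simple_function s -> simple_function s' ->
  ((nrm (simple_integral mu D s - simple_integral mu D s'))%:E <=
   \int[mu]_(w in D) (nrm (s w - s' w))%:E)%E.
Proof.
move=> [f m] [f' m'].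
pose p w := (s w, s' w).
have fp : finite_set (range p).
  apply: (@sub_finite_set _ _ (range s `*` range s')); last exact: finite_setX.
  by move=> _ [w _ <-]; split; exists w.
pose S := fset_set (range p).
have pS w : p w \in S by rewrite in_fset_set// inE; exists w.
have mp x : measurable (p @^-1` [set x]).
  rewrite (_ : _ @^-1` _ = s @^-1` [set x.1] `&` s' @^-1` [set x.2]); first exact: measurableI.
  by case: x => y y'; apply/seteqP; split => w /=; [case=> -> ->|case=> <- <-].
rewrite (integral_fset pS mp (psi := fun x => nrm (x.1 - x.2)))//; last by move=> x; exact: nrm_ge0.
have -> := simple_integral_fset pS mp fst.
have -> := simple_integral_fset pS mp snd.
rewrite -sumrB lee_fin (le_trans (nrm_sum _ _ _))//; apply: ler_sum => x _.
by rewrite -scalerBr nrmZr ger0_norm// fine_ge0.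
Qed.

End SimpleIntegral.

Section BochnerRiemann.
Context {R : realType} {Y : normedModType R[i]}.
Implicit Types (f : R -> Y) (s n : nat) (a b : R).
Local Notation mu := (@lebesgue_measure R : {measure set (measurableTypeR R) -> \bar R}).

Definition grid (a b : R) n j : R := a + (b - a) * (j%:R / n%:R).

(* Left Riemann sums for s = 0, right Riemann sums for s = 1. *)
Definition rsum (s n : nat) (a b : R) (f : R -> Y) : Y :=
  \sum_(j < n) ((b - a) / n%:R)%:C *: f (grid a b n (j + s)).

(** The index n marks the points outside [a, b[, where [step] vanishes. *)
Definition cell (a b : R) n (t : R) : nat :=
  if a <= t < b then Num.truncn (n%:R * ((t - a) / (b - a))) else n.

Definition step (s n : nat) (a b : R) (f : R -> Y) (t : R) : Y :=
  if (cell a b n t < n)%N then f (grid a b n (cell a b n t + s)) else 0.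

Lemma cellP a b n t : a < b -> (0 < n)%N -> a <= t < b ->
  (cell a b n t < n)%N /\ grid a b n (cell a b n t) <= t < grid a b n (cell a b n t).+1.
Proof.
move=> ab n0 /[dup] tab /andP[ta tb]; rewrite /cell tab.
have ba0 : 0 < b - a by rewrite subr_gt0.
have n0R : 0 < n%:R :> R by rewrite ltr0n.
set u := n%:R * _; have u0 : 0 <= u by rewrite mulr_ge0// divr_ge0 ?subr_ge0// ltW.
have un : u < n%:R by rewrite /u gtr_pMr// ltr_pdivrMr// mul1r ltrD2r.
have tE : t = a + (b - a) * (u / n%:R) by rewrite /u; field; rewrite !gt_eqF.
have /andP[] := truncn_itv u0; set k := Num.truncn u => ku uk.
split; first by rewrite -(ltr_nat R) (le_lt_trans ku).
rewrite /grid tE lerD2l ltrD2l !ler_pM2l ?ltr_pM2l// ler_pM2r ?ltr_pM2r ?invr_gt0//.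
by rewrite ku.
Qed.

Lemma grid_cell a b n k t : a < b -> (0 < n)%N -> (k < n)%N ->
  (grid a b n k <= t < grid a b n k.+1) <-> (cell a b n t = k).
Proof.
move=> ab n0 kn.
have ba0 : 0 < b - a by rewrite subr_gt0.
have n0R : 0 < n%:R :> R by rewrite ltr0n.
have gridS i j : (grid a b n i < grid a b n j) = (i < j)%N.
  by rewrite /grid ltrD2l ltr_pM2l// ltr_pM2r ?invr_gt0// ltr_nat.
have gridle i j : (grid a b n i <= grid a b n j) = (i <= j)%N.
  by rewrite /grid lerD2l ler_pM2l// ler_pM2r ?invr_gt0// ler_nat.
have g0 : grid a b n 0 = a by rewrite /grid mul0r mulr0 addr0.
have gn : grid a b n n = b by rewrite /grid divff ?gt_eqF// mulr1 addrC subrK.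
split=> [/andP[kt tk]|ck].
  have tab : a <= t < b.
    apply/andP; split; first by apply: le_trans kt; rewrite -[leLHS]g0 gridle.
    by apply: (lt_le_trans tk); rewrite -[leRHS]gn gridle.
  have [cn /andP[ct tc]] := cellP ab n0 tab.
  have := le_lt_trans ct tk; have := le_lt_trans kt tc; rewrite !gridS !ltnS => H1 H2.
  by apply/eqP; rewrite eqn_leq H1 H2.
have tab : a <= t < b.
  by move: ck; rewrite /cell; case: ifP => // _ nk; move: kn; rewrite nk ltnn.
by have [_] := cellP ab n0 tab; rewrite ck.
Qed.

Lemma cell_measurable a b n k : a < b -> (0 < n)%N -> measurable (cell a b n @^-1` [set k]).
Proof.
move=> ab n0; have [kn|nk] := ltnP k n.
  rewrite (_ : _ @^-1` _ = `[grid a b n k, grid a b n k.+1[%classic)//.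
  by apply/seteqP; split => t /=; rewrite in_itv /=; apply grid_cell.
have [->|nkn] := eqVneq k n.
  rewrite (_ : _ @^-1` _ = ~` `[a, b[%classic); first exact: measurableC.
  apply/seteqP; split => t /=; rewrite in_itv /=.
    by move=> ct tab; have [] := cellP ab n0 tab; rewrite ct ltnn.
  by move=> /negP/negbTE tab; rewrite /cell tab.
rewrite (_ : _ @^-1` _ = set0)//; apply/seteqP; split => // t /= ct.
have [tab|tab] := boolP (a <= t < b).
  by have [] := cellP ab n0 tab; rewrite ct ltnNge nk.
by move: ct nkn; rewrite /cell (negbTE tab) => ->; rewrite eqxx.
Qed.

Lemma cell_le a b n t : a < b -> (0 < n)%N -> (cell a b n t <= n)%N.
Proof.
move=> ab n0; have [tab|tab] := boolP (a <= t < b).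
  by have [] := cellP ab n0 tab => /ltnW.
by rewrite /cell (negbTE tab).
Qed.

Lemma step_simple s n a b f : a < b -> (0 < n)%N -> simple_function (step s n a b f).
Proof.
move=> ab n0; pose phi k := if (k < n)%N then f (grid a b n (k + s)) else 0.
split.
  apply: (@sub_finite_set _ _ (phi @` `I_n.+1)); last by apply: finite_image; exact: finite_II.
  by move=> _ [t _ <-]; exists (cell a b n t) => //=; rewrite ltnS cell_le.
move=> y; rewrite (_ : _ @^-1` _ = \bigcup_(k in `I_n.+1 `&` phi @^-1` [set y]) (cell a b n @^-1` [set k])).
  apply: fin_bigcup_measurable => [|k _]; last exact: cell_measurable.
  by apply: finite_setI; left; exact: finite_II.
apply/seteqP; split => [t /= ty|t [k [_ /= ky] /= tk]].
  by exists (cell a b n t) => //=; split => //=; rewrite ltnS cell_le.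
by rewrite /step tk.
Qed.

Let mu_itv (i : interval R) :
  mu [set` i] = (if (i.1 : \bar R) < i.2 then (i.2 : \bar R) - i.1 else 0)%E.
Proof. exact: lebesgue_measure_itv. Qed.

Lemma fin_mu_itv (a b : R) : (mu `[a, b]%classic < +oo)%E.
Proof. by rewrite mu_itv /=; case: ifP => _; rewrite ?ltry// -EFinB ltry. Qed.

Lemma mu_cell a b n k : a < b -> (k < n)%N ->
  (mu (`[a, b]%classic `&` cell a b n @^-1` [set k]) = ((b - a) / n%:R)%:E)%E.
Proof.
move=> ab kn; have n0 : (0 < n)%N by exact: leq_ltn_trans kn.
have ba0 : 0 < b - a by rewrite subr_gt0.
have n0R : 0 < n%:R :> R by rewrite ltr0n.
rewrite (_ : _ `&` _ = `[grid a b n k, grid a b n k.+1[%classic); last first.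
  have gridle i l : (grid a b n i <= grid a b n l) = (i <= l)%N.
    by rewrite /grid lerD2l ler_pM2l// ler_pM2r ?invr_gt0// ler_nat.
  have g0 : grid a b n 0 = a by rewrite /grid mul0r mulr0 addr0.
  have gn : grid a b n n = b by rewrite /grid divff ?gt_eqF// mulr1 addrC subrK.
  apply/seteqP; split => t /=; rewrite !in_itv /=; first by case=> _; apply grid_cell.
  move=> /[dup] /andP[H1 H2] H; split; last by apply grid_cell.
  apply/andP; split; first by apply: le_trans H1; rewrite -[leLHS]g0 gridle.
  by apply: (le_trans (ltW H2)); rewrite -[leRHS]gn gridle.
rewrite mu_itv /= lte_fin /grid ltrD2l ltr_pM2l// ltr_pM2r ?invr_gt0// ltr_nat ltnSn /=.
rewrite -EFinB; congr EFin.
by rewrite -[k.+1]addn1 natrD; field; rewrite gt_eqF.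
Qed.

Lemma cell_mem a b n : a < b -> (0 < n)%N -> exists S : {fset nat},
  (forall w, cell a b n w \in S) /\ perm_eq S (index_iota 0 n.+1).
Proof.
move=> ab n0; exists (seq_fset tt (iota 0 n.+1)); split => [w|].
  by rewrite seq_fsetE mem_iota ltnS cell_le.
by rewrite (perm_trans (seq_fset_perm _ _))// undup_id ?iota_uniq// /index_iota subn0.
Qed.

Lemma simple_integral_step s n a b f : a < b -> (0 < n)%N ->
  simple_integral mu `[a, b]%classic (step s n a b f) = rsum s n a b f.
Proof.
move=> ab n0; pose phi k := if (k < n)%N then f (grid a b n (k + s)) else 0.
have [S [pS SE]] := cell_mem ab n0.
have := @simple_integral_fset R _ _ mu `[a, b]%classic (measurable_itv _) (fin_mu_itv a b)
  nat (cell a b n) S pS (fun k => cell_measurable k ab n0) Y phi.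
rewrite (_ : phi \o cell a b n = step s n a b f)// => ->.
rewrite (perm_big _ SE) big_nat_recr//= /phi ltnn scaler0 addr0.
by rewrite big_mkord; apply: eq_bigr => j _; rewrite ltn_ord mu_cell.
Qed.

Lemma integral_nrm_step s n a b f : a < b -> (0 < n)%N ->
  (\int[mu]_(t in `[a, b]) (nrm (step s n a b f t))%:E =
   (\sum_(j < n) (b - a) / n%:R * nrm (f (grid a b n (j + s))))%:E)%E.
Proof.
move=> ab n0; pose phi k := if (k < n)%N then f (grid a b n (k + s)) else 0.
have [S [pS SE]] := cell_mem ab n0.
have := @integral_fset R _ _ mu `[a, b]%classic (measurable_itv _) (fin_mu_itv a b)
  nat (cell a b n) S pS (fun k => cell_measurable k ab n0) (fun k => nrm (phi k)) (fun k => nrm_ge0 _).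
rewrite (perm_big _ SE) big_nat_recr//= /phi ltnn nrm0 mulr0 addr0 => ->.
by congr EFin; rewrite big_mkord; apply: eq_bigr => j _; rewrite ltn_ord mu_cell.
Qed.

Section convergence.
Variables (a b : R) (f : R -> Y) (G : R -> R) (s : nat).
Hypotheses (ab : a < b) (s1 : (s <= 1)%N).
Hypothesis Ycomplete : forall u : nat -> Y,
  (forall e : R, 0 < e -> exists N, forall m n, (N <= m)%N -> (N <= n)%N -> nrm (u m - u n) <= e) ->
  exists l : Y, u @ \oo --> l.
Hypothesis fc : forall t, a < t < b -> f t' @[t' --> t] --> f t.
Hypothesis Gint : mu.-integrable `]a, b[%classic (EFin \o G).
Hypothesis fG : forall t, a < t < b -> nrm (f t) <= G t.
Hypothesis tagG : forall n j t, (j < n)%N -> a < t < b ->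
  grid a b n j <= t < grid a b n j.+1 -> nrm (f (grid a b n (j + s))) <= G t.

Let Do : set R := `]a, b[%classic.
Let Dc : set R := `[a, b]%classic.

Let nrmB_measurable (r : R -> Y) : simple_function r ->
  measurable_fun Do (fun t => nrm (f t - r t)).
Proof.
move=> [finr mr].
have my y : measurable_fun Do (fun t => nrm (f t - y)).
  apply: open_continuous_measurable_fun => [|t]; first exact: interval_open.
  move=> /set_mem; rewrite /Do /= in_itv /= => tab; apply: cvg_nrm; apply: cvgB; [exact: fc|exact: cvg_cst].
move=> mDo B mB.
rewrite (_ : _ `&` _ = \bigcup_(y in range r) ((r @^-1` [set y]) `&` (Do `&` ((fun t => nrm (f t - y)) @^-1` B)))).
  by apply: fin_bigcup_measurable => // y _; apply: measurableI => //; exact: my.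
apply/seteqP; split => [t [Dt Bt]|t [y _ [/= <- [Dt Bt]]]//].
by exists (r t); [exists t|].
Qed.

Let integral_oc (h : R -> \bar R) : (forall t, 0 <= h t)%E ->
  (\int[mu]_(t in Dc) h t = \int[mu]_(t in Do) h t)%E.
Proof.
move=> h0; apply/eqP; rewrite eq_le; apply/andP; split.
  rewrite integral_mkcond [leRHS]integral_mkcond.
  apply: (@le_integral_off_null _ _ _ mu [set a; b]).
  - exact: measurableU.
  - apply: null_set_setU => //; exact: lebesgue_measure_set1.
  - by move=> t; rewrite patchE; case: ifP.
  - by move=> t; rewrite patchE; case: ifP.
  - move=> t tab; rewrite !patchE; case: ifPn => [|_]; last by case: ifP.
    rewrite inE /Dc /= in_itv /= => /andP[t1 t2]; rewrite mem_set//.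
    rewrite /Do /= in_itv /= !lt_neqAle t1 t2 !andbT; apply/andP; split.
      by apply/eqP => at_; apply: tab; left.
    by apply/eqP => tb; apply: tab; right.
rewrite [leRHS]integral_mkcond; apply: le_integral_T => //.
  by move=> t; rewrite patchE; case: ifP.
move=> t; rewrite /Do /= in_itv /= => /andP[t1 t2]; rewrite patchE mem_set//.
by rewrite /Dc /= in_itv /= !ltW.
Qed.

Let dist (r : R -> Y) : \bar R := (\int[mu]_(t in Dc) (nrm (f t - r t))%:E)%E.

Let dist_ge0 r : (0 <= dist r)%E.
Proof. by apply: integral_ge0 => t _; rewrite lee_fin nrm_ge0. Qed.

Let nrm_SIB r r' : simple_function r -> simple_function r' ->
  ((nrm (simple_integral mu Dc r - simple_integral mu Dc r'))%:E <= dist r + dist r')%E.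
Proof.
move=> sr sr'; have nn (v : Y) : (0 <= (nrm v)%:E)%E by rewrite lee_fin nrm_ge0.
have Hn := @nrm_simple_integralB _ _ _ mu _ (measurable_itv _) (fin_mu_itv a b) _ _ _ sr sr'.
apply: le_trans; first exact: Hn.
rewrite /dist !integral_oc// -ge0_integralD//=; last 3 first.
- exact: measurable_itv.
- by apply/measurable_EFinP; exact: nrmB_measurable.
- by apply/measurable_EFinP; exact: nrmB_measurable.
apply: ge0_le_integral => //.
- exact: measurable_itv.
- apply/measurable_EFinP; apply: measurable_funTS.
  exact: (simple_measurable2 (fun v w => nrm (v - w)) sr sr').
- apply: emeasurable_funD; apply/measurable_EFinP; exact: nrmB_measurable.
- move=> t _; rewrite -EFinD lee_fin (nrmBC (f t) (r t)).
  exact: nrm_triangle.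
Qed.

Lemma step_cvg t : a < t < b -> step s n.+1 a b f t @[n --> \oo] --> f t.
Proof.
move=> tab; apply/cvg_nrmP => e e0.
have /cvg_nrmP /(_ e e0) [d /= d0 Hd] := fc tab.
have ba0 : 0 < b - a by rewrite subr_gt0.
have [N HN] : exists N : nat, (b - a) / d < N%:R.
  by exists (Num.truncn ((b - a) / d)).+1; exact: truncnS_gt.
exists N => // n /= Nn.
have tab' : a <= t < b by case/andP: tab => /ltW -> ->.
have [cn /andP[ct tc]] := cellP ab (ltn0Sn n) tab'.
rewrite /step cn; apply: Hd; rewrite /ball_ /=.
have dn : (b - a) / n.+1%:R < d.
  rewrite ltr_pdivrMr ?ltr0n// mulrC -ltr_pdivrMr// (lt_le_trans HN)// ler_nat.
  by rewrite (leq_trans Nn).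
have gS k : grid a b n.+1 k.+1 = grid a b n.+1 k + (b - a) / n.+1%:R.
  rewrite /grid (_ : k.+1%:R / _ = k%:R / n.+1%:R + n.+1%:R^-1); last by rewrite -(natr1 k) mulrDl mul1r.
  by rewrite [(b - a) * (_ + _)]mulrDr addrA.
have [s0|s0] : s = 0%N \/ s = 1%N by move: s1; case: (s) => [|[|]]; auto.
  rewrite s0 addn0; move: tc ct; rewrite gS; move: dn.
  move: (grid _ _ _ _) (_ / _) => g D dn tc ct.
  by rewrite ltr_norml; apply/andP; split; lra.
rewrite s0 addn1; move: tc ct; rewrite gS; move: dn.
move: (grid _ _ _ _) (_ / _) => g D dn tc ct.
by rewrite ltr_norml; apply/andP; split; lra.
Qed.

Let dist_step_cvg : dist (step s n.+1 a b f) @[n --> \oo] --> (0 : \bar R)%E.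
Proof.
have distE n : dist (step s n.+1 a b f) = (\int[mu]_(t in Do) (nrm (f t - step s n.+1 a b f t))%:E)%E.
  by rewrite /dist integral_oc// => t; rewrite lee_fin nrm_ge0.
under eq_fun do rewrite distE.
have mDo : measurable Do by exact: measurable_itv.
have m1 n : measurable_fun Do (fun t => (nrm (f t - step s n.+1 a b f t))%:E).
  by apply/measurable_EFinP; apply: nrmB_measurable; exact: step_simple.
have m2 : measurable_fun Do (cst (0 : \bar R)) by exact: measurable_cst.
have m3 : {ae mu, forall t, Do t ->
    (nrm (f t - step s n.+1 a b f t))%:E @[n --> \oo] --> cst (0 : \bar R) t}.
  apply: aeW => t; rewrite /Do /= in_itv /= => tab.
  apply: cvg_EFin; first exact: nearW.
  have -> : (0 : R) = nrm (f t - f t) by rewrite subrr nrm0.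
  by apply: cvg_nrm; apply: cvgB; [exact: cvg_cst|exact: step_cvg].
have m4 : mu.-integrable Do (fun t => (2 * G t)%:E).
  rewrite (_ : (fun _ => _) = (fun t => 2%:E * (EFin \o G) t)%E); last by apply/funext => t; rewrite EFinM.
  exact: integrableZl.
have m5 : {ae mu, forall t n, Do t ->
    (`|(nrm (f t - step s n.+1 a b f t))%:E| <= (2 * G t)%:E)%E}.
  apply: aeW => t n; rewrite /Do /= in_itv /= => tab.
  have tab' : a <= t < b by case/andP: tab => /ltW -> ->.
  have [cn ct] := cellP ab (ltn0Sn n) tab'.
  rewrite lee_fin ger0_norm ?nrm_ge0// (le_trans (nrmB _ _))// mulr2n mulrDl mul1r lerD ?fG//.
  by rewrite /step cn tagG.
have [_ _] := @dominated_convergence _ _ _ mu Do mDo _ _ _ m1 m2 m3 m4 m5.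
by rewrite integral0.
Qed.

(** The step functions behind the Riemann sums approximate f in L1 by dominated convergence. As f
    may be singular at an end point, the majorant [G] has to dominate the values at the tags as
    well, which is what [tagG] asks. *)
Lemma bochner_riemann : rsum s n.+1 a b f @[n --> \oo] --> bochner mu `[a, b]%classic f.
Proof.
have SIE n : simple_integral mu Dc (step s n.+1 a b f) = rsum s n.+1 a b f.
  exact: simple_integral_step.
have small e : 0 < e -> \forall n \near \oo, (dist (step s n.+1 a b f) <= e%:E)%E.
  move=> e0; have /fine_cvgP[fin0 /cvgrPdist_le /(_ e e0) H] := dist_step_cvg.
  near=> n.
  have finn : dist (step s n.+1 a b f) \is a fin_num by near: n.
  have : `|0 - fine (dist (step s n.+1 a b f))| <= e by near: n.
  by rewrite sub0r normrN ger0_norm ?fine_ge0// -lee_fin fineK.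
have [l ul] : exists l : Y, rsum s n.+1 a b f @[n --> \oo] --> l.
  apply: Ycomplete => e e0.
  have [N _ HN] := small _ (divr_gt0 e0 (ltr0Sn _ 1)).
  exists N => m n Nm Nn; rewrite -!SIE -lee_fin.
  apply: le_trans (nrm_SIB (step_simple _ _ ab (ltn0Sn m)) (step_simple _ _ ab (ltn0Sn n))) _.
  by rewrite (le_trans (leeD (HN m Nm) (HN n Nn)))// -EFinD -splitr.
have isb : is_bochner mu Dc f l.
  split.
    exists (fun n => step s n.+1 a b f) => [n|]; first exact: step_simple.
    have : mu.-negligible [set a; b].
      exists [set a; b]; split => //; first exact: measurableU.
      by apply: null_set_setU => //; exact: lebesgue_measure_set1.
    apply: negligibleS => t /= H; apply: contrapT => tab; apply: H.
    rewrite /Dc /= in_itv /= => /andP[t1 t2]; apply: step_cvg.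
    rewrite !lt_neqAle t1 t2 !andbT; apply/andP; split.
      by apply/eqP => at_; apply: tab; left.
    by apply/eqP => tb; apply: tab; right.
  exists (fun n => step s n.+1 a b f); split => [n||].
  - exact: step_simple.
  - exact: dist_step_cvg.
  - by under eq_fun do rewrite SIE.
rewrite (_ : bochner mu _ f = l)//; rewrite /bochner.
(* The chosen value [z] may come from another approximating sequence [r]; comparing [r] with the
   step functions in L1 gives z = l. *)
case: xgetP => [z _ [_ [r [rs rd rz]]]|/(_ l)//].
apply/eqP; rewrite -subr_eq0; apply/eqP/nrm_eq0.
apply/eqP; rewrite eq_le nrm_ge0 andbT; apply/ler_addgt0Pr => e e0; rewrite add0r.
have e40 : 0 < e / 4 by rewrite divr_gt0.
have /fine_cvgP[fin0 /cvgrPdist_le /(_ _ e40) H] := rd.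
have /cvg_nrmP /(_ _ e40) Hz := rz.
have /cvg_nrmP /(_ _ e40) Hl := ul.
near \oo => n.
have finn : dist (r n) \is a fin_num by near: n.
have d1 : (dist (r n) <= (e / 4)%:E)%E.
  have : `|0 - fine (dist (r n))| <= e / 4 by near: n.
  by rewrite sub0r normrN ger0_norm ?fine_ge0// -lee_fin fineK.
have d2 : (dist (step s n.+1 a b f) <= (e / 4)%:E)%E by near: n; exact: small.
have d3 : nrm (simple_integral mu Dc (r n) - rsum s n.+1 a b f) <= e / 4 + e / 4.
  rewrite -SIE -lee_fin EFinD; apply: le_trans (leeD d1 d2).
  by apply: nrm_SIB => //; exact: step_simple.
have d4 : nrm (z - simple_integral mu Dc (r n)) < e / 4 by near: n.
have d5 : nrm (l - rsum s n.+1 a b f) < e / 4 by near: n.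
have := nrm_triangle z (simple_integral mu Dc (r n)) l.
have := nrm_triangle (simple_integral mu Dc (r n)) (rsum s n.+1 a b f) l.
by rewrite (nrmBC (rsum _ _ _ _ _)); lra.
Unshelve. all: by end_near. Qed.

End convergence.
End BochnerRiemann.

(** * Sums of powers and integrable majorants *)

Section Estimates.
Context {R : realType}.
Implicit Types (k n j N : nat).

(** A tangent bound for a concave power, obtained from Young's inequality with exponents 1 / q and 1
    / (1 - q). *)
Lemma powR_1sub (q y : R) : 0 < q < 1 -> 0 <= y <= 1 -> (1 - y) `^ q <= 1 - q * y.
Proof.
move=> /andP[q0 q1] /andP[y0 y1].
have q1' : 0 < 1 - q by rewrite subr_gt0.
have := @conjugate_powR R ((1 - y) `^ q) 1 q^-1 (1 - q)^-1 (powR_ge0 _ _) ler01.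
rewrite !invr_gt0 !invrK => /(_ q0 q1'); rewrite addrC subrK => /(_ erefl).
rewrite mulr1 powR1 -powRrM divff ?gt_eqF// powRr1 ?subr_ge0// => /le_trans; apply.
by lra.
Qed.

(** The right Riemann sums of the decreasing function t^(q - 1) stay below its integral: each term
    is at most an increment of the primitive t^q / q, and these telescope. *)
Lemma sum_powR (q : R) n : 0 < q < 1 ->
  \sum_(j < n) n%:R^-1 * (j.+1%:R / n%:R) `^ (q - 1) <= q^-1.
Proof.
move=> /[dup] q01 /andP[q0 q1]; have [->|n0] := posnP n; first by rewrite big_ord0 invr_ge0 ltW.
have n0R : 0 < n%:R :> R by rewrite ltr0n.
pose u j : R := q^-1 * (j%:R / n%:R) `^ q.
have H (j : 'I_n) : n%:R^-1 * (j.+1%:R / n%:R) `^ (q - 1) <= u j.+1 - u j.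
  set x : R := j.+1%:R / n%:R; have x0 : 0 < x by rewrite divr_gt0// ltr0n.
  have j0 : 0 < j.+1%:R :> R by rewrite ltr0n.
  have y01 : 0 <= (j.+1%:R^-1 : R) <= 1 by rewrite invr_ge0 ltW//= invf_le1// ler1n.
  have xy : x * j.+1%:R^-1 = n%:R^-1 by rewrite /x mulrAC divff ?mul1r// gt_eqF.
  have yE : j%:R / n%:R = x * (1 - j.+1%:R^-1).
    by rewrite mulrBr mulr1 xy /x -natr1 mulrDl mul1r addrK.
  rewrite /u -/x yE powRM ?(ltW x0)//; last by rewrite subr_ge0; case/andP: y01.
  clearbody x; have := powR_1sub q01 y01; rewrite -(mulr_powRB1 (ltW x0) q0) -xy.
  move: ((1 - _) `^ q) => Z; move: (powR_ge0 x (q - 1)); move: (x `^ (q - 1)) => P P0.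
  move: y01; move: (j.+1%:R^-1) => y /andP[y0 y1] K.
  rewrite -(@ler_pM2l _ q)// mulrBr !(mulrA q) divff ?gt_eqF// !mul1r.
  have : x * P * (q * y) <= x * P * (1 - Z) by rewrite ler_wpM2l ?mulr_ge0 ?(ltW x0)//; lra.
  by lra.
apply: (@le_trans _ _ (\sum_(j < n) (u j.+1 - u j))); first by apply: ler_sum => j _; exact: H.
rewrite -(big_mkord xpredT (fun j => u j.+1 - u j)) telescope_sumr//.
rewrite /u divff ?gt_eqF// powR1 mulr1 lerBlDr lerDl mulr_ge0 ?invr_ge0 ?(ltW q0)// powR_ge0//.
Qed.

Lemma bernoulli_le1 (x : R) N : 0 <= x <= 1 -> (1 - x) ^+ N * (1 + N%:R * x) <= 1.
Proof.
move=> /andP[x0 x1]; elim: N => [|N IH]; first by rewrite expr0 mul0r addr0 mul1r.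
apply: le_trans IH; rewrite exprS mulrC mulrA mulrC ler_wpM2l ?exprn_ge0 ?subr_ge0//.
have : 0 <= N%:R * x * x by rewrite !mulr_ge0.
rewrite -natr1; have := sqr_ge0 x; nra.
Qed.

Lemma inv_le_powR (u q : R) : 0 < u -> 0 <= q <= 1 -> (1 + u)^-1 <= u `^ (- q).
Proof.
move=> u0 /andP[q0 q1]; rewrite powRN lef_pV2 ?posrE ?powR_gt0 ?addr_gt0//.
have [u1|u1] := leP u 1.
  have := ge0_ler_powR q0 (_ : u \in Num.nneg) (_ : 1 \in Num.nneg) u1.
  by rewrite !nnegrE ler01 (ltW u0) powR1 => /(_ isT isT); lra.
have := @ler_powR R u (ltW u1) q 1 q1.
by rewrite powRr1 ?(ltW u0)//; lra.
Qed.

(** The source of the bound on (k + 1) times the integral of |z|^k: along a tangent from 1 one has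
    |z| <= 1 - d t. The terms are dominated by increments of the primitive (1 - d t)^(k + 1) / d,
    which telescope. *)
Lemma sum_geom_line (d : R) n k : 0 < d <= 1 ->
  \sum_(j < n) n%:R^-1 * (k.+1%:R * (1 - d * (j.+1%:R / n%:R)) ^+ k) <= d^-1.
Proof.
move=> /andP[d0 d1]; have [->|n0] := posnP n; first by rewrite big_ord0 invr_ge0 ltW.
have n0R : 0 < n%:R :> R by rewrite ltr0n.
pose u j : R := 1 - d * (j%:R / n%:R).
have u0 j : (j <= n)%N -> 0 <= u j.
  move=> jn; rewrite subr_ge0 (le_trans _ d1)// ler_piMr ?(ltW d0)//.
  by rewrite ler_pdivrMr// mul1r ler_nat.
have uS j : u j - u j.+1 = d / n%:R.
  by rewrite /u -(natr1 j) [(_ + 1) / _]mulrDl mul1r mulrDr; ring.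
have H (j : 'I_n) : n%:R^-1 * (k.+1%:R * u j.+1 ^+ k) <= d^-1 * u j ^+ k.+1 - d^-1 * u j.+1 ^+ k.+1.
  rewrite -mulrBr ler_pdivlMl// subrXX uS (mulrA d) ler_wpM2l ?divr_ge0 ?(ltW d0)//.
  rewrite mulr_natl -[k.+1 in X in X <= _]card_ord -sumr_const; apply: ler_sum => i _.
  rewrite -[in leLHS](@subnK i k); last by rewrite -ltnS.
  rewrite exprD ler_wpM2r ?exprn_ge0 ?u0//.
  rewrite /=; apply: lerXn2r; rewrite ?nnegrE ?u0// ?(ltnW (ltn_ord j))//.
  by rewrite -subr_ge0 uS divr_ge0// ltW.
apply: (@le_trans _ _ (\sum_(j < n) (d^-1 * u j ^+ k.+1 - d^-1 * u j.+1 ^+ k.+1))).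
  by apply: ler_sum => j _; exact: H.
rewrite -(big_mkord xpredT (fun j => d^-1 * u j ^+ k.+1 - d^-1 * u j.+1 ^+ k.+1)).
under eq_bigr do rewrite -opprB.
rewrite sumrN telescope_sumr// opprB.
rewrite /u mul0r mulr0 subr0 expr1n mulr1 lerBlDr lerDl mulr_ge0 ?invr_ge0 ?(ltW d0)//.
by rewrite exprn_ge0// (u0 n).
Qed.

(** The k + 1 terms of the geometric sum are all at least q ^+ k. This plays the part of
    [sum_geom_line] on the arc. *)
Lemma geom_term (q : R) k : 0 <= q < 1 -> k.+1%:R * q ^+ k <= (1 - q)^-1.
Proof.
move=> /andP[q0 q1]; have q1' : 0 < 1 - q by rewrite subr_gt0.
rewrite -[leRHS]mul1r ler_pdivlMr//.
apply: (@le_trans _ _ ((1 - q) * \sum_(i < k.+1) q ^+ i)).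
  rewrite mulrC ler_wpM2l ?(ltW q1')// mulr_natl -[k.+1 in X in X <= _]card_ord -sumr_const.
  by apply: ler_sum => i _; rewrite ler_wiXn2l ?(ltW q1)// -ltnS.
have := subrXX q 1 k.+1; rewrite expr1n => H.
have -> : (1 - q) * \sum_(i < k.+1) q ^+ i = 1 - q ^+ k.+1.
  rewrite -opprB -[RHS]opprB H mulNr; congr (- (_ * _)).
  rewrite (reindex_inj rev_ord_inj) /=; apply: eq_bigr => i _.
  by rewrite expr1n mulr1 /=.
by rewrite lerBlDr lerDl exprn_ge0.
Qed.

End Estimates.

Section Integrable.
Context {R : realType}.
Local Notation mu := (@lebesgue_measure R : {measure set (measurableTypeR R) -> \bar R}).

(** Fatou's lemma along the step functions: bounded Riemann sums of a nonnegative continuous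
    function bound its integral, even if it blows up at an end point. *)
Lemma integrable_rsum (a b B : R) (G : R -> R) (s : nat) : a < b -> (s <= 1)%N ->
  (forall t, 0 <= G t) -> (forall t, a < t < b -> G t' @[t' --> t] --> G t) ->
  (forall n, \sum_(j < n) (b - a) / n%:R * G (grid a b n (j + s)) <= B) ->
  mu.-integrable `]a, b[%classic (EFin \o G).
Proof.
move=> ab s1 G0 Gc GB.
have mDo : measurable (`]a, b[%classic : set (measurableTypeR R)) by exact: measurable_itv.
have mG : measurable_fun (`]a, b[%classic : set (measurableTypeR R)) G.
  apply: open_continuous_measurable_fun => [|t]; first exact: interval_open.
  by move=> /set_mem; rewrite /= in_itv /=; exact: Gc.
have mEG : measurable_fun (`]a, b[%classic : set (measurableTypeR R)) (EFin \o G).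
  exact/measurable_EFinP.
apply/integrableP; split => //.
have E : (\int[mu]_(x in `]a, b[) `|(EFin \o G) x| = \int[mu]_(x in `]a, b[) (G x)%:E)%E.
  by apply: eq_integral => t _ /=; rewrite ger0_norm.
rewrite [ltLHS]E; apply: (@le_lt_trans _ _ B%:E); last exact: ltry.
pose f t : R[i]^o := (G t)%:C.
have fc t : a < t < b -> f t' @[t' --> t] --> f t.
  move=> tab; apply/cvg_nrmP => e e0; have /cvgrPdist_lt /(_ e e0) := Gc t tab.
  by apply: filterS => t'; rewrite /f -rmorphB nrm_real.
pose h n t : \bar R := (nrm (step s n.+1 a b f t))%:E.
have hn n : simple_function (step s n.+1 a b f : measurableTypeR R -> _) by exact: step_simple.
have mh n : measurable_fun (`]a, b[%classic : set (measurableTypeR R)) (h n).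
  apply/measurable_EFinP; apply: measurable_funTS.
  exact: (simple_measurable2 (fun v _ => nrm v) (hn n) (hn n)).
have h0 n t : (`]a, b[%classic : set (measurableTypeR R)) t -> (0 <= h n t)%E.
  by move=> _; rewrite lee_fin nrm_ge0.
have hB n : (\int[mu]_(t in `]a, b[) h n t <= B%:E)%E.
  apply: (@le_trans _ _ (\int[mu]_(t in `[a, b]) h n t)%E).
    apply: ge0_subset_integral => //.
    - apply/measurable_EFinP; apply: measurable_funTS.
      exact: (simple_measurable2 (fun v _ => nrm v) (hn n) (hn n)).
    - by move=> t _; rewrite lee_fin nrm_ge0.
    - by move=> t /=; rewrite !in_itv /= => /andP[t1 t2]; rewrite !ltW.
  rewrite integral_nrm_step// lee_fin (le_trans _ (GB n.+1))//.
  by apply: ler_sum => j _; rewrite /f nrm_real ger0_norm.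
have lim t : a < t < b -> limn_einf (h ^~ t) = (G t)%:E.
  move=> tab; apply: (cvg_limn_einf_sup _).1.
  apply: cvg_EFin; first exact: nearW.
  have -> : G t = nrm (f t) by rewrite /f nrm_real ger0_norm.
  by apply: cvg_nrm; exact: step_cvg.
have E' : (\int[mu]_(x in `]a, b[) (G x)%:E = \int[mu]_(x in `]a, b[) limn_einf (h ^~ x))%E.
  by apply: eq_integral => t /set_mem; rewrite /= in_itv /= => tab; rewrite lim.
rewrite E'; apply: le_trans (fatou mu mDo mh h0) _.
rewrite limn_einf_lim; apply: lime_le; first exact: is_cvg_einfs.
apply: nearW => n; apply: le_trans (hB n).
by apply: ereal_inf_lbound; exists n => //=; exact: leqnn.
Qed.

End Integrable.

Section PowerIntegrable.
Context {R : realType}.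
Local Notation mu := (@lebesgue_measure R : {measure set (measurableTypeR R) -> \bar R}).

Lemma powR_continuous (q t : R) : 0 < t -> t' `^ q @[t' --> t] --> t `^ q.
Proof.
move=> t0; have : derivable ((@powR R) ^~ q) t 1 by apply: derivable_powR; rewrite in_itv /= t0.
by move=> /derivable1_diffP /differentiable_continuous.
Qed.

Lemma grid01 n j : grid (0 : R) 1 n j = j%:R / n%:R.
Proof. by rewrite /grid add0r subr0 mul1r. Qed.

Lemma integrable_powR (A q : R) : 0 <= A -> 0 < q < 1 ->
  mu.-integrable `]0, 1[%classic (EFin \o (fun t => A * t `^ (q - 1))).
Proof.
move=> A0 q01; apply: (@integrable_rsum _ _ _ (A * q^-1) _ 1) => //.
- by move=> t; rewrite mulr_ge0// powR_ge0.
- by move=> t /andP[t0 _]; apply: cvgMr; exact: powR_continuous.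
- move=> n; apply: le_trans (ler_wpM2l A0 (sum_powR n q01)).
  rewrite mulr_sumr; apply: ler_sum => j _.
  by rewrite grid01 addn1 subr0 mul1r mulrCA.
Qed.

Lemma integrable_powR_onem (A q : R) : 0 <= A -> 0 < q < 1 ->
  mu.-integrable `]0, 1[%classic (EFin \o (fun t => A * (1 - t) `^ (q - 1))).
Proof.
move=> A0 q01; apply: (@integrable_rsum _ _ _ (A * q^-1) _ 0) => //.
- by move=> t; rewrite mulr_ge0// powR_ge0.
- move=> t /andP[_ t1]; apply: cvgMr.
  apply: (@continuous_comp _ _ _ (fun t : R => 1 - t) (fun t => t `^ (q - 1))).
    by apply: cvgB; [exact: cvg_cst|exact: cvg_id].
  by apply: powR_continuous; rewrite subr_gt0.
- move=> n; apply: le_trans (ler_wpM2l A0 (sum_powR n q01)).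
  rewrite mulr_sumr (reindex_inj rev_ord_inj) /=; apply: ler_sum => j _.
  rewrite grid01 addn0 subr0 mul1r mulrCA ler_wpM2l// ler_wpM2l ?invr_ge0//.
  rewrite le_eqVlt; apply/orP; left; apply/eqP; congr (_ `^ _).
  rewrite natrB ?ltn_ord// mulrBl divff ?pnatr_eq0 -?lt0n ?(leq_ltn_trans _ (ltn_ord j))//.
  by rewrite opprB addrCA subrr addr0.
Qed.

End PowerIntegrable.

(** * Completeness of the algebra of bounded operators *)

Section Completeness.
Context {R : realType}.

Definition nrm_cauchy {Y : normedModType R[i]} (u : nat -> Y) :=
  forall e : R, 0 < e -> exists N, forall m n, (N <= m)%N -> (N <= n)%N -> nrm (u m - u n) <= e.

Lemma nrm_complete (X : completeNormedModType R[i]) (u : nat -> X) :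
  nrm_cauchy u -> exists l : X, u @ \oo --> l.
Proof.
move=> cu; exists (lim (u @ \oo)); apply: cauchy_cvg; apply: cauchy_exP => -[e e'].
rewrite ltcE /= => /andP[/eqP -> e0].
have [N HN] := cu (e / 2) (divr_gt0 e0 (ltr0Sn _ 1)).
exists (u N); exists N => // n /= Nn.
rewrite -ball_normE /= -nrmE ltcR (le_lt_trans (HN _ _ _ _))//.
by rewrite ltr_pdivrMr// mulr_natr mulr2n ltrDr.
Qed.

Lemma bop_complete (X : completeNormedModType R[i]) (u : nat -> bop X X) :
  nrm_cauchy u -> exists l : bop X X, u @ \oo --> l.
Proof.
move=> cu.
have cux x : nrm_cauchy (fun n => u n x).
  move=> e e0; have nx0 : 0 < nrm x + 1 by rewrite ltr_wpDl ?nrm_ge0.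
  have [N HN] := cu (e / (nrm x + 1)) (divr_gt0 e0 nx0).
  exists N => m n Nm Nn; have := opnorm_le (u m - u n) x.
  rewrite -nrm_bop => /le_trans; apply.
  apply: (@le_trans _ _ (e / (nrm x + 1) * (nrm x + 1))); last by rewrite divfK ?gt_eqF.
  by rewrite ler_pM ?nrm_ge0 ?HN// lerDl.
have /choice[l Hl] : forall x, exists l : X, u n x @[n --> \oo] --> l.
  by move=> x; exact: nrm_complete.
have lin : linear l.
  move=> a x y; have H : u n (a *: x + y) @[n --> \oo] --> a *: l x + l y.
    under eq_fun do rewrite linearP; apply: cvgD (Hl y); apply: cvgZr; exact: Hl.
  exact: (cvg_unique _ (Hl _) H).
have [N1 HN1] := cu 1 ltr01.
have bd (e : R) N : (forall m n, (N <= m)%N -> (N <= n)%N -> nrm (u m - u n) <= e) ->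
    forall n x, (N <= n)%N -> nrm (l x - u n x) <= e * nrm x.
  move=> HN n x Nn.
  have H : nrm (u m x - u n x) @[m --> \oo] --> nrm (l x - u n x).
    by apply: cvg_nrm; apply: cvgB; [exact: Hl|exact: cvg_cst].
  rewrite -(cvg_lim _ H)//; apply: limr_le; first by apply/cvg_ex; exists (nrm (l x - u n x)).
  exists N => // m /= Nm; have := opnorm_le (u m - u n) x; rewrite -nrm_bop => /le_trans; apply.
  by rewrite ler_wpM2r ?nrm_ge0// HN.
have lb : l \in bounded_linear X X.
  apply/asboolP; split=> //; exists (1 + opnorm (u N1)) => x.
  rewrite -(subrK (u N1 x) (l x)) (le_trans (nrmD _ _))// mulrDl lerD//.
    exact: bd HN1 _ _ _.
  exact: opnorm_le.
exists (Bop lb); apply/cvg_nrmP => e e0.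
have [N HN] := cu (e / 2) (divr_gt0 e0 (ltr0Sn _ 1)).
exists N => // n /= Nn; rewrite nrm_bop; apply: (@le_lt_trans _ _ (e / 2)).
  apply: opnorm_lub => x x1; rewrite (le_trans (bd _ _ HN n x Nn))//.
  by rewrite ler_piMr// divr_ge0// ltW.
by rewrite ltr_pdivrMr// mulr_natr mulr2n ltrDr.
Qed.

End Completeness.

Lemma nbhs_nrm {R : realType} (V : normedModType R[i]) (z : V) (e : R) : 0 < e ->
  nbhs z [set w | nrm (w - z) < e].
Proof.
move=> e0; apply/nbhs_normP; exists e%:C; rewrite /= ?ltcR// => w /=.
by rewrite -nrmE ltcR nrmBC.
Qed.

(** * Separating contours from smaller Stolz domains by half-planes *)

Section StolzGeometry.
Context {R : realType}.
Local Notation C := R[i]^o.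
Implicit Types (z w : C).

(* The linear functional whose level sets are orthogonal to the direction phi. *)
Definition hp (phi : R) z : R := cos phi * complex.Re z + sin phi * complex.Im z.

Lemma hpE phi z : hp phi z = complex.Re (cis (- phi) * z).
Proof. by case: z => a b; rewrite /hp /cis /= cosN sinN; ring. Qed.

Lemma hp_nrm phi z : hp phi z <= nrm z.
Proof.
rewrite hpE (le_trans (ler_norm _))// (le_trans (Re_nrm _))//.
by rewrite nrmM nrm_cis mul1r.
Qed.

Lemma hpB phi z w : hp phi (z - w) = hp phi z - hp phi w.
Proof. by case: z w => [a b] [c d]; rewrite /hp /=; ring. Qed.

Lemma hp_cis phi psi (r : R) : hp phi (om r psi) = r * cos (psi - phi).
Proof. by rewrite /hp /om /cis /= cosB; ring. Qed.

(** The condition on [phi] says that the half-plane contains 1; it contains the disc in any case,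
    hence the closed hull. Used in contrapositive form to show that contours lie outside the smaller
    domain. *)
Lemma closure_stolz_hp (b phi : R) : cos phi <= sin b ->
  closure (stolz b) `<=` [set z | hp phi z <= sin b].
Proof.
move=> cs; have hull z : stolz b z -> hp phi z <= sin b.
  move=> /interior_subset /(_ [set z | hp phi z <= sin b]); apply; split; last first.
    move=> w [->|/ltW wb]; last exact: le_trans (hp_nrm _ _) wb.
    by rewrite /= /hp /= mulr1 mulr0 addr0.
  apply/convex_setW => x y /set_mem /= xb /set_mem /= yb k k0 k1; rewrite inE /=.
  change (hp phi ((k%:num : R[i]) * (x : C) + (1 - (k%:num : R[i])) * (y : C)) <= sin b).
  move: (k%:num : R[i]) k0 k1 => [t t']; rewrite !ltcE /= => /andP[/eqP -> t0] /andP[_ t1].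
  move: (x : C) (y : C) xb yb => [a c] [e d] xb yb.
  rewrite (_ : hp _ _ = t * hp phi (a +i* c) + (1 - t) * hp phi (e +i* d)); first by nra.
  by rewrite /hp /=; ring.
move=> z zc /=; rewrite leNgt; apply/negP => bz.
have e0 : 0 < hp phi z - sin b by rewrite subr_gt0.
have [w [/hull wb wz]] := zc _ (nbhs_nrm z e0).
have := hp_nrm phi (z - w); rewrite hpB nrmBC.
by move: wz => /=; lra.
Qed.

(** The strict inequality leaves a ball of radius (sin g - r) t around z, each point of which is a
    combination of 1 and of a point [v] of the open disc. *)
Lemma drop_stolz (r g : R) : 0 <= r < sin g -> drop_set r `<=` stolz g.
Proof.
move=> /andP[r0 rg] z [t /andP[t0 t1] zt].
have e0 : 0 < (sin g - r) * t by rewrite mulr_gt0// subr_gt0.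
apply: filterS (nbhs_nrm z e0) => w /= wz A [cA sA].
have A1 : A 1 by apply: sA; left.
have wd : nrm (w - (1 - t)%:C : C) < sin g * t.
  by have := nrm_triangle w z ((1 - t)%:C : C); lra.
pose v : C := t^-1%:C * (w - (1 - t)%:C).
have Av : A v.
  apply: sA; right; rewrite /= /v nrmM nrm_real gtr0_norm ?invr_gt0//.
  by rewrite mulrC ltr_pdivrMr.
have wE : w = t%:C * v + (1 - t%:C) * 1.
  rewrite /v mulrA -rmorphM /= divff ?gt_eqF// mul1r mulr1 rmorphB /= rmorph1; ring.
have tC0 : 0 <= t%:C :> R[i] by rewrite lecR ltW.
have tC1 : t%:C <= 1 :> R[i] by rewrite lecR.
have := cA v 1 (Itv01 tC0 tC1) (mem_set Av) (mem_set A1); rewrite inE.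
by rewrite wE.
Qed.

Lemma sin_cos_diff (b0 b : R) : sin b * cos (b - b0) - sin b0 = cos b * sin (b - b0).
Proof.
have -> : sin b0 = sin (b - (b - b0)) by rewrite opprB addrCA subrr addr0.
by rewrite (sinB b (b - b0)); ring.
Qed.

Lemma sin_lt_cos_diff (b0 b : R) : 0 < b0 -> b0 < b -> b < pi / 2 ->
  sin b0 < sin b * cos (b - b0).
Proof.
move=> b00 b0b bpi; rewrite -subr_gt0 sin_cos_diff mulr_gt0//.
  by apply: cos_gt0_pihalf; apply/andP; split; lra.
by apply: sin_gt0_pi; apply/andP; split; have := pi_gt0 R; lra.
Qed.

(** The half-plane is bounded by the tangent from 1 to the inner circle. Its functional is sin b0 at
    1 and the larger sin b cos (b - b0) at the outer tangency point, so it increases along the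
    line. *)
Lemma line_out (b0 b t psi phi : R) : 0 < b0 -> b0 < b -> b < pi / 2 -> 0 < t ->
  cos phi = sin b0 -> cos (psi - phi) = cos (b - b0) ->
  ~ closure (stolz b0) (line 1 (om (sin b) psi) t).
Proof.
move=> b00 b0b bpi t0 cphi cpsi /(closure_stolz_hp (phi := phi)).
rewrite cphi lexx => /(_ isT) /=; rewrite leNgt => /negP; apply.
rewrite (_ : hp _ _ = hp phi 1 + t * (hp phi (om (sin b) psi) - hp phi 1)); last first.
  by rewrite /line /hp; case: (om _ _) => [u v] /=; ring.
rewrite hp_cis cpsi (_ : hp phi 1 = sin b0); last by rewrite /hp /= cphi mulr1 mulr0 addr0.
by rewrite ltrDl mulr_gt0// subr_gt0 sin_lt_cos_diff.
Qed.

Lemma om_out (b0 b psi : R) : 0 < b0 -> b0 < b -> b < pi / 2 ->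
  pi / 2 - b <= psi <= 2 * pi - (pi / 2 - b) ->
  ~ closure (stolz b0) (om (sin b) psi).
Proof.
move=> b00 b0b bpi /andP[psi1 psi2].
have p0 := pi_gt0 R.
have sb0 : 0 < sin b by apply: sin_gt0_pi; apply/andP; split; lra.
(* Near the two ends of the arc the separating direction is that of the inner tangent; in between it
   is [psi] itself. *)
have [phi [cphi cpsi]] : exists phi, cos phi <= sin b0 /\ cos (b - b0) <= cos (psi - phi).
  have sE : sin b0 = cos (pi / 2 - b0) by rewrite cosB cos_pihalf sin_pihalf; ring.
  have [l|l] := ltP psi (pi / 2 - b0).
    exists (pi / 2 - b0); rewrite sE lexx; split => //.
    rewrite -(cosN (psi - _)) leNgt; apply/negP; rewrite ltr_cos ?in_itv /=; [|apply/andP; split..]; lra.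
  have [u|u] := ltP (2 * pi - (pi / 2 - b0)) psi.
    exists (2 * pi - (pi / 2 - b0)); rewrite sE; split.
      by rewrite addrC cosD mulr_natl cos2pi sin2pi mulr1 mulr0 subr0 cosN.
    rewrite leNgt; apply/negP; rewrite ltr_cos ?in_itv /=; [|apply/andP; split..]; lra.
  exists psi; rewrite subrr cos0; split; last exact: cos_le1.
  have [m|m] := leP psi pi.
    rewrite sE leNgt; apply/negP; rewrite ltr_cos ?in_itv /=; [|apply/andP; split..]; lra.
  have -> : cos psi = cos (2 * pi - psi).
    by rewrite cosB mulr_natl cos2pi sin2pi; ring.
  rewrite sE leNgt; apply/negP; rewrite ltr_cos ?in_itv /=; [|apply/andP; split..]; lra.
move=> /(closure_stolz_hp cphi) /=; rewrite hp_cis leNgt => /negP; apply.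
apply: lt_le_trans (sin_lt_cos_diff b00 b0b bpi) _.
by rewrite ler_wpM2l// ltW.
Qed.

Lemma stolz_mono (a b : R) : sin a <= sin b -> stolz a `<=` stolz b.
Proof.
move=> ab; apply: interiorS => z Hz A [cA sA]; apply: Hz; split => //.
by move=> w [->|wa]; apply: sA; [left|right; exact: lt_le_trans wa ab].
Qed.

End StolzGeometry.

(** * Resolvents and contour sums *)

Section OperatorAlgebra.
Context {R : realType} {X : normedModType R[i]}.
Implicit Types (A B : bop X X) (a : R[i]).

Lemma bop_scaleAl a A B : (a *: A) * B = a *: (A * B).
Proof. exact: bopP. Qed.

Lemma bop_scaleAr a A B : A * (a *: B) = a *: (A * B).
Proof. by apply: bopP => x; apply: linearZ. Qed.

Lemma nrm_bopM A B : nrm (A * B) <= nrm A * nrm B.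
Proof.
rewrite !nrm_bop; apply: opnorm_lub => x x1.
apply: (@le_trans _ _ (opnorm A * nrm (B x))); first exact: (opnorm_le A (B x)).
by rewrite ler_wpM2l ?opnorm_ge0// opnorm_ub.
Qed.

End OperatorAlgebra.

Section Resolvent.
Context {R : realType} {X : normedModType R[i]} (T : bop X X) (U : set R[i]^o).
Local Notation C := R[i]^o.
Local Notation Rs z := (resolvent z T).
Hypothesis specU : spectrum T `<=` ~` U.

Lemma resolventP (z : C) : U z ->
  Rs z * (z *: (1 : bop X X) - T) = 1 /\ (z *: (1 : bop X X) - T) * Rs z = 1.
Proof.
move=> Uz; rewrite /resolvent; case: xgetP => [S _ //|nS].
by exfalso; apply: (specU _ Uz); apply/seteqP; split => // S /nS.
Qed.

Lemma mul_T_resolvent (z : C) : U z -> T * Rs z = z *: Rs z - 1.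
Proof.
move=> /resolventP[_]; rewrite mulrBl bop_scaleAl mul1r => <-.
by rewrite opprB addrC subrK.
Qed.

Lemma mul_resolvent_T (z : C) : U z -> Rs z * T = z *: Rs z - 1.
Proof.
move=> /resolventP[+ _]; rewrite mulrBr bop_scaleAr mulr1 => <-.
by rewrite opprB addrC subrK.
Qed.

Lemma resolventB (z w : C) : U z -> U w -> Rs z - Rs w = (w - z) *: (Rs z * Rs w).
Proof.
move=> Uz Uw; have [Rz _] := resolventP Uz; have [_ Rw] := resolventP Uw.
have -> : Rs z - Rs w = Rs z * ((w *: (1 : bop X X) - T) - (z *: (1 : bop X X) - T)) * Rs w.
  by rewrite mulrBr mulrBl Rz mul1r -mulrA Rw mulr1.
by rewrite opprB addrA subrK -scalerBl bop_scaleAr mulr1 bop_scaleAl.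
Qed.

Variable CR : R.
Hypothesis CR0 : 0 <= CR.
Hypothesis RsB : forall z : C, U z -> nrm ((z - 1) *: Rs z) <= CR.

Lemma nrm_resolvent (z : C) : U z -> z != 1 -> nrm (Rs z) <= CR / nrm (z - 1).
Proof.
move=> Uz z1; have nz : 0 < nrm (z - 1) by exact: nrmB_gt0.
by rewrite ler_pdivlMr// mulrC -nrmZ RsB.
Qed.

Lemma resolvent_cvg (lam : R -> C) (t : R) : U (lam t) -> lam t != 1 ->
  lam t' @[t' --> t] --> lam t -> (\forall t' \near t, U (lam t')) ->
  Rs (lam t') @[t' --> t] --> Rs (lam t).
Proof.
move=> Ut t1 ct nU; set z := lam t.
have nz : 0 < nrm (z - 1) by exact: nrmB_gt0.
pose m := nrm (z - 1) / 2; have m0 : 0 < m by rewrite divr_gt0.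
pose K := CR / m * (CR / m); have K0 : 0 <= K by rewrite mulr_ge0// divr_ge0// ltW.
have /cvg_nrmP Hc := ct.
apply/cvg_nrmP => e e0.
have e'0 : 0 < Num.min m (e / (K + 1)) by rewrite lt_min m0 divr_gt0// ltr_wpDl.
near=> t'.
have Ut' : U (lam t') by near: t'.
have : nrm (z - lam t') < Num.min m (e / (K + 1)) by near: t'; exact: Hc.
rewrite lt_min => /andP[d1 d2].
have mt' : m <= nrm (lam t' - 1).
  have := nrm_triangle z (lam t') 1; rewrite /m in d1 *; lra.
have t'1 : lam t' != 1.
  by apply/eqP => E; move: mt'; rewrite E subrr nrm0 leNgt m0.
rewrite resolventB// nrmZ (nrmBC (lam t')).
apply: (@le_lt_trans _ _ (nrm (z - lam t') * K)).
  rewrite ler_wpM2l ?nrm_ge0// (le_trans (nrm_bopM _ _))// ler_pM ?nrm_ge0//.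
    rewrite (le_trans (nrm_resolvent Ut t1))// ler_wpM2l// lef_pV2 ?posrE// -/z /m.
    by rewrite ler_pdivrMr// ler_peMr ?nrm_ge0// ler1n.
  rewrite (le_trans (nrm_resolvent Ut' t'1))// ler_wpM2l// lef_pV2 ?posrE//.
  exact: lt_le_trans mt'.
move: d2; rewrite ltr_pdivlMr ?ltr_wpDl// mulrDr mulr1.
by have := nrm_ge0 (z - lam t'); lra.
Unshelve. all: by end_near. Qed.

(** Operator-valued polynomials in z, given by closure rules; vanishing moments of phi are passed
    through them by induction in [contour_opoly]. *)
Inductive opoly : (C -> bop X X) -> Prop :=
| opoly_const B : opoly (fun=> B)
| opoly_X H : opoly H -> opoly (fun z => z *: H z)
| opoly_add H K : opoly H -> opoly K -> opoly (fun z => H z + K z).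

(** Scalar polynomials, encoded as multipliers of [opoly], so that products and sums come at
    once. *)
Definition spoly (a : C -> C) := forall H, opoly H -> opoly (fun z => a z *: H z).

Lemma opoly_mull A H : opoly H -> opoly (fun z => A * H z).
Proof.
elim=> [B|{}H _ IH|{}H K _ IH1 _ IH2]; first exact: opoly_const.
- rewrite (_ : (fun _ => _) = (fun z => z *: (A * H z))); first exact: opoly_X.
  by apply/funext => z; rewrite bop_scaleAr.
- rewrite (_ : (fun _ => _) = (fun z => A * H z + A * K z)); first exact: opoly_add.
  by apply/funext => z; rewrite mulrDr.
Qed.

Lemma opoly_mulr A H : opoly H -> opoly (fun z => H z * A).
Proof.
elim=> [B|{}H _ IH|{}H K _ IH1 _ IH2]; first exact: opoly_const.
- rewrite (_ : (fun _ => _) = (fun z => z *: (H z * A))); first exact: opoly_X.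
  by apply/funext => z; rewrite bop_scaleAl.
- rewrite (_ : (fun _ => _) = (fun z => H z * A + K z * A)); first exact: opoly_add.
  by apply/funext => z; rewrite mulrDl.
Qed.

Lemma spolyM a b : spoly a -> spoly b -> spoly (fun z => a z * b z).
Proof.
move=> sa sb H oH; rewrite (_ : (fun _ => _) = (fun z => a z *: (b z *: H z))).
  by apply: sa; exact: sb.
by apply/funext => z; rewrite scalerA.
Qed.

Lemma spolyD a b : spoly a -> spoly b -> spoly (fun z => a z + b z).
Proof.
move=> sa sb H oH; rewrite (_ : (fun _ => _) = (fun z => a z *: H z + b z *: H z)).
  by apply: opoly_add; [exact: sa|exact: sb].
by apply/funext => z; rewrite scalerDl.
Qed.

Lemma spolyX : spoly id.
Proof. by move=> H; exact: opoly_X. Qed.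

Lemma spolyC (c : C) : spoly (fun=> c).
Proof.
move=> H; elim=> [B|{}H _ IH|{}H K _ IH1 _ IH2].
- exact: (opoly_const (c *: B)).
- rewrite (_ : (fun _ => _) = (fun z => z *: (c *: H z))); first exact: opoly_X.
  by apply/funext => z; rewrite !scalerA mulrC.
- rewrite (_ : (fun _ => _) = (fun z => c *: H z + c *: K z)); first exact: opoly_add.
  by apply/funext => z; rewrite scalerDr.
Qed.

Lemma spolyXn k : spoly (fun z => z ^+ k).
Proof.
elim: k => [|k IH]; first exact: (spolyC 1).
rewrite (_ : (fun _ => _) = (fun z : C => z * z ^+ k)).
  exact: spolyM spolyX IH.
by apply/funext => z; rewrite exprS.
Qed.

Lemma spoly1B : spoly (fun z => 1 - z).
Proof.
rewrite (_ : (fun _ => _) = (fun z : C => 1 + (-1) * z)).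
  by apply: spolyD; [exact: spolyC|apply: spolyM; [exact: spolyC|exact: spolyX]].
by apply/funext => z; rewrite mulN1r.
Qed.

(* G z is a z *: R(z, T) up to a polynomial. Multiplying G by T multiplies the
   symbol a by z, as T R(z, T) = z R(z, T) - 1. *)
Definition symb (a : C -> C) (G : C -> bop X X) := spoly a /\
  exists2 E, opoly E & forall z, U z -> G z = a z *: Rs z + E z.

Lemma symb_mulTl a G : symb a G -> symb (fun z => z * a z) (fun z => T * G z).
Proof.
move=> [sa [E oE HE]]; split; first exact: spolyM spolyX sa.
exists (fun z => a z *: (- 1 : bop X X) + (T * E z : bop X X)).
  apply: opoly_add; last exact: (opoly_mull T oE).
  by apply: sa; exact: opoly_const.
move=> z Uz; rewrite HE// mulrDr bop_scaleAr mul_T_resolvent// scalerBr scalerA.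
by rewrite -addrA scalerN (mulrC (a z)).
Qed.

Lemma symb_mulTr a G : symb a G -> symb (fun z => z * a z) (fun z => G z * T).
Proof.
move=> [sa [E oE HE]]; split; first exact: spolyM spolyX sa.
exists (fun z => a z *: (- 1 : bop X X) + (E z * T : bop X X)).
  apply: opoly_add; last exact: (opoly_mulr T oE).
  by apply: sa; exact: opoly_const.
move=> z Uz; rewrite HE// mulrDl bop_scaleAl mul_resolvent_T// scalerBr scalerA.
by rewrite -addrA scalerN (mulrC (a z)).
Qed.

Lemma symb_sub a b G H : symb a G -> symb b H -> symb (fun z => a z - b z) (fun z => G z - H z).
Proof.
have E1 (f : C -> C) : (fun z => - f z) = (fun z => (-1) * f z).
  by apply/funext => z; rewrite mulN1r.
move=> [sa [E oE HE]] [sb [F oF HF]]; split.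
  by apply: spolyD => //; rewrite E1; apply: spolyM => //; exact: spolyC.
exists (fun z => E z + (-1) *: F z).
  by apply: opoly_add => //; exact: (spolyC (-1)).
by move=> z Uz; rewrite HE// HF// scaleN1r scalerBl opprD addrACA.
Qed.

Lemma eq_symb a b G H : symb a G -> a =1 b -> G =1 H -> symb b H.
Proof. by move=> + /funext <- /funext <-. Qed.

Lemma symb_left k a G : symb a G ->
  symb (fun z => (1 - z) * (z ^+ k * a z)) (fun z => (1 - T) * T ^+ k * G z).
Proof.
move=> sG.
have H : symb (fun z => z ^+ k * a z) (fun z => T ^+ k * G z).
  elim: k => [|k IH]; first by apply: (eq_symb sG) => z; rewrite expr0 mul1r.
  by apply: (eq_symb (symb_mulTl IH)) => z; rewrite exprS mulrA.
apply: (eq_symb (symb_sub H (symb_mulTl H))) => z; first by rewrite mulrBl mul1r.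
by rewrite -mulrA mulrBl mul1r.
Qed.

Lemma symb_right k a G : symb a G ->
  symb (fun z => (1 - z) * (z ^+ k * a z)) (fun z => G z * (T ^+ k * (1 - T))).
Proof.
move=> sG.
have H : symb (fun z => z ^+ k * a z) (fun z => G z * T ^+ k).
  elim: k => [|k IH]; first by apply: (eq_symb sG) => z; rewrite expr0 ?mul1r ?mulr1.
  apply: (eq_symb (symb_mulTr IH)) => z; first by rewrite exprS mulrA.
  by rewrite exprSr mulrA.
apply: (eq_symb (symb_sub H (symb_mulTr H))) => z; first by rewrite mulrBl mul1r.
by rewrite !mulrBr !mulr1 mulrA.
Qed.

End Resolvent.

Section LsumLinear.
Context {R : realType} {Y : normedModType R[i]}.
Local Notation C := R[i]^o.
Implicit Types (F G : C -> Y) (r th : R).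

Lemma LsumD r th n F G : Lsum r th n (fun z => F z + G z) = Lsum r th n F + Lsum r th n G.
Proof.
have H w p : psum n w p (fun z => F z + G z) = psum n w p F + psum n w p G.
  by rewrite /psum -big_split; apply: eq_bigr => j _; rewrite scalerDr.
by rewrite /Lsum !H (addrACA (psum _ _ _ F)) (addrACA (psum _ _ _ F + _)).
Qed.

Lemma LsumZ r th n (c : C) F : Lsum r th n (fun z => c *: F z) = c *: Lsum r th n F.
Proof.
have H w p : psum n w p (fun z => c *: F z) = c *: psum n w p F.
  by rewrite /psum scaler_sumr; apply: eq_bigr => j _; rewrite !scalerA mulrC.
by rewrite /Lsum !H !scalerDr.
Qed.

Lemma Lsum_scale r th n (g : C -> C) (y : Y) :
  Lsum r th n (fun z => g z *: y) = (Lsum r th n g : C) *: y.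
Proof.
have H w p : psum n w p (fun z => g z *: y) = (psum n w p g : C) *: y.
  by rewrite /psum scaler_suml; apply: eq_bigr => j _; rewrite scalerA.
by rewrite /Lsum !H !scalerDl.
Qed.

Lemma Lsum_sum r th n (I : Type) (s : seq I) (F : I -> C -> Y) :
  Lsum r th n (fun z => \sum_(i <- s) F i z) = \sum_(i <- s) Lsum r th n (F i).
Proof.
elim: s => [|i s IH].
  rewrite big_nil -[RHS](scale0r (Lsum r th n (fun=> 0))) -LsumZ; congr Lsum.
  by apply/funext => z; rewrite big_nil scale0r.
rewrite big_cons -IH -LsumD; congr Lsum.
by apply/funext => z; rewrite big_cons.
Qed.

End LsumLinear.

Section LsumBop.
Context {R : realType} {X : normedModType R[i]}.
Local Notation C := R[i]^o.

Lemma Lsum_mull (r th : R) n (A : bop X X) (F : C -> bop X X) :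
  A * Lsum r th n F = Lsum r th n (fun z => A * F z).
Proof.
have H w p : A * psum n w p F = psum n w p (fun z => A * F z).
  by rewrite /psum mulr_sumr; apply: eq_bigr => j _; rewrite bop_scaleAr.
by rewrite /Lsum !mulrDr !H.
Qed.

Lemma Lsum_mulr (r th : R) n (A : bop X X) (F : C -> bop X X) :
  Lsum r th n F * A = Lsum r th n (fun z => F z * A).
Proof.
have H w p : psum n w p F * A = psum n w p (fun z => F z * A).
  by rewrite /psum mulr_suml; apply: eq_bigr => j _; rewrite bop_scaleAl.
by rewrite /Lsum !mulrDl !H.
Qed.

End LsumBop.

(** * Complex differentiability and decay at 1 *)

Section Holomorphic.
Context {R : realType}.
Local Notation C := R[i]^o.
Implicit Types (phi : C -> C) (z : C).

Lemma derivable_cdiff phi z : derivable phi z 1 -> cdiff phi z.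
Proof.
move=> /cvg_ex[p /cvg_nrmP Hp]; exists p => e e0.
have [d /= d0 Hd] := Hp e e0.
have d0R : 0 < complex.Re d by move: d0; rewrite ltcE /= => /andP[].
have dE : d = (complex.Re d)%:C by rewrite RRe_real// ger0_real// ltW.
exists (complex.Re d) => // w wd.
have [->|wz] := eqVneq w z; first by rewrite !subrr mulr0 subrr !nrm0 mulr0.
have wz0 : w - z != 0 by rewrite subr_eq0.
have : ball_ Num.norm (0 : C) d (w - z).
  by rewrite /ball_ /= sub0r normrN -nrmE dE ltcR.
move=> /Hd/(_ wz0).
rewrite /= [(w - z) *: 1]mulr1 subrK => H.
rewrite (_ : _ - _ = (w - z) * (- (p - (w - z)^-1 *: (phi w - phi z)))); last first.
  rewrite [_ *: _](_ : _ = (w - z)^-1 * (phi w - phi z))//.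
  have K (u v : R[i]) : u != 0 -> u * (u^-1 * v) = v by move=> u0; rewrite mulrA divff// mul1r.
  by rewrite opprB [RHS]mulrBr K// [p * _]mulrC.
by rewrite nrmM nrmN mulrC ler_wpM2r ?nrm_ge0// ltW.
Qed.

Lemma derivable_cvg phi z : derivable phi z 1 -> phi w @[w --> z] --> phi z.
Proof. by move=> /derivable1_diffP/differentiable_continuous. Qed.

Lemma cvg_scale (Y : normedModType R[i]) (c : C) (f : R -> Y) (t : R) (l : Y) :
  f t' @[t' --> t] --> l -> c *: f t' @[t' --> t] --> c *: l.
Proof. by move=> H; exact: cvgZl_tmp. Qed.

(* Stated for an abstract V: unifying with a concrete complement of a closure diverges. *)
Lemma near_preimage (lam : R -> C) (t : R) (V : set C) : lam t' @[t' --> t] --> lam t ->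
  nbhs (lam t) V -> \forall t' \near t, V (lam t').
Proof. by move=> lamc nV; exact: lamc nV. Qed.

(** The decay exponent is lowered to min (s, 1/2), so that q - 1 lies in ]-1, 0[. At distance at
    least 1 from the point 1 the decay estimate no longer dominates and boundedness of phi takes
    over. *)
Lemma Hinfty0_powR (g : R) phi : Hinfty0 g phi -> exists q D : R,
  [/\ 0 < q < 1, 0 <= D & forall z, stolz g z -> nrm (phi z) <= D * nrm (1 - z) `^ q].
Proof.
case=> _ [M HM] [s [c [s0 c0 Hs]]]; exists (Num.min s 2^-1), (c + `|M|).
have q0 : 0 < Num.min s 2^-1 by rewrite lt_min s0 invr_gt0 ltr0n.
split=> [||z gz]; first by rewrite q0 gt_min [X in _ || X](_ : _ = true) ?orbT//; lra.
  by rewrite addr_ge0// ltW.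
set q := Num.min s 2^-1 in q0 *; have qs : q <= s by rewrite ge_min lexx.
have [z1|z1] := leP 1 (nrm (1 - z)).
  have p1 : 1 <= nrm (1 - z) `^ q by rewrite -[leLHS](powRr0 (nrm (1 - z))) ler_powR// ltW.
  rewrite (le_trans (HM _ gz))// (le_trans (ler_norm _))//.
  apply: (@le_trans _ _ (c + `|M|)); first by rewrite lerDr ltW.
  by rewrite ler_peMr// addr_ge0// ltW.
rewrite (le_trans (Hs _ gz))// ler_pM ?powR_ge0// ?(ltW c0)// ?lerDl//.
have [->|n0] := eqVneq (nrm (1 - z)) 0; first by rewrite !powR0// gt_eqF.
by rewrite ger_powR// lt_neqAle eq_sym n0 nrm_ge0/= ltW.
Qed.

Lemma eq_cdiff (f h : C -> C) z (d : R) : 0 < d ->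
  (forall w, nrm (w - z) < d -> f w = h w) -> cdiff f z -> cdiff h z.
Proof.
move=> d0 fh [p Hp]; exists p => e e0; have [d' d'0 Hd'] := Hp e e0.
exists (Num.min d d') => [|w]; first by rewrite lt_min d0.
rewrite lt_min => /andP[wd wd']; rewrite -!fh//; last by rewrite subrr nrm0.
exact: Hd'.
Qed.

Lemma cdiff_cont (f : C -> C) z (e : R) : cdiff f z -> 0 < e ->
  exists2 d : R, 0 < d & forall w, nrm (w - z) < d -> nrm (f w - f z) <= e.
Proof.
move=> [p Hp] e0; have [d d0 Hd] := Hp 1 ltr01; have p0 := nrm_ge0 p.
have p1 : 0 < 1 + nrm p by lra.
exists (Num.min d (e / (1 + nrm p))) => [|w]; first by rewrite lt_min d0 divr_gt0.
rewrite lt_min ltr_pdivlMr// => /andP[wd we].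
have := nrmD (f w - f z - p * (w - z)) (p * (w - z)); rewrite subrK (nrmM p).
by have := Hd _ wd; lra.
Qed.

Lemma nrm_drop (r : R) z : drop_set r z -> r <= 1 -> nrm z <= 1.
Proof.
move=> [t /andP[t0 t1] zt] r1.
have := nrmD (z - (1 - t)%:C) ((1 - t)%:C : C); rewrite subrK nrm_real ger0_norm ?subr_ge0//.
have := ler_wpM2r (ltW t0) r1; lra.
Qed.

End Holomorphic.
Lemma rsum_segment {R : realType} {Y : normedModType R[i]} (s n : nat) (a e : R[i]^o)
    (F : R[i]^o -> Y) :
  rsum s n 0 1 (fun t => (e - a) *: F (line a e t)) =
  psum n (fun=> (n%:R^-1)%:C * (e - a)) (fun j => line a e ((j + s)%:R / n%:R)) F.
Proof.
rewrite /rsum /psum; apply: eq_bigr => j _.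
by rewrite grid01 scalerA subr0 mul1r.
Qed.

Lemma rsum_arc {R : realType} {Y : normedModType R[i]} (n : nat) (r th : R)
    (F : R[i]^o -> Y) :
  rsum 1 n th (2 * pi - th) (fun t => ('i * r%:C * cis t) *: F (om r t)) =
  psum n (w2 r th n) (fun j => p2 r th n j.+1) F.
Proof.
rewrite /rsum /psum; apply: eq_bigr => j _.
by rewrite addn1 scalerA -mulrA.
Qed.

(** * Riemann sums and moments on one contour *)

Section ContourLimit.
Context {R : realType} {X : completeNormedModType R[i]}.
Local Notation C := R[i]^o.
Variables (T : bop X X) (b0 b g : R) (phi : C -> C) (CR : R).
Hypotheses (b00 : 0 < b0) (b0b : b0 < b) (bg : b < g) (gpi : g < pi / 2).
Local Notation U := (~` closure (stolz b0) : set C).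
Hypothesis specU : spectrum T `<=` ~` U.
Hypotheses (CR0 : 0 <= CR) (RsB : forall z, U z -> nrm ((z - 1) *: resolvent z T) <= CR).
Hypothesis Hphi : Hinfty0 g phi.
Local Notation r := (sin b).
Local Notation th := (pi / 2 - b).

Let angles : [/\ 0 < b0, b0 < b, b < g & g < pi / 2].
Proof. by []. Qed.

Lemma sin_contour : [/\ 0 < r, r < 1 & r < sin g].
Proof.
have pi0 := pi_gt0 R; have [b0_gt0 b0_lt_b b_lt_g g_ltpi] := angles.
have rg : r < sin g.
  by rewrite ltr_sin// in_itv /=; apply/andP; split; lra.
split=> //; first by rewrite sin_gt0_pi//; apply/andP; split; lra.
exact: lt_le_trans rg (sin_le1 _).
Qed.

Lemma drop_in z : drop_set r z -> stolz g z /\ z != 1.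
Proof.
have [r0 r1 rg] := sin_contour => rz; split; last exact: drop_ne1 rz.
by apply: drop_stolz rz; rewrite ltW.
Qed.

Lemma tangent_in (e t : R) : (e = th) \/ (e = - th) -> 0 < t ->
  U (line 1 (om r e) t).
Proof.
move=> eth t0; have bpi := lt_trans bg gpi; have [b0_gt0 b0_lt_b b_lt_g g_ltpi] := angles.
have pb0 : cos (pi / 2 - b0) = sin b0 by rewrite cosB cos_pihalf sin_pihalf mul0r mul1r add0r.
case: eth => ->.
  apply: (@line_out _ b0 b t th (pi / 2 - b0)) => //.
  by rewrite -cosN; congr cos; lra.
apply: (@line_out _ b0 b t (- th) (- (pi / 2 - b0))) => //; first by rewrite cosN.
by congr cos; lra.
Qed.

Lemma tangent_drop (e t : R) : 0 < t <= 1 -> drop_set r (line 1 (om r e) t).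
Proof.
have [r0 r1 rg] := sin_contour => /andP[t0 t1].
rewrite (_ : line _ _ _ = (1 - (1 - t))%:C * om r e + (1 - t)%:C); last first.
  by rewrite /line subKr rmorphB rmorph1; ring.
apply: drop_conv1; last by apply: om_drop; rewrite ltW.
by rewrite subr_ge0 t1/= ltrBlDr ltrDl.
Qed.

Lemma arc_in (psi : R) : th <= psi <= 2 * pi - th -> U (om r psi).
Proof. by move=> H; apply: om_out => //; exact: lt_trans bg gpi. Qed.

Local Notation F := (fun z : C => phi z *: resolvent z T).

Lemma contour_cvg (lam : R -> C) (t : R) : continuous lam -> U (lam t) -> drop_set r (lam t) ->
  F (lam t') @[t' --> t] --> F (lam t).
Proof.
move=> lamc Ut dt; have [gt t1] := drop_in dt; apply: cvgZ.
  apply: (cvg_comp _ _ (lamc t)); apply: derivable_cvg.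
  by case: Hphi => H _ _; exact: H.
apply: (resolvent_cvg specU CR0 RsB); [exact: Ut|exact: t1|exact: lamc|].
have nU : nbhs (lam t) U.
  apply: open_nbhs_nbhs; split; last exact: Ut.
  exact: (closed_openC (@closed_closure _ _)).
exact: near_preimage (lamc t) nU.
Qed.

(** phi contributes the exponent q and the resolvent -1; as q - 1 > -1, this is an integrable
    singularity along the tangents. *)
Lemma contour_bound : exists q D : R, [/\ 0 < q < 1, 0 <= D & forall z, U z -> drop_set r z ->
  nrm (F z) <= D * nrm (1 - z) `^ (q - 1)].
Proof.
have [q [D [q01 D0 HD]]] := Hinfty0_powR Hphi; exists q, (D * CR); split=> //.
  by rewrite mulr_ge0.
move=> z Uz /drop_in[gz z1]; have n0 : nrm (1 - z) != 0 by rewrite lt0r_neq0// nrmB_gt0// eq_sym.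
rewrite nrmZ powRB ?n0 ?implybT// powRr1 ?nrm_ge0// mulrACA.
by rewrite ler_pM ?nrm_ge0// ?HD// nrmBC (nrm_resolvent RsB).
Qed.

Lemma Lsum_cvg : Lsum r th n.+1 F @[n --> \oo] --> stolz_boundary_integral b F.
Proof.
have [r0 r1 rg] := sin_contour; have r0' := ltW r0.
have pi0 := pi_gt0 R; have [b0_gt0 b0_lt_b b_lt_g g_ltpi] := angles.
have [q [D [q01 D0 HD]]] := contour_bound; have [q0 q1] := andP q01.
have th0 : 0 < th by lra.
have thpi : th < 2 * pi - th by lra.
have nom e : 1 - r <= nrm (om r e - 1).
  by have := nrm_triangle (1 : C) (om r e) 0; rewrite !subr0 nrm1 nrm_om// nrmBC; lra.
have nseg e t : 0 < t -> nrm (1 - line 1 (om r e) t) = t * nrm (om r e - 1).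
  move=> t0; rewrite (_ : 1 - _ = - (t%:C *: (om r e - 1))).
    by rewrite nrmN nrmZ nrm_real gtr0_norm.
  by rewrite /line opprD addrA subrr add0r.
have segB e t : (e = th) \/ (e = - th) -> 0 < t <= 1 ->
    nrm ((om r e - 1) *: F (line 1 (om r e) t)) <=
    nrm (om r e - 1) * (D * nrm (om r e - 1) `^ (q - 1)) * t `^ (q - 1).
  move=> eth /andP[t0 t1]; rewrite nrmZ -mulrA ler_wpM2l ?nrm_ge0//.
  rewrite (le_trans (HD _ _ _))//; first exact: tangent_in.
    by apply: tangent_drop; rewrite t0.
  by rewrite nseg// powRM ?nrm_ge0 ?(ltW t0)// -mulrA [_ `^ _ * _]mulrC.
have powle (t s : R) : 0 < t -> t <= s -> s `^ (q - 1) <= t `^ (q - 1).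
  move=> t0 ts; have s0 := lt_le_trans t0 ts.
  rewrite -(opprB 1 q) !powRN lef_pV2 ?posrE ?powR_gt0//.
  by rewrite ge0_ler_powR ?nnegrE ?(ltW t0) ?(ltW s0)// subr_ge0 ltW.
apply: cvgD; first apply: cvgD.
- rewrite (_ : (fun n => psum n.+1 _ _ F) = (fun n => rsum 1 n.+1 0 1
      (fun t => (om r th - 1) *: F (line 1 (om r th) t)))); last first.
    apply/funext => n; rewrite (rsum_segment 1 n.+1 1 (om r th) F).
    by apply: eq_bigr => j _; rewrite addn1.
  apply: (@bochner_riemann _ _ 0 1 _ (fun t => nrm (om r th - 1) *
    (D * nrm (om r th - 1) `^ (q - 1)) * t `^ (q - 1)) 1) => //.
  + exact: bop_complete.
  + move=> t /andP[t0 t1]; apply: cvg_scale.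
    apply: contour_cvg; first exact: line_continuous.
      by apply: tangent_in => //; left.
    by apply: tangent_drop; rewrite t0 ltW.
  + apply: integrable_powR => //.
    by rewrite !mulr_ge0 ?nrm_ge0 ?powR_ge0.
  + move=> t /andP[t0 t1]; apply: segB; first by left.
    by rewrite t0 ltW.
  (* The tag is the end of the cell farther from 1 and the majorant decreases away from 1, so its
     value at [t] dominates. On the last segment the left end plays this role. *)
  + move=> n j t jn /andP[t0 t1]; rewrite grid01 addn1 => /andP[jt tj].
    have n0 : 0 < n%:R :> R by rewrite ltr0n (leq_ltn_trans _ jn).
    rewrite grid01 in tj *.
    apply: le_trans (segB _ _ _ _) _; first by left.
      by rewrite (lt_trans t0 tj)/= ler_pdivrMr// mul1r ler_nat.
    rewrite ler_wpM2l ?mulr_ge0 ?nrm_ge0 ?powR_ge0//.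
    by apply: powle => //; exact: ltW.
- rewrite (_ : (fun n => psum n.+1 _ _ F) = (fun n => rsum 1 n.+1 th (2 * pi - th)
      (fun t => ('i * r%:C * cis t) *: F (om r t)))); last first.
    by apply/funext => n; rewrite (rsum_arc n.+1 r th F).
  have arcB t : th <= t <= 2 * pi - th -> nrm (('i * r%:C * cis t) *: F (om r t)) <=
      r * (D * (1 - r) `^ (q - 1)).
    move=> tt; rewrite nrmZ -mulrA (nrmM 'i) nrmi mul1r -/(om r t) nrm_om// ler_wpM2l//.
    rewrite (le_trans (HD _ _ _))//; [exact: arc_in|exact: om_drop|].
    by rewrite ler_wpM2l// powle ?subr_gt0// nrmBC.
  apply: (@bochner_riemann _ _ th (2 * pi - th) _ (fun=> r * (D * (1 - r) `^ (q - 1))) 1) => //.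
  + exact: bop_complete.
  + move=> t /andP[t0 t1]; apply: cvgZ.
      rewrite (_ : (fun t => 'i * _ * _) = (fun t => ('i : C) *: om r t)); last first.
        by apply/funext => u; rewrite -mulrA.
      by rewrite -mulrA; apply: cvg_scale; exact: om_continuous.
    apply: contour_cvg; [exact: om_continuous| |exact: om_drop].
    by apply: arc_in; rewrite !ltW.
  + pose K : R := r * (D * (1 - r) `^ (q - 1)).
    have K0 : 0 <= K by rewrite !mulr_ge0 ?powR_ge0.
    apply: (@integrable_rsum _ th (2 * pi - th) ((2 * pi - th - th) * K) (fun=> K) 1) => //.
      by move=> t _; exact: cvg_cst.
    move=> n; rewrite sumr_const card_ord -mulrnAl -[X in X * K]mulr_natr.
    have [->|n0] := posnP n; first by rewrite mulr0 mul0r mulr_ge0// subr_ge0 ltW.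
    by rewrite divfK// pnatr_eq0 -lt0n.
  + by move=> t /andP[t0 t1]; apply: arcB; rewrite !ltW.
  + move=> n j t jn _ _; apply: arcB.
    have n0 : 0 < n%:R :> R by rewrite ltr0n (leq_ltn_trans _ jn).
    rewrite addn1 /grid lerDl mulr_ge0 ?divr_ge0 ?subr_ge0 ?(ltW thpi)//=.
    rewrite -lerBrDl ler_piMr ?subr_ge0 ?(ltW thpi)//.
    by rewrite ler_pdivrMr// mul1r ler_nat.
- rewrite (_ : (fun n => psum n.+1 _ _ F) = (fun n => rsum 0 n.+1 0 1
      (fun t => (1 - om r (- th)) *: F (line (om r (- th)) 1 t)))); last first.
    apply/funext => n; rewrite (rsum_segment 0 n.+1 (om r (- th)) 1 F).
    by apply: eq_bigr => j _; rewrite addn0.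
  have lineC t : line (om r (- th)) 1 t = line 1 (om r (- th)) (1 - t).
    by rewrite /line rmorphB; ring.
  have segB' t : 0 <= t < 1 -> nrm ((1 - om r (- th)) *: F (line (om r (- th)) 1 t)) <=
      nrm (om r (- th) - 1) * (D * nrm (om r (- th) - 1) `^ (q - 1)) * (1 - t) `^ (q - 1).
    move=> /andP[t0 t1]; rewrite lineC -opprB scaleNr nrmN; apply: segB; first by right.
    by rewrite subr_gt0 t1/= lerBlDr lerDl.
  apply: (@bochner_riemann _ _ 0 1 _ (fun t => nrm (om r (- th) - 1) *
    (D * nrm (om r (- th) - 1) `^ (q - 1)) * (1 - t) `^ (q - 1)) 0) => //.
  + exact: bop_complete.
  + move=> t /andP[t0 t1]; apply: cvg_scale.
    apply: contour_cvg; first exact: line_continuous.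
      by rewrite lineC; apply: tangent_in; [right|rewrite subr_gt0].
    by rewrite lineC; apply: tangent_drop; rewrite subr_gt0 t1/= lerBlDr lerDl ltW.
  + apply: integrable_powR_onem => //.
    by rewrite !mulr_ge0 ?nrm_ge0 ?powR_ge0.
  + by move=> t /andP[t0 t1]; apply: segB'; rewrite ltW.
  + move=> n j t jn /andP[t0 t1]; rewrite addn0 !grid01 => /andP[jt tj].
    have n0 : 0 < n%:R :> R by rewrite ltr0n (leq_ltn_trans _ jn).
    apply: le_trans (segB' _ _) _.
      by rewrite divr_ge0//= ltr_pdivrMr// mul1r ltr_nat.
    rewrite ler_wpM2l ?mulr_ge0 ?nrm_ge0 ?powR_ge0//.
    by apply: powle; rewrite ?subr_gt0// lerD2l lerN2.
Qed.


Lemma contour_moments k (e : R) : 0 < e -> exists N, forall n, (N <= n)%N ->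
  nrm (Lsum r th n (fun z => phi z * z ^+ k) : C) <= e.
Proof.
move=> e0; have [r0 r1 rg] := sin_contour; have r0' := ltW r0.
have pi0 := pi_gt0 R; have [b0_gt0 b0_lt_b b_lt_g g_ltpi] := angles.
(* The value of phi at 1 is unconstrained; replacing it by 0 makes the function continuous on the
   full drop, thanks to the decay of phi. *)
pose h z := if z == 1 then 0 else phi z * z ^+ k.
have zk z : drop_set r z -> nrm (z ^+ k) <= 1.
  by move=> /nrm_drop/(_ (ltW r1)) z1; rewrite nrmX exprn_ile1// nrm_ge0.
have hE z : z != 1 -> h z = phi z * z ^+ k by rewrite /h => /negbTE ->.
have h1 : h 1 = 0 by rewrite /h eqxx.
have hd z : drop_set r z -> cdiff h z.
  move=> dz; have [gz z1] := drop_in dz.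
  have n0 : 0 < nrm (1 - z) by rewrite nrmB_gt0// eq_sym.
  apply: (eq_cdiff (f := phi \* (fun w : C => w ^+ k)) n0).
    by move=> w wz; rewrite hE//; apply: contraTneq wz => ->; rewrite ltxx.
  apply/derivable_cdiff/derivableM; first by case: Hphi => H _ _; exact: H.
  exact: exprn_derivable.
have [M HM] : exists M, forall z, full_drop r z -> nrm (h z) <= M.
  case: Hphi => _ [M HM] _; exists `|M| => z [dz|->]; last by rewrite h1 nrm0.
  have [gz z1] := drop_in dz; rewrite hE// (nrmM (phi z)) -[leRHS]mulr1.
  by rewrite ler_pM ?nrm_ge0 ?zk// (le_trans (HM _ gz))// ler_norm.
have hc : cont_in (full_drop r) h.
  move=> z [dz|->] e' e'0.
    by have [d d0 Hd] := cdiff_cont (hd _ dz) e'0; exists d => // w _; exact: Hd.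
  have [q [D [/andP[q0 q1] D0 HD]]] := Hinfty0_powR Hphi.
  have eD : 0 < e' / (D + 1) by rewrite divr_gt0// ltr_wpDl.
  (* The radius whose q-th power, multiplied by D, is at most e'. *)
  exists ((e' / (D + 1)) `^ q^-1) => [|w dw wd]; first by rewrite powR_gt0.
  rewrite h1 subr0; case: dw => [dw|->]; last by rewrite h1 nrm0 ltW.
  have [gw w1] := drop_in dw; rewrite hE// (nrmM (phi w)).
  apply: (@le_trans _ _ (D * nrm (1 - w) `^ q)).
    by rewrite -[leRHS]mulr1 ler_pM ?nrm_ge0 ?zk// HD.
  apply: (@le_trans _ _ (D * (e' / (D + 1)))).
    rewrite ler_wpM2l// [leRHS](_ : _ = ((e' / (D + 1)) `^ q^-1) `^ q); last first.
      by rewrite -powRrM mulVf ?lt0r_neq0// powRr1// ltW.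
    by rewrite ge0_ler_powR ?nnegrE ?nrm_ge0 ?powR_ge0 ?(ltW q0)// nrmBC ltW.
  by rewrite mulrA ler_pdivrMr ?ltr_wpDl// mulrC ler_wpM2l ?(ltW e'0)// lerDl.
have thb : 0 <= th <= pi by apply/andP; split; lra.
have [N HN] := Lsum_cdiff r0' thb hd HM hc e0.
exists N => n Nn; rewrite (_ : Lsum _ _ _ _ = Lsum r th n h); first exact: HN.
by apply: eq_Lsum => // z /drop_in[_ z1]; rewrite hE.
Qed.

Lemma contour_opoly (H : C -> bop X X) : opoly H ->
  Lsum r th n (fun z => phi z *: H z) @[n --> \oo] --> (0 : bop X X).
Proof.
(* The case [opoly_X] raises the power of z, so the induction is run with an arbitrary factor z ^+
   k. *)
move=> oH; suff {oH} K k : opoly H ->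
    Lsum r th n (fun z => (phi z * z ^+ k) *: H z) @[n --> \oo] --> (0 : bop X X).
  have := K 0%N oH; rewrite (_ : (fun n => Lsum r th n (fun z => (phi z * z ^+ 0) *: H z)) =
    (fun n => Lsum r th n (fun z => phi z *: H z)))//.
  by apply/funext => n; congr Lsum; apply/funext => z; rewrite expr0 mulr1.
move=> oH; elim: oH k => [B|{}H _ IH|{}H K _ IH1 _ IH2] k.
- apply/cvg_nrmP => e e0; have e'0 : 0 < e / (nrm B + 1) by rewrite divr_gt0// ltr_wpDl ?nrm_ge0.
  have [N HN] := contour_moments k e'0; exists N => // n /HN HNn.
  rewrite sub0r nrmN Lsum_scale nrmZ.
  apply: (@le_lt_trans _ _ (e / (nrm B + 1) * nrm B)); first by rewrite ler_wpM2r ?nrm_ge0.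
  by rewrite -mulrA gtr_pMr// mulrC ltr_pdivrMr ?ltr_wpDl ?nrm_ge0// mul1r ltrDl.
- have := IH k.+1; rewrite (_ : (fun n => Lsum r th n (fun z => (phi z * z ^+ k.+1) *: H z)) =
    (fun n => Lsum r th n (fun z => (phi z * z ^+ k) *: (z *: H z))))//.
  apply/funext => n; congr Lsum; apply/funext => z.
  by rewrite scalerA exprSr mulrA.
- rewrite (_ : (fun n => Lsum r th n _) =
    (fun n => Lsum r th n (fun z => (phi z * z ^+ k) *: H z) +
              Lsum r th n (fun z => (phi z * z ^+ k) *: K z))).
    by rewrite -[0 in X in _ --> X]addr0; apply: cvgD.
  apply/funext => n; rewrite -LsumD; congr Lsum; apply/funext => z.
  by rewrite scalerDr.
Qed.

End ContourLimit.

(** * Estimates uniform in the angle, on the segments and on the arc *)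

Section Pieces.
Context {R : realType}.
Local Notation C := R[i]^o.
Variables (b0 b g : R).
Hypotheses (b00 : 0 < b0) (b0b : b0 < b) (bg : b < g) (gpi : g < pi / 2).
Local Notation U := (~` closure (stolz b0) : set C).
Local Notation r := (sin b).
Local Notation th := (pi / 2 - b).
Local Notation d := (1 - sin g).

(* tau is comparable to the distance of the node to 1. *)
Record contour_piece n (w p : nat -> C) (tau : nat -> R) : Prop := ContourPiece {
  piece_tau : forall j, (j < n)%N -> 0 < tau j <= 1 ;
  piece_out : forall j, (j < n)%N -> U (p j) ;
  piece_drop : forall j, (j < n)%N -> drop_set r (p j) ;
  piece_weight : forall j, (j < n)%N -> nrm (w j) <= 8 * n%:R^-1 ;
  piece_nrm : forall j, (j < n)%N -> nrm (p j) <= 1 - d * tau j ;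
  piece_dist : forall j, (j < n)%N -> d * tau j <= nrm (1 - p j) <= 2 * tau j ;
  piece_geom : forall k, \sum_(j < n) n%:R^-1 * (k.+1%:R * (1 - d * tau j) ^+ k) <= d^-1 ;
  piece_powR : forall q : R, 0 < q < 1 ->
    \sum_(j < n) n%:R^-1 * tau j `^ (q - 1) <= q^-1 }.

(** The gap d depends on g only and serves all contours with b < g, so the constants below do not
    depend on b. *)
Lemma stolz_gap : 0 < d <= 1 /\ r <= 1 - d.
Proof.
have [r0 r1 rg] := sin_contour b00 b0b bg gpi.
have pi0 := pi_gt0 R.
have H : sin g < 1.
  have : sin g < sin (pi / 2).
    have b00' := b00; have b0b' := b0b; have bg' := bg; have gpi' := gpi.
    by rewrite ltr_sin// in_itv /=; apply/andP; split; lra.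
  by rewrite sin_pihalf.
by split; [apply/andP; split; lra|lra].
Qed.

Lemma nrm_tangent (e t : R) : 0 < t <= 1 ->
  nrm (line 1 (om r e) t) <= 1 - d * t /\
  d * t <= nrm (1 - line 1 (om r e) t) <= 2 * t.
Proof.
have [/andP[d0 d1] rd] := stolz_gap; have [r0 r1 rg] := sin_contour b00 b0b bg gpi.
move=> /andP[t0 t1]; have nom := nrm_om e (ltW r0).
have l1 : d <= nrm (om r e - 1).
  by have := nrm_triangle (1 : C) (om r e) 0; rewrite !subr0 nrm1 nom nrmBC; lra.
have l2 : nrm (om r e - 1) <= 2.
  by have := nrm_triangle (om r e) 0 (1 : C); rewrite subr0 sub0r nrmN nrm1 nom; lra.
split.
  rewrite (_ : line _ _ _ = ((1 - t)%:C : C) + t%:C *: om r e); last first.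
    by rewrite /line /GRing.scale /= rmorphB rmorph1; ring.
  rewrite (le_trans (nrmD _ _))// (nrmZ t%:C) !nrm_real nom ger0_norm ?subr_ge0//.
  by rewrite gtr0_norm//; have := ler_wpM2r (ltW t0) rd; lra.
rewrite (_ : 1 - _ = - (t%:C *: (om r e - 1))); last by rewrite /line opprD addrA subrr add0r.
rewrite nrmN nrmZ nrm_real gtr0_norm// mulrC ler_wpM2l ?(ltW t0)//=.
by rewrite mulrC ler_wpM2r// ltW.
Qed.

Lemma nrm_weight (e : R) n : nrm ((n%:R^-1)%:C * (om r e - 1) : C) <= 8 * n%:R^-1.
Proof.
have [r0 r1 rg] := sin_contour b00 b0b bg gpi; have nom := nrm_om e (ltW r0).
rewrite (nrmM (_%:C)) nrm_real ger0_norm ?invr_ge0// mulrC ler_wpM2r ?invr_ge0//.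
by have := nrm_triangle (om r e) 0 (1 : C); rewrite subr0 sub0r nrmN nrm1 nom; lra.
Qed.

Lemma segment_piece1 n :
  contour_piece n (w1 r th n) (fun j => p1 r th n j.+1) (fun j => j.+1%:R / n%:R).
Proof.
have [d01 rd] := stolz_gap; have [r0 r1 rg] := sin_contour b00 b0b bg gpi.
have tau j : (j < n)%N -> 0 < (j.+1%:R / n%:R : R) <= 1.
  move=> jn; have n0 : 0 < n%:R :> R by rewrite ltr0n (leq_ltn_trans _ jn).
  by rewrite divr_gt0 ?ltr0Sn//= ler_pdivrMr// mul1r ler_nat.
split=> [j /tau//|j /tau/andP[t0 _]|j jn|j _|j /tau/(nrm_tangent th)[]//|j /tau/(nrm_tangent th)[]//|k|q q01].
- by apply: (tangent_in b00 b0b bg gpi) => //; left.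
- by apply: p1_drop => //; exact: ltW.
- exact: nrm_weight.
- exact: sum_geom_line.
- exact: sum_powR.
Qed.

Lemma segment_piece3 n :
  contour_piece n (w3 r th n) (p3 r th n) (fun j => (n - j)%:R / n%:R).
Proof.
have [d01 rd] := stolz_gap; have [r0 r1 rg] := sin_contour b00 b0b bg gpi.
have tau j : (j < n)%N -> 0 < ((n - j)%:R / n%:R : R) <= 1.
  move=> jn; have n0 : 0 < n%:R :> R by rewrite ltr0n (leq_ltn_trans _ jn).
  apply/andP; split; first by rewrite divr_gt0// ltr0n subn_gt0.
  by rewrite ler_pdivrMr// mul1r ler_nat leq_subr.
have pE j : (j < n)%N -> p3 r th n j = line 1 (om r (- th)) ((n - j)%:R / n%:R).
  move=> jn; have n0 : n%:R != 0 :> R by rewrite pnatr_eq0 -lt0n (leq_ltn_trans _ jn).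
  by rewrite natrB ?(ltnW jn)// mulrBl divff// /p3 /line rmorphB rmorph1; ring.
have rev (f : nat -> R) : \sum_(j < n) f (n - j)%N = \sum_(j < n) f j.+1.
  rewrite (reindex_inj rev_ord_inj); apply: eq_bigr => j _ /=.
  by rewrite subKn// ltn_ord.
split=> [j /tau//|j jn|j jn|j jn|j jn|j jn|k|q q01].
- by rewrite pE//; apply: (tangent_in b00 b0b bg gpi); [right|case/andP: (tau _ jn)].
- by apply: p3_drop => //; exact: ltW.
- by have := nrm_weight (- th) n; rewrite -nrmN -mulrN opprB.
- by rewrite pE//; exact: (nrm_tangent _ (tau _ jn)).1.
- by rewrite pE//; exact: (nrm_tangent _ (tau _ jn)).2.
- rewrite (rev (fun i => n%:R^-1 * (k.+1%:R * (1 - d * (i%:R / n%:R)) ^+ k))).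
  exact: sum_geom_line.
- rewrite (rev (fun i => n%:R^-1 * (i%:R / n%:R) `^ (q - 1))).
  exact: sum_powR.
Qed.

(** The arc keeps a distance between d and 2 from 1, so tau = 1 will do and the two sums reduce to
    single terms. *)
Lemma arc_piece n :
  contour_piece n (w2 r th n) (fun j => p2 r th n j.+1) (fun=> 1).
Proof.
have [/andP[d0 d1] rd] := stolz_gap; have [r0 r1 rg] := sin_contour b00 b0b bg gpi.
have pi0 := pi_gt0 R; have pi4 := @pihalf_lt2 R.
have b00' := b00; have b0b' := b0b; have bg' := bg; have gpi' := gpi.
have nom e := nrm_om e (ltW r0).
have nV0 : 0 <= n%:R^-1 :> R by rewrite invr_ge0.
have sum1 (c : R) : 0 <= c -> \sum_(j < n) n%:R^-1 * c <= c.
  move=> c0; rewrite sumr_const card_ord -mulrnAl -[n%:R^-1 *+ n]mulr_natr.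
  have [->|n0] := posnP n; first by rewrite mulr0 mul0r.
  by rewrite mulVf ?mul1r// pnatr_eq0 -lt0n.
split=> [j _|j jn|j _|j jn|j _|j _|k|q /andP[q0 q1]].
- by rewrite ltr01 lexx.
- apply: (arc_in b00 b0b bg gpi).
  have n0 : 0 < n%:R :> R by rewrite ltr0n (leq_ltn_trans _ jn).
  have t0 : 0 <= j.+1%:R / n%:R :> R by rewrite divr_ge0.
  have t1 : j.+1%:R / n%:R <= 1 :> R by rewrite ler_pdivrMr// mul1r ler_nat.
  have L0 : 0 <= 2 * pi - th - th by lra.
  rewrite lerDl mulr_ge0//= -lerBrDl.
  by rewrite ler_piMr.
- by apply: p2_drop; exact: ltW.
(* The opening angle of the arc is at most 2 pi, and 8 bounds it since pi / 2 < 2. *)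
- rewrite /w2 (nrmM (_%:C)) nrm_real (nrmM 'i) nrmi mul1r nom normrM (ger0_norm nV0).
  rewrite -mulrA (mulrC n%:R^-1) mulrA ler_wpM2r// ger0_norm; last by lra.
  have : (2 * pi - th - th) * r <= (2 * pi - th - th) * 1 by rewrite ler_wpM2l ?(ltW r1)//; lra.
  lra.
- by rewrite mulr1 nom.
- rewrite !mulr1.
  have := nrm_triangle (1 : C) (p2 r th n j.+1) 0; have := nrm_triangle (1 : C) 0 (p2 r th n j.+1).
  rewrite !subr0 sub0r nrmN nrm1 nom => H1 H2; apply/andP; split; lra.
- rewrite mulr1 (le_trans (sum1 _ _))// ?mulr_ge0 ?exprn_ge0 ?subr_ge0//; try lra.
  by rewrite (le_trans (geom_term _ _)) ?opprB ?subrKC//; apply/andP; split; lra.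
- rewrite powR1 (le_trans (sum1 _ _))// ?ler01// invf_ge1// ltW//.
Qed.

End Pieces.

(** * The series for phi(T) *)

Section Symbols.
Context {R : realType}.
Local Notation C := R[i]^o.

(** The symbol of V_k without its factor 1 - z; that factor, restored in [vsym], is the one combined
    with R(z, T). The cube is (1 - z^3)^3 / (1 - z)^3. *)
Definition csym k (z : C) : C := (k.+2%:R)%:C * z ^+ k * (1 + z + z ^+ 2) ^+ 3.

Definition vsym k (z : C) : C := csym k z * (1 - z).

(** With S = z^3 and |z| < 1 this is the tail (1 - S)^3 sum_(k >= N) (k + 1)(k + 2) S^k in closed
    form. *)
Definition rsym N (z : C) : C := (z ^+ 3) ^+ N *
  (2 + (2 * N%:R)%:C * (1 - z ^+ 3) + (N%:R * N.+1%:R)%:C * (1 - z ^+ 3) ^+ 2).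

(* Abel summation, three times, of the geometric series in z^3. *)
Lemma symbol_identity N (z : C) : \sum_(k < N) (k.+1%:R)%:C *
    ((1 - z) * (z ^+ k * ((1 - z) * (z ^+ k * vsym k z)))) + rsym N z = 2.
Proof.
elim: N => [|N IH]; first by rewrite big_ord0 /rsym expr0 !(mul0r, mulr0, addr0, add0r, mul1r).
rewrite big_ord_recr /= -[RHS]IH -addrA; congr (_ + _).
have E (n : nat) : (n.+1%:R)%:C = (n%:R)%:C + 1 :> C by rewrite -natr1 rmorphD rmorph1.
have EM (a c : R) : (a * c)%:C = a%:C * c%:C :> C by rewrite rmorphM.
rewrite /rsym /vsym /csym !EM !E [z ^+ 3 ^+ N.+1]exprS -exprM mulnC exprM.
rewrite rmorph0 add0r.
rewrite (_ : z ^+ N ^+ 3 = z ^+ N * z ^+ N * z ^+ N); last by rewrite !exprS expr0; ring.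
move: (z ^+ N) ((N%:R)%:C : C) => u v; ring.
Qed.

Lemma nrm_pnat n : nrm ((n%:R)%:C : C) = n%:R.
Proof. by rewrite nrm_real ger0_norm. Qed.

Lemma nrm_cube_factor (z : C) : nrm z <= 1 -> nrm (1 + z + z ^+ 2) <= 3.
Proof.
move=> z1; have := nrmD (1 + z) (z ^+ 2); have := nrmD (1 : C) z; rewrite nrm1 nrmX.
have : nrm z ^+ 2 <= 1 by rewrite exprn_ile1// nrm_ge0.
lra.
Qed.

(** 54 = 2 * 3^3, from k + 2 <= 2 (k + 1) and |1 + z + z^2| <= 3. *)
Lemma nrm_csym k (z : C) (rho : R) : nrm z <= rho -> rho <= 1 ->
  nrm (csym k z) <= 54 * (k.+1%:R * rho ^+ k).
Proof.
move=> zr r1; have rho0 := le_trans (nrm_ge0 z) zr.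
rewrite /csym (nrmM (_ * _)) (nrmM (_%:C)) nrm_pnat !nrmX.
have Q : nrm (1 + z + z ^+ 2) ^+ 3 <= 27.
  rewrite (@le_trans _ _ (3 ^+ 3))//; last by rewrite -natrX ler_nat.
  by rewrite lerXn2r ?nnegrE ?nrm_ge0// nrm_cube_factor// (le_trans zr).
have zk : nrm z ^+ k <= rho ^+ k by rewrite lerXn2r ?nnegrE ?nrm_ge0.
have k2 : k.+2%:R <= 2 * k.+1%:R :> R by rewrite -natrM ler_nat mul2n -addnn addSn !addnS !ltnS leq_addr.
rewrite (_ : 54 * _ = 2 * k.+1%:R * rho ^+ k * 27); last by move: (k.+1%:R : R) (rho ^+ k) => u v; ring.
by rewrite ler_pM ?mulr_ge0 ?exprn_ge0 ?nrm_ge0// ler_pM ?exprn_ge0 ?nrm_ge0.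
Qed.

(** With x = d tau, the polynomial factor is at most of order (1 + N x)^2, while [bernoulli_le1]
    bounds |z|^N by 1 / (1 + N x). The power z^(3N) supplies this decay three times, so one factor
    is left over. *)
Lemma nrm_rsym N (z : C) (d tau : R) : 0 < d <= 1 -> 0 < tau <= 1 ->
  nrm z <= 1 - d * tau -> nrm (1 - z) <= 2 * tau ->
  nrm (rsym N z) <= 72 / d ^+ 2 * (1 + N%:R * (d * tau))^-1.
Proof.
move=> /andP[d0 d1] /andP[t0 t1] zr z1.
have [x xE] : exists x, x = d * tau by exists (d * tau).
have x0 : 0 < x by rewrite xE mulr_gt0.
have x1 : x <= 1 by rewrite xE mulr_ile1// ltW.
rewrite -xE in zr *; have nz1 : nrm z <= 1 by lra.
have nx0 : 0 <= N%:R * x by rewrite mulr_ge0// ltW.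
set v := nrm (1 - z ^+ 3).
have v6 : v <= 6 / d * x.
  rewrite /v (_ : 1 - z ^+ 3 = (1 - z) * (1 + z + z ^+ 2)); last by rewrite !exprS expr0; ring.
  rewrite nrmM (_ : 6 / d * x = 2 * tau * 3); last first.
    by rewrite xE mulrA divfK ?lt0r_neq0//; ring.
  by rewrite ler_pM ?nrm_ge0// nrm_cube_factor.
have v0 : 0 <= v := nrm_ge0 _.
have dV : 1 <= d^-1 by rewrite invf_ge1.
have v6' : v ^+ 2 <= 36 / d ^+ 2 * x ^+ 2.
  rewrite (_ : 36 / d ^+ 2 * x ^+ 2 = (6 / d * x) ^+ 2); last first.
    by rewrite !exprMn exprVn; congr (_ * _ * _); ring.
  by rewrite lerXn2r ?nnegrE ?mulr_ge0 ?invr_ge0// ltW.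
have poly : nrm (2 + (2 * N%:R)%:C * (1 - z ^+ 3) + (N%:R * N.+1%:R)%:C * (1 - z ^+ 3) ^+ 2 : C)
    <= 72 / d ^+ 2 * (1 + N%:R * x) ^+ 2.
  apply: (@le_trans _ _ (2 + 2 * N%:R * v + N%:R * N.+1%:R * v ^+ 2)).
    rewrite (le_trans (nrmD _ _))//; apply: lerD.
      rewrite (le_trans (nrmD _ _))//; apply: lerD.
        by have := nrmD (1 : C) 1; rewrite nrm1.
      by rewrite (nrmM (_%:C)) nrm_real ger0_norm// mulr_ge0.
    by rewrite (nrmM (_%:C)) nrm_real ger0_norm ?mulr_ge0// nrmX.
  have NS : N%:R * N.+1%:R <= 2 * N%:R ^+ 2 :> R.
    by rewrite -natrX -!natrM ler_nat; case: (N) => // m; rewrite -mulnn mulnCA leq_mul2l/= mul2n -addnn addSn addnS ltnS ltnS leq_addr.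
  have d2 : d^-1 <= d^-1 ^+ 2 by rewrite expr2 ler_peMl// ltW ?invr_gt0.
  have h1 : 2 * N%:R * v <= 12 * d^-1 ^+ 2 * (N%:R * x).
    apply: (@le_trans _ _ (2 * N%:R * (6 / d * x))); first by rewrite ler_wpM2l ?mulr_ge0.
    rewrite (_ : 2 * N%:R * (6 / d * x) = 12 * d^-1 * (N%:R * x)); last by ring.
    by rewrite ler_wpM2r// ler_wpM2l.
  have h2 : N%:R * N.+1%:R * v ^+ 2 <= 72 * d^-1 ^+ 2 * (N%:R * x) ^+ 2.
    apply: (@le_trans _ _ (2 * N%:R ^+ 2 * (36 / d ^+ 2 * x ^+ 2))).
      by rewrite ler_pM ?mulr_ge0 ?sqr_ge0.
    by rewrite -exprVn; set e := d^-1; clearbody e; move: (N%:R : R) => u; rewrite (_ : _ * _ = 72 * e ^+ 2 * (u * x) ^+ 2)//; ring.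
  have y0 : 0 <= d^-1 ^+ 2 * (N%:R * x) by rewrite mulr_ge0 ?sqr_ge0.
  have d21 : 1 <= d^-1 ^+ 2 by exact: le_trans d2.
  rewrite -exprVn; move: h1 h2 y0 d21; set D := d^-1 ^+ 2; set y := N%:R * x.
  set p1 := _ * v; set p2 := _ * v ^+ 2; clearbody p1 p2 D y.
  move=> h1 h2 y0 d21.
  rewrite (_ : 72 * D * (1 + y) ^+ 2 = 72 * D + 144 * (D * y) + 72 * D * y ^+ 2); last by ring.
  by move: h1; rewrite -mulrA => h1; lra.
have pw : nrm z ^+ N * (1 + N%:R * x) <= 1.
  apply: le_trans (@bernoulli_le1 _ x N _); last by rewrite (ltW x0).
  by rewrite ler_wpM2r ?addr_ge0// lerXn2r ?nnegrE ?nrm_ge0// (le_trans (nrm_ge0 z)).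
rewrite /rsym (nrmM (_ ^+ N)) !nrmX.
have u0 : 0 < 1 + N%:R * x by lra.
have K0 : 0 <= 72 / d ^+ 2 by rewrite mulr_ge0// invr_ge0 sqr_ge0.
rewrite -exprM mulnC exprM; have w0 : 0 <= nrm z ^+ N by rewrite exprn_ge0// nrm_ge0.
move: pw poly w0 u0 K0; set P := nrm (_ + _); set w := nrm z ^+ N; set u := 1 + N%:R * x.
set K := 72 / d ^+ 2; clearbody P w u K => pw poly w0 u0 K0.
apply: (@le_trans _ _ (w ^+ 3 * (K * u ^+ 2))); first by rewrite ler_wpM2l ?exprn_ge0.
rewrite (_ : w ^+ 3 * (K * u ^+ 2) = K * (w * (w * u) ^+ 2)); last by ring.
rewrite ler_wpM2l// -[leRHS]mul1r ler_pdivlMr// -mulrA mulrC -mulrA.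
have wu0 : 0 <= w * u by rewrite mulr_ge0// ltW.
by rewrite [u * w]mulrC mulr_ile1 ?exprn_ile1 ?exprn_ge0.
Qed.

End Symbols.

Lemma sum_bopE {R : realType} {V W : normedModType R[i]} (I : Type) (s : seq I)
    (F : I -> bop V W) (x : V) : (\sum_(i <- s) F i) x = \sum_(i <- s) F i x.
Proof. by elim: s => [|i s IH]; rewrite ?big_nil// !big_cons bopDE IH. Qed.

(** * R-bounds for V_k and decay of the remainder *)

Section ContourEstimates.
Context {R : realType} {X : completeNormedModType R[i]}.
Local Notation C := R[i]^o.
Variables (T : bop X X) (b0 b g : R) (phi : C -> C) (M : R).
Hypotheses (b00 : 0 < b0) (b0b : b0 < b) (bg : b < g) (gpi : g < pi / 2).
Local Notation U := (~` closure (stolz b0) : set C).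
Hypotheses (M0 : 0 < M) (phiM : forall z, stolz g z -> nrm (phi z) <= M).
Local Notation r := (sin b).
Local Notation th := (pi / 2 - b).
Local Notation d := (1 - sin g).

Lemma eq_piece {Y : lmodType R[i]} n w p tau (F G : C -> Y) : contour_piece b0 b g n w p tau ->
  (forall z, U z -> drop_set r z -> F z = G z) -> psum n w p F = psum n w p G.
Proof.
move=> cp FG; apply: eq_bigr => j _; rewrite FG//; [exact: (piece_out cp)|exact: (piece_drop cp)].
Qed.

Lemma eq_contour {Y : lmodType R[i]} n (F G : C -> Y) :
  (forall z, U z -> drop_set r z -> F z = G z) -> Lsum r th n F = Lsum r th n G.
Proof.
move=> FG; rewrite /Lsum (eq_piece (segment_piece1 b00 b0b bg gpi n) FG).
rewrite (eq_piece (arc_piece b00 b0b bg gpi n) FG).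
by rewrite (eq_piece (segment_piece3 b00 b0b bg gpi n) FG).
Qed.

Variable CE : R.
Hypotheses (CE0 : 0 <= CE) (resE : forall n (S : nat -> bop X X) (x : nat -> X),
  (forall k, (k < n)%N -> resolvents T b0 (S k)) ->
  radE n (fun k => S k (x k)) sqn <= CE * radE n x sqn).

(** On each piece V_k is K times a combination of operators (p j - 1) R(p j, T) whose coefficients
    have total modulus at most 1, by [piece_geom]. In K = 432 / d * M, 432 = 8 * 54 collects the
    bounds of the weights and of [csym]; the 4 comes from [radE_acvx]. *)
Lemma piece_Rbound n w p tau N (a : nat -> X) : (0 < n)%N -> contour_piece b0 b g n w p tau ->
  radE N (fun k => psum n w p (fun z => (phi z * vsym k z) *: resolvent z T) (a k)) sqn <=
  4 * (432 / d * M) ^+ 2 * CE * radE N a sqn.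
Proof.
move=> n0 cp; have [/andP[d0 d1] rd] := stolz_gap b00 b0b bg gpi.
have [K KE] : exists K : R, K = 432 / d * M by exists (432 / d * M).
have c0 : 0 < 432 :> R by rewrite ltr0n.
have K0 : 0 < K by rewrite KE; exact: (mulr_gt0 (divr_gt0 c0 d0) M0).
rewrite -KE.
(* The minus sign turns the factor 1 - z of [vsym] into the p j - 1 of the R-bounded family. *)
pose c k (j : 'I_n) : C := (K^-1)%:C * (w j * (phi (p j) * - csym k (p j))).
pose W (j : 'I_n) : X -> X := (p j - 1) *: resolvent (p j) T.
have cE k : psum n w p (fun z => (phi z * vsym k z) *: resolvent z T) (a k) =
    (K%:C : C) *: (\sum_j c k j *: W j (a k)).
  rewrite /psum sum_bopE scaler_sumr; apply: eq_bigr => j _.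
  rewrite /W !bopZE !scalerA; congr (_ *: _).
  rewrite /c /vsym; move: (csym k (p j)) => u; rewrite !mulrA -rmorphM mulfV ?gt_eqF// rmorph1 mul1r.
  by ring.
rewrite (eq_radE (y := fun k => (K%:C : C) *: (\sum_j c k j *: W j (a k))) (h := sqn))//.
rewrite radE_sqnZ /sqn -/sqn nrm_real (gtr0_norm K0).
rewrite [leRHS](_ : _ = K ^+ 2 * (4 * (CE * radE N a sqn))); last by ring.
rewrite ler_wpM2l ?sqr_ge0//; apply: radE_acvx.
- by rewrite mulr_ge0// radE_ge0//; exact: sqn_ge0.
- move=> J; apply: resE => k _; exists (p (J k)) => //.
  exact: (piece_out cp).
move=> k _.
apply: (@le_trans _ _ (\sum_(j < n) K^-1 * (432 * M * (n%:R^-1 * (k.+1%:R * (1 - d * tau j) ^+ k))))).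
  apply: ler_sum => j _; rewrite /c (nrmM (_%:C)) nrm_real gtr0_norm ?invr_gt0//.
  rewrite ler_wpM2l ?invr_ge0 ?(ltW K0)// (nrmM (w j)) (nrmM (phi _)) nrmN.
  have jn := ltn_ord j; have [t0 t1] := andP (piece_tau cp jn).
  have rho1 : 1 - d * tau j <= 1 by rewrite gerBl mulr_ge0// ltW.
  have := nrm_csym k (piece_nrm cp jn) rho1.
  have gp : stolz g (p j) by case: (drop_in b00 b0b bg gpi (piece_drop cp jn)).
  have := phiM gp; have := piece_weight cp jn.
  have := nrm_ge0 (w j); have := nrm_ge0 (phi (p j)); have := nrm_ge0 (csym k (p j)).
  move: (nrm (w j)) (nrm (phi (p j))) (nrm (csym k (p j))) (k.+1%:R * _) => u v s t s0 v0 u0 u1 v1 s1.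
  rewrite [leRHS](_ : _ = 8 * n%:R^-1 * (M * (54 * t))); last by ring.
  by rewrite ler_pM ?mulr_ge0// ler_pM.
rewrite -mulr_sumr -mulr_sumr mulrC -ler_pdivlMr ?invr_gt0// invrK mul1r KE.
rewrite [leRHS](_ : _ = 432 * M * d^-1); last by ring.
exact: (ler_wpM2l (mulr_ge0 (ltW c0) (ltW M0)) (piece_geom cp k)).
Qed.

Lemma contour_Rbound n N (a : nat -> X) : (0 < n)%N ->
  radE N (fun k => Lsum r th n (fun z => (phi z * vsym k z) *: resolvent z T) (a k)) sqn <=
  40 * (432 / d * M) ^+ 2 * CE * radE N a sqn.
Proof.
move=> n0; pose F k z := (phi z * vsym k z) *: resolvent z T.
pose v1 k := psum n (w1 r th n) (fun j => p1 r th n j.+1) (F k) (a k).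
pose v2 k := psum n (w2 r th n) (fun j => p2 r th n j.+1) (F k) (a k).
pose v3 k := psum n (w3 r th n) (p3 r th n) (F k) (a k).
have vE k : Lsum r th n (F k) (a k) = (v1 k + v2 k) + v3 k by rewrite /Lsum !bopDE.
rewrite (eq_radE (y := fun k => (v1 k + v2 k) + v3 k) (h := sqn) (fun k _ => vE k) (fun=> erefl)).
have H1 : radE N v1 sqn <= _ := piece_Rbound N a n0 (segment_piece1 b00 b0b bg gpi n).
have H2 : radE N v2 sqn <= _ := piece_Rbound N a n0 (arc_piece b00 b0b bg gpi n).
have H3 : radE N v3 sqn <= _ := piece_Rbound N a n0 (segment_piece3 b00 b0b bg gpi n).
have := radE_sqnD N (fun k => v1 k + v2 k) v3; have := radE_sqnD N v1 v2.
move: H1 H2 H3; set B := _ * radE N a sqn; move: (radE N v1 sqn) (radE N v2 sqn) (radE N v3 sqn).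
move=> x1 x2 x3 H1 H2 H3 H4 H5.
(* Two uses of [radE_sqnD] give the weights 4, 4 and 2. *)
rewrite [leRHS](_ : _ = 10 * B); last by rewrite /B; ring.
clearbody B; lra.
Qed.

Variable CR : R.
Hypotheses (CR0 : 0 <= CR) (RsB : forall z, U z -> nrm ((z - 1) *: resolvent z T) <= CR).

(** The decay 1 / (1 + N x) of the remainder is weakened to (N x)^(- q / 2). Half of the exponent q
    is thus spent on decay in N, and the other half keeps the singularity tau^(q / 2 - 1)
    integrable. *)
Lemma piece_remainder q D : 0 < q < 1 -> 0 <= D ->
  (forall z, stolz g z -> nrm (phi z) <= D * nrm (1 - z) `^ q) ->
  exists2 K : R, 0 <= K & forall N n w p tau, (0 < N)%N -> contour_piece b0 b g n w p tau ->
    nrm (psum n w p (fun z => (phi z * rsym N z) *: resolvent z T)) <= K * N%:R `^ (- (q / 2)).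
Proof.
move=> /andP[q0 q1] D0 HD; have [/andP[d0 d1] rd] := stolz_gap b00 b0b bg gpi.
have q20 : 0 < q / 2 by rewrite divr_gt0.
have q21 : q / 2 < 1 by lra.
pose K1 : R := 8 * (D * CR * (72 / d ^+ 2)) * d `^ (q / 2 - 1).
have K10 : 0 <= K1 by rewrite !mulr_ge0 ?invr_ge0 ?sqr_ge0 ?powR_ge0.
exists (K1 * (q / 2)^-1) => [|N n w p tau N0 cp]; first by rewrite mulr_ge0// invr_ge0 ltW.
have N0R : 0 < N%:R :> R by rewrite ltr0n.
apply: (@le_trans _ _ (\sum_(j < n) K1 * N%:R `^ (- (q / 2)) * (n%:R^-1 * tau j `^ (q / 2 - 1)))); last first.
  rewrite -mulr_sumr [leRHS]mulrAC ler_wpM2l ?mulr_ge0 ?powR_ge0//.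
  by apply: (piece_powR cp); rewrite q20.
rewrite (le_trans (nrm_sum _ _ _))//; apply: ler_sum => j _; have jn := ltn_ord j.
have /andP[t0 t1] := piece_tau cp jn; have [gp p1] := drop_in b00 b0b bg gpi (piece_drop cp jn).
have /andP[dt1 dt2] := piece_dist cp jn.
have dt0 : 0 < d * tau j by rewrite mulr_gt0.
have Rb := nrm_resolvent RsB (piece_out cp jn) p1.
have rb : nrm (rsym N (p j)) <= 72 / d ^+ 2 * (1 + N%:R * (d * tau j))^-1.
  by apply: nrm_rsym => //; [rewrite d0|rewrite t0|exact: (piece_nrm cp)].
have n1 : 0 < nrm (1 - p j) by exact: lt_le_trans dt1.
have pR : nrm (phi (p j)) * nrm (resolvent (p j) T) <= D * CR * (d * tau j) `^ (q - 1).
  apply: (@le_trans _ _ (D * nrm (1 - p j) `^ q * (CR / nrm (1 - p j)))).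
    by rewrite ler_pM ?nrm_ge0// ?HD// nrmBC.
  rewrite (_ : _ * _ * _ = D * CR * (nrm (1 - p j) `^ q / nrm (1 - p j))); last by ring.
  have n1' : nrm (1 - p j) != 0 by rewrite lt0r_neq0.
  rewrite (_ : nrm (1 - p j) `^ q / nrm (1 - p j) = nrm (1 - p j) `^ (q - 1)); last first.
    by rewrite powRB ?n1' ?implybT// powRr1// nrm_ge0.
  rewrite ler_wpM2l ?mulr_ge0// -(opprB 1 q) !powRN lef_pV2 ?posrE ?powR_gt0//.
  by rewrite ge0_ler_powR ?nnegrE ?(ltW dt0) ?(ltW n1) ?subr_ge0 ?(ltW q1).
have rb' : nrm (rsym N (p j)) <= 72 / d ^+ 2 * (N%:R `^ (- (q / 2)) * (d * tau j) `^ (- (q / 2))).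
  apply: le_trans rb _; rewrite ler_wpM2l ?mulr_ge0 ?invr_ge0 ?sqr_ge0//.
  rewrite -powRM ?ler0n ?(ltW dt0)//; apply: inv_le_powR; first by rewrite mulr_gt0.
  by rewrite !ltW.
rewrite nrmZ [nrm ((_ * _) *: _)]nrmZ (nrmM (phi _)).
have E : (d * tau j) `^ (q - 1) * (d * tau j) `^ (- (q / 2)) = d `^ (q / 2 - 1) * tau j `^ (q / 2 - 1).
  rewrite -powRD; last by rewrite (lt0r_neq0 dt0) implybT.
  rewrite (_ : q - 1 + - (q / 2) = q / 2 - 1); last by lra.
  by rewrite powRM// ltW.
rewrite [leRHS](_ : _ = (8 * n%:R^-1) * ((D * CR * (d * tau j) `^ (q - 1)) *
   (72 / d ^+ 2 * (N%:R `^ (- (q / 2)) * (d * tau j) `^ (- (q / 2)))))); last first.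
  transitivity (8 * n%:R^-1 * (D * CR * (72 / d ^+ 2) * N%:R `^ (- (q / 2)) *
    ((d * tau j) `^ (q - 1) * (d * tau j) `^ (- (q / 2))))); last by ring.
  by rewrite E /K1; ring.
rewrite ler_pM ?mulr_ge0 ?nrm_ge0 ?(piece_weight cp)//.
rewrite [leLHS](_ : _ = nrm (phi (p j)) * nrm (resolvent (p j) T) * nrm (rsym N (p j))); last by ring.
by rewrite ler_pM ?mulr_ge0 ?nrm_ge0.
Qed.

(** One N serves every mesh n, so N can be fixed before the limit in n is taken. *)
Lemma contour_remainder : Hinfty0 g phi -> forall e : R, 0 < e -> exists2 N : nat, (0 < N)%N &
  forall n, nrm (Lsum r th n (fun z => (phi z * rsym N z) *: resolvent z T)) <= e.
Proof.
move=> Hphi e e0; have [q [D [q01 D0 HD]]] := Hinfty0_powR Hphi.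
have [K K0 HK] := piece_remainder q01 D0 HD; have [q0 q1] := andP q01.
have q20 : 0 < q / 2 by rewrite divr_gt0.
(* For N >= x one gets N^(q / 2) >= y, hence K N^(- q / 2) <= (K + 1) / y = e / 3 on each of the
   three pieces. *)
pose y : R := 3 * (K + 1) / e; have y0 : 0 < y by rewrite divr_gt0// mulr_gt0// ltr_wpDl.
pose x : R := y `^ (q / 2)^-1; have x0 : 0 < x by rewrite powR_gt0.
exists (Num.truncn x).+1 => // n; set N := (Num.truncn x).+1.
have xN : x <= N%:R by rewrite ltW// truncnS_gt.
have small : K * N%:R `^ (- (q / 2)) <= e / 3.
  apply: (@le_trans _ _ ((K + 1) * y^-1)).
    rewrite ler_pM ?powR_ge0// ?lerDl// powRN lef_pV2 ?posrE ?powR_gt0// ?(lt_le_trans x0)//.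
    rewrite [leLHS](_ : _ = x `^ (q / 2)).
      by rewrite ge0_ler_powR ?nnegrE ?(ltW x0) ?(ltW q20).
    by rewrite /x -powRrM mulVf ?gt_eqF// powRr1// ltW.
  rewrite /y; have K1 : K + 1 != 0 by rewrite gt_eqF// ltr_wpDl.
  by rewrite le_eqVlt; apply/orP; left; apply/eqP; field; rewrite K1 gt_eqF.
have H1 := HK N n _ _ _ isT (segment_piece1 b00 b0b bg gpi n).
have H2 := HK N n _ _ _ isT (arc_piece b00 b0b bg gpi n).
have H3 := HK N n _ _ _ isT (segment_piece3 b00 b0b bg gpi n).
rewrite (_ : e = e / 3 + e / 3 + e / 3); last by field.
rewrite /Lsum (le_trans (nrmD _ _))// lerD ?(le_trans H3)//.
by rewrite (le_trans (nrmD _ _))// lerD ?(le_trans H1) ?(le_trans H2).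
Qed.

End ContourEstimates.

(** * Duality between the two square functions *)

Section Pairing.
Context {R : realType} {X : normedModType R[i]}.
Local Notation C := R[i]^o.

(* AM-GM inside the average over signs. *)
Lemma radE_pairing_part (f : C -> R) N (y : nat -> dual X) (v : nat -> X) (mu : R) :
  (forall a b, f (a + b) = f a + f b) -> (forall z, `|f z| <= nrm z) -> 0 < mu ->
  `|\sum_(k < N) f (y k (v k))| <= (mu * radE N y sqn + mu^-1 * radE N v sqn) / 2.
Proof.
move=> fD fn mu0.
have amgm (b : dual X) (x : X) : `|f (b x)| <= mu / 2 * sqn b + mu^-1 / 2 * sqn x.
  rewrite (le_trans (fn _))// (le_trans (opnorm_le b x))// -nrm_bop /sqn.
  move: (nrm b) (nrm x) => u w; have := sqr_ge0 (mu * u - w).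
  have -> : mu / 2 * u ^+ 2 + mu^-1 / 2 * w ^+ 2 =
      mu^-1 / 2 * ((mu * u) ^+ 2 + w ^+ 2) by field; rewrite gt_eqF.
  have -> : u * w = mu^-1 / 2 * (2 * (mu * u) * w) by field; rewrite gt_eqF.
  by move=> H; rewrite ler_wpM2l ?divr_ge0 ?invr_ge0 ?(ltW mu0)//; lra.
pose g (p : dual X * X) : R := f (p.1 p.2).
have E : \sum_(k < N) f (y k (v k)) = radE N (fun k => (y k, v k)) g.
  rewrite (radE_biadditive (phi := fun (b : dual X) x => f (b x)))//.
    by move=> a b c; rewrite bopDE fD.
  by move=> a b c; rewrite linearD fD.
pose h (p : dual X * X) : R := mu / 2 * sqn p.1 + mu^-1 / 2 * sqn p.2.
have hE : radE N (fun k => (y k, v k)) h = (mu * radE N y sqn + mu^-1 * radE N v sqn) / 2.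
  rewrite /h (radE_linear N _ (mu / 2) (mu^-1 / 2) (fun p => sqn p.1) (fun p => sqn p.2)).
  have E1 := radE_raddf (fst : {additive dual X * X -> dual X}) N (fun k => (y k, v k)) sqn.
  have E2 := radE_raddf (snd : {additive dual X * X -> X}) N (fun k => (y k, v k)) sqn.
  rewrite /= in E1 E2; rewrite -[radE N _ (fun p => sqn p.1)]E1 -[radE N _ (fun p => sqn p.2)]E2.
  by move: (radE N _ _) (radE N _ _) => p q; ring.
rewrite E -hE ler_norml; apply/andP; split.
  rewrite lerNl -mulN1r -radEZ; apply: radE_le => p; rewrite mulN1r.
  by rewrite (le_trans _ (amgm p.1 p.2))// -normrN ler_norm.
by apply: radE_le => p; rewrite (le_trans _ (amgm p.1 p.2))// ler_norm.
Qed.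

Lemma radE_pairing N (y : nat -> dual X) (v : nat -> X) (mu : R) : 0 < mu ->
  nrm (\sum_(k < N) (y k (v k) : C)) <= mu * radE N y sqn + mu^-1 * radE N v sqn.
Proof.
move=> mu0; rewrite (le_trans (nrm_ReIm _))//.
have fsum (f : C -> R) : (forall a b, f (a + b) = f a + f b) ->
    f (\sum_(k < N) (y k (v k) : C)) = \sum_(k < N) f (y k (v k)).
  move=> fD; have f0 : f 0 = 0 by apply: (addrI (f 0)); rewrite -fD !addr0.
  by elim/big_rec2: _ => // k a b _ <-; rewrite fD.
rewrite (fsum (@complex.Re R)) ?(fsum (@complex.Im R)); try by case=> a b [].
have H1 := @radE_pairing_part (@complex.Re R) N y v mu _ (@Re_nrm R) mu0.
have H2 := @radE_pairing_part (@complex.Im R) N y v mu _ (@Im_nrm R) mu0.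
rewrite [leRHS]splitr lerD//; [apply: H1|apply: H2]; by case=> a b [].
Qed.

End Pairing.

Lemma bop_mulE {R : realType} {X : normedModType R[i]} (A B : bop X X) x : (A * B) x = A (B x).
Proof. by []. Qed.

Lemma bop_1BE {R : realType} {X : normedModType R[i]} (A : bop X X) x : (1 - A) x = x - A x.
Proof. by []. Qed.

Lemma bop_subE {R : realType} {V W : normedModType R[i]} (A B : bop V W) x : (A - B) x = A x - B x.
Proof. by []. Qed.

Lemma adjoint_powE {R : realType} {X : normedModType R[i]} (T : bop X X) k (y : dual X) (x : X) :
  ((adjoint T ^+ k * (1 - adjoint T)) y) x = y (((1 - T) * T ^+ k) x).
Proof.
have pE (w : dual X) (u : X) : (adjoint T ^+ k) w u = w ((T ^+ k) u).
  elim: k u => [//|k IH] u; rewrite exprS [RHS](_ : _ = w ((T ^+ k) (T u))).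
    exact: (IH (T u)).
  by rewrite exprSr.
rewrite !bop_mulE pE !bop_1BE bop_subE.
exact/esym/(linearB y).
Qed.

Lemma spoly_exp {R : realType} {X : normedModType R[i]} (a : R[i]^o -> R[i]^o) k :
  spoly (X := X) a -> spoly (X := X) (fun z => a z ^+ k).
Proof.
move=> sa; elim: k => [|k IH]; first exact: (spolyC 1).
rewrite (_ : (fun z => a z ^+ k.+1) = (fun z => a z * a z ^+ k)); first exact: spolyM.
by apply/funext => z; rewrite exprS.
Qed.

Lemma spoly_vsym {R : realType} {X : normedModType R[i]} k : spoly (X := X) (@vsym R k).
Proof.
have s2 := spolyM (spolyC (X := X) ((k.+2%:R)%:C : R[i]^o)) (spolyXn k).
have s3 := spoly_exp 3 (spolyD (spolyD (spolyC (X := X) (1 : R[i]^o)) (@spolyX R X)) (spolyXn 2)).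
exact: (spolyM (spolyM s2 s3) (@spoly1B R X)).
Qed.

(** * The decomposition of phi(T), for finite N *)

Section Decomposition.
Context {R : realType} {X : completeNormedModType R[i]}.
Local Notation C := R[i]^o.
Variables (T : bop X X) (b0 b g : R) (phi : C -> C).
Hypotheses (b00 : 0 < b0) (b0b : b0 < b) (bg : b < g) (gpi : g < pi / 2).
Local Notation U := (~` closure (stolz b0) : set C).
Hypothesis specU : spectrum T `<=` ~` U.
Hypothesis Hphi : Hinfty0 g phi.
Local Notation r := (sin b).
Local Notation th := (pi / 2 - b).
Local Notation V n k := (Lsum r th n (fun z => (phi z * vsym k z) *: resolvent z T)).
Local Notation tsym k z := ((1 - z) * (z ^+ k * ((1 - z) * (z ^+ k * vsym k z)))).

(* Replacing z by T in the symbol only changes the contour sums by moments of phi,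
   which vanish in the limit. *)
Lemma contour_multiplier k :
  Lsum r th n (fun z => (phi z * tsym k z) *: resolvent z T) -
  (1 - T) * T ^+ k * (V n k * (T ^+ k * (1 - T))) @[n --> \oo] --> (0 : bop X X).
Proof.
have s0 : symb T U (vsym k) (fun z => vsym k z *: resolvent z T).
  split; first exact: spoly_vsym.
  by exists (fun=> 0) => [|z _]; [exact: opoly_const|rewrite addr0].
have [_ [E oE HE]] := symb_left specU k (symb_right specU k s0).
rewrite (_ : (fun n => _) = (fun n => - Lsum r th n (fun z => phi z *: E z))).
  by rewrite -oppr0; apply: cvgN; exact: (contour_opoly b00 b0b bg gpi Hphi oE).
apply/funext => n.
rewrite Lsum_mulr Lsum_mull.
rewrite (eq_contour b00 b0b bg gpi n (F := fun z => (1 - T) * T ^+ k * _)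
  (G := fun z => (phi z * tsym k z) *: resolvent z T + phi z *: E z)).
  by rewrite LsumD opprD addrA subrr add0r.
move=> z Uz _; rewrite -(scalerA (phi z) (vsym k z)) -(scalerA (phi z) (tsym k z)) -scalerDr -HE//.
by rewrite bop_scaleAl bop_scaleAr.
Qed.

(** [symbol_identity], multiplied by phi(z) R(z, T) and summed over the contour, holds exactly for
    each n; only the passage from z to T in the finitely many terms is asymptotic. *)
Lemma contour_decomposition N :
  Lsum r th n (fun z => phi z *: resolvent z T) *+ 2 -
  Lsum r th n (fun z => (phi z * rsym N z) *: resolvent z T) -
  \sum_(k < N) ((k.+1%:R)%:C : C) *: ((1 - T) * T ^+ k * (V n k * (T ^+ k * (1 - T))))
  @[n --> \oo] --> (0 : bop X X).
Proof.
pose D k n := Lsum r th n (fun z => (phi z * tsym k z) *: resolvent z T) -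
  (1 - T) * T ^+ k * (V n k * (T ^+ k * (1 - T))).
rewrite (_ : (fun n => _) = (fun n => \sum_(k < N) ((k.+1%:R)%:C : C) *: D k n)).
  elim: N => [|N IH].
    rewrite (_ : (fun n => _) = (fun=> 0)); first exact: cvg_cst.
    by apply/funext => n; rewrite big_ord0.
  rewrite (_ : (fun n => _) = (fun n => \sum_(k < N) ((k.+1%:R)%:C : C) *: D k n +
    ((N.+1%:R)%:C : C) *: D N n)); last by apply/funext => n; rewrite big_ord_recr.
  rewrite -[0 in X in _ --> X]addr0; apply: cvgD => //.
  rewrite -[0 in X in _ --> X](scaler0 _ ((N.+1%:R)%:C : C)).
  by apply: cvgZl_tmp; exact: contour_multiplier.
apply/funext => n; rewrite /D.
under [RHS]eq_bigr do rewrite scalerBr.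
rewrite sumrB; congr (_ - _).
under [RHS]eq_bigr do rewrite -LsumZ.
rewrite -(@Lsum_sum _ _ _ _ n _ (index_enum 'I_N)) -scaler_nat -LsumZ -scaleN1r -LsumZ -LsumD.
congr Lsum; apply/funext => z.
rewrite -(symbol_identity N z) !scalerA -scalerDl.
under [RHS]eq_bigr do rewrite scalerA.
rewrite -scaler_suml; congr (_ *: _).
rewrite [X in X = _](_ : _ = phi z * \sum_(k < N) ((k.+1%:R)%:C : C) * tsym k z).
  by rewrite mulr_sumr; apply: eq_bigr => k _; rewrite mulrCA.
by ring.
Qed.

End Decomposition.

(** * The norm of the contour integral *)

Section ContourNorm.
Context {R : realType} {X : completeNormedModType R[i]}.
Local Notation C := R[i]^o.
Variables (T : bop X X) (b0 b g : R) (phi : C -> C) (M CR CE Cs : R).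
Hypotheses (b00 : 0 < b0) (b0b : b0 < b) (bg : b < g) (gpi : g < pi / 2).
Local Notation U := (~` closure (stolz b0) : set C).
Hypothesis specU : spectrum T `<=` ~` U.
Hypothesis Hphi : Hinfty0 g phi.
Hypotheses (M0 : 0 < M) (phiM : forall z, stolz g z -> nrm (phi z) <= M).
Hypotheses (CR0 : 0 <= CR) (RsB : forall z, U z -> nrm ((z - 1) *: resolvent z T) <= CR).
Hypotheses (CE0 : 0 <= CE) (resE : forall n (S : nat -> bop X X) (x : nat -> X),
  (forall k, (k < n)%N -> resolvents T b0 (S k)) ->
  radE n (fun k => S k (x k)) sqn <= CE * radE n x sqn).
Hypothesis sqx : forall x N,
  radE N (fun k => (Num.sqrt k.+1%:R)%:C *: (T ^+ k * (1 - T)) x) sqn <= 2 * (Cs * nrm x) ^+ 2.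
Hypothesis sqy : forall y N,
  radE N (fun k => (Num.sqrt k.+1%:R)%:C *: (adjoint T ^+ k * (1 - adjoint T)) y) sqn <=
    2 * (Cs * nrm y) ^+ 2.
Local Notation r := (sin b).
Local Notation th := (pi / 2 - b).
Local Notation d := (1 - sin g).
Local Notation V n k := (Lsum r th n (fun z => (phi z * vsym k z) *: resolvent z T)).
Local Notation F := (fun z => phi z *: resolvent z T).

(** The square functions bound the averages by 2 Cs^2 on the side of x and, as the functional has
    norm at most 2, by 8 Cs^2 on the dual side; 80 is 40 times the former 2. *)
Lemma main_term_bound n N (x : X) (y : dual X) : (0 < n)%N -> nrm x <= 1 -> nrm y <= 2 ->
  nrm (y ((\sum_(k < N) ((k.+1%:R)%:C : C) *:
    ((1 - T) * T ^+ k * (V n k * (T ^+ k * (1 - T))))) x) : C) <=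
  M * (8 * Cs ^+ 2 + 80 * (432 / d) ^+ 2 * CE * Cs ^+ 2).
Proof.
move=> n0 x1 y2.
pose a k := (Num.sqrt k.+1%:R)%:C *: (T ^+ k * (1 - T)) x.
pose c k := (Num.sqrt k.+1%:R)%:C *: (adjoint T ^+ k * (1 - adjoint T)) y.
have E : y ((\sum_(k < N) ((k.+1%:R)%:C : C) *:
    ((1 - T) * T ^+ k * (V n k * (T ^+ k * (1 - T))))) x) = \sum_(k < N) c k (V n k (a k)).
  rewrite sum_bopE linear_sum; apply: eq_bigr => k _.
  move: (V n k : bop X X) => W; pose s : C := (Num.sqrt k.+1%:R)%:C.
  have ss : s * s = (k.+1%:R)%:C by rewrite /s -rmorphM /= -expr2 sqr_sqrtr// ler0n.
  pose u : X := (T ^+ k * (1 - T)) x.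
  transitivity ((k.+1%:R)%:C *: (y (((1 - T) * T ^+ k) (W u)) : C)); first exact: linearZ.
  rewrite -ss -scalerA -adjoint_powE /c /a.
  transitivity (s *: (((adjoint T ^+ k * (1 - adjoint T)) y) (W (s *: u)))); last by [].
  move: ((adjoint T ^+ k * (1 - adjoint T)) y : dual X) => z.
  have -> : W (s *: u) = s *: W u by exact: linearZ.
  by have -> : z (s *: W u) = s *: z (W u) by exact: linearZ.
(* The AM-GM weight is M: the average of V_k (a k) is of order M^2, and M^-1 makes it linear in
   M. *)
rewrite E; apply: le_trans (radE_pairing N c (fun k => V n k (a k)) M0) _.
have Ha : radE N a sqn <= 2 * Cs ^+ 2.
  rewrite (le_trans (sqx x N))// ler_wpM2l// exprMn ler_piMr ?sqr_ge0//.
  by rewrite exprn_ile1// nrm_ge0.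
have Hc : radE N c sqn <= 8 * Cs ^+ 2.
  rewrite (le_trans (sqy y N))// exprMn.
  have : nrm y ^+ 2 <= 2 ^+ 2 by rewrite lerXn2r ?nnegrE ?nrm_ge0.
  by move=> /(ler_wpM2l (sqr_ge0 Cs)); lra.
have HV := contour_Rbound b00 b0b bg gpi M0 phiM CE0 resE N a n0.
rewrite [leRHS](_ : _ = M * (8 * Cs ^+ 2) +
  M^-1 * (40 * (432 / d * M) ^+ 2 * CE * (2 * Cs ^+ 2))); last first.
  move: (432 / d) => L; field; exact: lt0r_neq0.
apply: lerD; first by rewrite ler_wpM2l// ltW.
rewrite ler_wpM2l ?invr_ge0 ?(ltW M0)//; apply: le_trans HV _.
exact: (ler_wpM2l (mulr_ge0 (mulr_ge0 (ler0n _ 40) (sqr_ge0 _)) CE0) Ha).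
Qed.

Lemma contour_norm : nrm (stolz_boundary_integral b F : bop X X) <=
  M * (8 * Cs ^+ 2 + 80 * (432 / d) ^+ 2 * CE * Cs ^+ 2).
Proof.
set B := leRHS; set Phi := stolz_boundary_integral b F.
rewrite nrm_bop; apply: opnorm_lub => x x1.
have [y y2 xy] := hahn_banach (Phi x).
apply/ler_addgt0Pr => e e0.
(* Applying a functional of norm at most 2 to the three errors costs 2 * 2 * e / 8 + 2 * e / 8 + 2 *
   e / 8 = e. *)
have e8 : 0 < e / 8 by rewrite divr_gt0// ltr0n.
have [N N0 HN] := contour_remainder b00 b0b bg gpi CR0 RsB Hphi e8.
have /cvg_nrmP/(_ _ e8)[N1 _ HN1] := Lsum_cvg b00 b0b bg gpi specU CR0 RsB Hphi.
have /cvg_nrmP/(_ _ e8)[N2 _ HN2] := contour_decomposition b00 b0b bg gpi specU Hphi N.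
pose n := maxn N1 N2.
have h1 : nrm (Phi - Lsum r th n.+1 F) < e / 8 by apply: HN1; exact: leq_maxl.
have h2 : nrm (Lsum r th n.+1 F *+ 2 - Lsum r th n.+1 (fun z => (phi z * rsym N z) *: resolvent z T) -
    \sum_(k < N) ((k.+1%:R)%:C : C) *: ((1 - T) * T ^+ k * (V n.+1 k * (T ^+ k * (1 - T))))) < e / 8.
  by rewrite -nrmN -sub0r; apply: HN2; rewrite /= leqW ?leq_maxr.
have h3 := HN n.+1.
have h4 := main_term_bound N (ltn0Sn n) x1 y2.
move: h1 h2 h3 h4; rewrite -/B.
set L := Lsum _ _ _ F; set S := \sum_(k < N) _; set Q := Lsum _ _ _ _.
clearbody L S Q B Phi => h1 h2 h3 h4.
have yn (A : bop X X) : nrm (y (A x) : C) <= 2 * nrm A.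
  rewrite (le_trans (opnorm_le y _))// -nrm_bop ler_pM ?nrm_ge0//.
  rewrite (le_trans (opnorm_le A x))// -nrm_bop -[leRHS]mulr1.
  by rewrite ler_wpM2l ?nrm_ge0.
have split : y (Phi x) *+ 2 = y (((Phi - L) *+ 2) x) + y ((L *+ 2 - Q - S) x) + y (Q x) + y (S x).
  have EP : (Phi - L) *+ 2 + (L *+ 2 - Q - S) + Q + S = Phi *+ 2.
    rewrite mulrnBl -[L *+ 2 - Q - S]addrA subrKA -!addrA.
    by rewrite (addrC Q S) addKr addNr addr0.
  by rewrite -!linearD -!bopDE EP -raddfMn; congr (y _).
have y1 := yn ((Phi - L) *+ 2); have y3 := yn (L *+ 2 - Q - S); have y4 := yn Q.
have n2 : nrm ((Phi - L) *+ 2) <= 2 * nrm (Phi - L).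
  by rewrite mulr2n (le_trans (nrmD _ _))// mulr_natl mulr2n.
have t : nrm (y (Phi x) *+ 2 : C) <= nrm (y (((Phi - L) *+ 2) x) : C) +
   nrm (y ((L *+ 2 - Q - S) x) : C) + nrm (y (Q x) : C) + nrm (y (S x) : C).
  by rewrite split (le_trans (nrmD _ _))// lerD2r (le_trans (nrmD _ _))// lerD2r nrmD.
have t2 : nrm (y (Phi x) *+ 2 : C) = 2 * nrm (y (Phi x) : C).
  by rewrite -scaler_nat nrmZ -(rmorph_nat (real_complex R)) nrm_pnat.
have := nrm_ge0 (y (Phi x) : C); lra.
Qed.

End ContourNorm.

Lemma Rbounded_bounded {R : realType} {d : measure_display} {M : measurableType d}
    {P : probability M R} {eps : nat -> {RV P >-> R}} {X : normedModType R[i]}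
    (E : set (bop X X)) : rademacher_sequence eps -> Rbounded eps E ->
  exists2 C : R, 0 <= C & forall A, E A -> nrm A <= C.
Proof.
move=> eps_rad RE; have [C C0 HC] := Rbounded_radE eps_rad RE.
exists (Num.sqrt C) => [|A EA]; first exact: sqrtr_ge0.
rewrite nrm_bop; apply: opnorm_lub => x x1.
have := HC 1%N (fun=> A) (fun=> x) (fun _ _ => EA).
rewrite /= /sqn !add0r !nrmN => H.
rewrite -(@ler_pXn2r _ 2) ?nnegrE ?nrm_ge0 ?sqrtr_ge0// sqr_sqrtr//.
have : C * nrm x ^+ 2 <= C by rewrite ler_piMr// exprn_ile1// nrm_ge0.
by lra.
Qed.

Lemma bounded_set_nrm {R : realType} {V : normedModType R[i]} (E : set V) (C : R) :
  (forall v, E v -> nrm v <= C) -> bounded_set E.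
Proof.
move=> EC; exists C%:C; split; first by rewrite complex_real.
by move=> x Cx v /EC vC /=; rewrite -nrmE (le_trans _ (ltW Cx))// lecR.
Qed.

Lemma sup_stolz_ub {R : realType} (g : R) (phi : R[i]^o -> R[i]^o) z : Hinfty0 g phi ->
  stolz g z -> nrm (phi z) <= sup_stolz g phi.
Proof.
case=> _ [M HM] _ gz; apply: sup_upper_bound; last by exists z.
by split; [exists (nrm (phi z)), z|exists M => _ [w gw <-]; exact: HM].
Qed.

Lemma nrm_cauchy_factor {R : realType} : nrm ((2 * pi%:C * 'i)^-1 : R[i]^o) <= 1.
Proof.
pose u : R[i]^o := 2 * pi%:C * 'i.
have nu : 1 <= nrm u.
  rewrite /u (nrmM (2 * pi%:C)) nrmi mulr1 (nrmM 2) -(rmorph_nat (real_complex R)) nrm_pnat.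
  by rewrite nrm_real ger0_norm ?pi_ge0//; have := pi_ge2 R; lra.
have u0 : (u : R[i]) != 0 by apply/eqP => u0; move: nu; rewrite u0 nrm0 ler10.
have : nrm u * nrm ((u : R[i])^-1 : R[i]^o) = 1 by rewrite -nrmM mulfV// nrm1.
by move=> H; rewrite -H -[leLHS]mul1r ler_wpM2r// nrm_ge0.
Qed.

Theorem theorem7p3 (R : realType) (d : measure_display) (M : measurableType d)
    (P : probability M R) (eps : nat -> {RV P >-> R})
    (X : completeNormedModType R[i]) (T : bop X X) (alpha : R) :
  rademacher_sequence eps ->
  0 < alpha < pi / 2 ->
  Rritt_of_Rtype eps T alpha ->
  (exists C : R, [/\ 0 < C,
     forall x : X, (square_norm eps T x <= (C * nrm x)%:E)%E &
     forall y : dual X, (square_norm eps (adjoint T) y <= (C * nrm y)%:E)%E]) ->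
  forall gamma : R, alpha < gamma < pi / 2 -> bounded_Hinfty_calculus T gamma.
Proof.
move=> eps_rad _ [[Rpow Rdiff] /andP[a0 api] specT Rres] [Cs [Cs0 sqX sqY]] g /andP[ag gpi].
(* The type exhibited is [a'], not alpha; with [b0] between the two, b0 < b for every admissible
   contour. *)
have [a' a'E] : exists a', a' = (alpha + g) / 2 by exists ((alpha + g) / 2).
have [b0 b0E] : exists b0, b0 = (alpha + a') / 2 by exists ((alpha + a') / 2).
have [aa' a'g] : alpha < a' /\ a' < g by split; lra.
have [ab0 b0a'] : alpha < b0 /\ b0 < a' by split; lra.
have b00 : 0 < b0 by lra.
have pi0 := pi_gt0 R.
have spec_mono b : alpha < b < pi / 2 -> spectrum T `<=` closure (stolz b).
  move=> /andP[ab bpi]; apply: (subset_trans specT); apply: closure_subset.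
  by apply: stolz_mono; rewrite ltW// ltr_sin// in_itv /=; apply/andP; split; lra.
have bounded b : alpha < b < pi / 2 ->
    exists2 C : R, 0 <= C & forall A, resolvents T b A -> nrm A <= C.
  by move=> Hb; exact: (Rbounded_bounded eps_rad (Rres b Hb)).
exists a'; split => //.
  split.
  - split.
      by have [C _ HC] := Rbounded_bounded eps_rad Rpow; exact: (bounded_set_nrm HC).
    by have [C _ HC] := Rbounded_bounded eps_rad Rdiff; exact: (bounded_set_nrm HC).
  - by apply/andP; split; lra.
  - by apply: spec_mono; apply/andP; split; lra.
  - move=> b /andP[a'b bpi]; have [|C _ HC] := bounded b; first by apply/andP; split; lra.
    exact: (bounded_set_nrm HC).
have b0int : alpha < b0 < pi / 2 by apply/andP; split; lra.
have [CR CR0 HR] := bounded b0 b0int.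
have [CE CE0 HE] := Rbounded_radE eps_rad (Rres b0 b0int).
have [K0 K0E] : exists K0 : R, K0 =
    8 * Cs ^+ 2 + 80 * (432 / (1 - sin g)) ^+ 2 * CE * Cs ^+ 2 by eexists.
have K00 : 0 <= K0.
  rewrite K0E; apply: addr_ge0; first exact: (mulr_ge0 (ler0n _ 8) (sqr_ge0 _)).
  exact: (mulr_ge0 (mulr_ge0 (mulr_ge0 (ler0n _ 80) (sqr_ge0 _)) CE0) (sqr_ge0 _)).
exists (K0 + 1) => [|phi Hphi b /andP[a'b bg]]; first by rewrite ltr_wpDl.
have [S SE] : exists S, S = sup_stolz g phi by eexists.
rewrite -SE.
have phiS z : stolz g z -> nrm (phi z) <= S by move=> gz; rewrite SE; exact: sup_stolz_ub.
have S0 : 0 <= S.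
  apply: le_trans (nrm_ge0 (phi 0)) (phiS 0 _); apply: (@drop_stolz _ 0).
    by rewrite lexx sin_gt0_pi//; apply/andP; split; lra.
  by apply: drop_disc; rewrite nrm0.
rewrite /fcalc nrmZ; apply/ler_addgt0Pr => e e0.
(* [contour_norm] needs a positive bound for |phi|, while the supremum S may be 0; S + e / (K0 + 1)
   is used instead, at a final cost of at most e. *)
have e'0 : 0 < e / (K0 + 1) by rewrite divr_gt0// ltr_wpDl.
have b0b : b0 < b by lra.
have specU : spectrum T `<=` ~` (~` closure (stolz b0)) by rewrite setCK; exact: spec_mono.
have main : nrm (stolz_boundary_integral b (fun z => phi z *: resolvent z T) : bop X X) <=
    (S + e / (K0 + 1)) * K0.
  rewrite {2}K0E; apply: (contour_norm b00 b0b bg gpi specU Hphi _ _ CR0 _ CE0 HE).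
  - by rewrite ltr_wpDl.
  - by move=> z /phiS zS; rewrite (le_trans zS)// lerDl ltW.
  - by move=> z Uz; apply: HR; exists z.
  - move=> x N; exact: (square_norm_radE eps_rad (mulr_ge0 (ltW Cs0) (nrm_ge0 x)) (sqX x)).
  - move=> y N; exact: (square_norm_radE eps_rad (mulr_ge0 (ltW Cs0) (nrm_ge0 y)) (sqY y)).
apply: (@le_trans _ _ (1 * ((S + e / (K0 + 1)) * K0))).
  by rewrite ler_pM ?nrm_ge0// nrm_cauchy_factor.
have eK : e / (K0 + 1) * K0 <= e.
  by rewrite -mulrA ler_piMr ?(ltW e0)// mulrC ler_pdivrMr ?ltr_wpDl// mul1r lerDl.
by rewrite mul1r mulrDl; lra.
Qed.
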